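(* Let $G$ be a connected compact Lie group equipped with its normalized Haar measure $\mu_G$. Let $X=(X_1,\ldots,X_m)$ be a family of left-invariant Hörmander vector fields. Suppose that $1<p<\infty$. Then there exists a constant $C$ depending only on $p,G,X$ such that $$\Bigl\|f-\int_G f\,\mathrm{d}\mu_G\Bigr\|_{\mathrm{L}^p(G)}\leq C\,\|\nabla_p(f)\|_{\mathrm{L}^p(G,\ell^p_m)},\quad f\in\mathrm{dom}\,\nabla_p.$$
   Context: A family of left-invariant Hörmander vector fields on a connected Lie group $G$ with identity $e$ is a finite sequence $X=(X_1,\ldots,X_m)$ of left-invariant smooth vector fields which generate the Lie algebra of $G$ and such that $X_1(e),\ldots,X_m(e)$ are linearly independent. The subelliptic gradient $\nabla\colon\mathrm{C}^\infty_c(G)\subset\mathrm{L}^p(G)\to\mathrm{L}^p(G,\ell^p_m)$, $f\mapsto(X_1f,\ldots,X_mf)$, is closable and $\nabla_p$ denotes its closure. In the inequality, $\int_G f\,\mathrm{d}\mu_G$ is identified with a constant function. *)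

(* Defs.v *)
From HB Require Import structures.
From mathcomp Require Import all_boot all_order all_algebra.
From mathcomp Require Import all_classical all_reals all_analysis.
From mathcomp Require Export complex.

Set Implicit Arguments.
Unset Strict Implicit.
Unset Printing Implicit Defensive.

Import Order.TTheory GRing.Theory Num.Theory numFieldNormedType.Exports.

Local Open Scope classical_set_scope.
Local Open Scope ring_scope.

(** * Smooth functions on open subsets of R^n *)

Definition partial (R : realType) (n : nat) (i : 'I_n)
    (f : 'rV[R]_n -> R) : 'rV[R]_n -> R :=
  fun x => 'D_(delta_mx 0 i) f x.

(** Only meaningful for [U] open: the derivatives at a point of [U] then depend
    on the values of [f] on [U] alone. *)
Fixpoint class_C (R : realType) (n k : nat) (U : set 'rV[R]_n)
    (f : 'rV[R]_n -> R) : Prop :=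
  {in U, continuous f} /\
  match k with
  | 0 => True
  | k'.+1 => forall i : 'I_n,
      {in U, forall x, derivable f x (delta_mx 0 i)} /\
      class_C k' U (partial i f)
  end.

Definition smooth_on (R : realType) (n : nat) (U : set 'rV[R]_n)
    (f : 'rV[R]_n -> R) : Prop :=
  forall k, class_C k U f.

(** * Manifolds *)

(** The values of [chart_map] off [chart_dom], and of [chart_inv] off
    [chart_im], are irrelevant. *)
Record chart (R : realType) (n : nat) (M : Type) := Chart {
  chart_dom : set M;
  chart_map : M -> 'rV[R]_n;
  chart_inv : 'rV[R]_n -> M
}.

Definition chart_im (R : realType) (n : nat) (M : Type) (c : chart R n M) :=
  chart_map c @` chart_dom c.

Definition is_chart (R : realType) (n : nat) (M : topologicalType)
    (c : chart R n M) : Prop :=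
  [/\ open (chart_dom c),
      open (chart_im c),
      {in chart_dom c, cancel (chart_map c) (chart_inv c)},
      {in chart_dom c, continuous (chart_map c)} &
      {in chart_im c, continuous (chart_inv c)}].

Definition is_atlas (R : realType) (n : nat) (M : topologicalType)
    (A : set (chart R n M)) : Prop :=
  [/\ forall c, A c -> is_chart c,
      forall x : M, exists2 c, A c & chart_dom c x &
      forall c d, A c -> A d -> forall j : 'I_n,
        smooth_on (chart_map c @` (chart_dom c `&` chart_dom d))
                  (fun z => chart_map d (chart_inv c z) 0 j)].

Definition prod_chart (R : realType) (n n' : nat) (M M' : Type)
    (c : chart R n M) (c' : chart R n' M') : chart R (n + n') (M * M') :=
  Chart (chart_dom c `*` chart_dom c')
        (fun x => row_mx (chart_map c x.1) (chart_map c' x.2))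
        (fun z => (chart_inv c (lsubmx z), chart_inv c' (rsubmx z))).

Definition prod_atlas (R : realType) (n n' : nat) (M M' : Type)
    (A : set (chart R n M)) (A' : set (chart R n' M')) :
    set (chart R (n + n') (M * M')) :=
  [set d | exists c c', [/\ A c, A' c' & d = prod_chart c c']].

Definition smooth_map (R : realType) (n n' : nat) (M N : topologicalType)
    (A : set (chart R n M)) (B : set (chart R n' N)) (F : M -> N) : Prop :=
  continuous F /\
  forall c d, A c -> B d -> forall j : 'I_n',
    smooth_on (chart_map c @` (chart_dom c `&` F @^-1` chart_dom d))
              (fun z => chart_map d (F (chart_inv c z)) 0 j).

(** * Lie groups *)

(** The distinguished point carried by [PointedTopological] is arbitrary; the
    measure theory library requires one. *)
HB.mixin Record isLieGroup (R : realType) (n : nat) G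
    of Group G & PointedTopological G := {
  atlas : set (chart R n G);
  atlasP : is_atlas atlas;
  lie_hausdorff : hausdorff_space G;
  lie_second_countable : @second_countable G;
  lie_mul_smooth :
    smooth_map (prod_atlas atlas atlas) atlas
               (fun xy : G * G => (xy.1 * xy.2)%g);
  lie_inv_smooth : smooth_map atlas atlas (fun x : G => x^-1%g)
}.

#[short(type="lieGroupType")]
HB.structure Definition LieGroup (R : realType) (n : nat) :=
  {G of isLieGroup R n G & Group G & PointedTopological G}.

Definition smooth (R : realType) (n : nat) (G : lieGroupType R n)
    (f : G -> R) : Prop :=
  forall c : chart R n G, atlas c ->
    smooth_on (chart_im c) (fun z => f (chart_inv c z)).

(** * Vector fields *)

(** A tangent vector at [x] is a derivation at [x] of the algebra of smooth
    functions. It is represented by a functional on all functions, of which only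
    the values on smooth functions matter. *)
Definition tangent_vector (R : realType) (n : nat) (G : lieGroupType R n)
    (x : G) (v : (G -> R) -> R) : Prop :=
  (forall (a : R) (f g : G -> R), smooth f -> smooth g ->
     v (fun y => a * f y + g y) = a * v f + v g) /\
  (forall f g : G -> R, smooth f -> smooth g ->
     v (fun y => f y * g y) = f x * v g + g x * v f).

Definition vfield (R : realType) (G : Type) := G -> (G -> R) -> R.

Definition vector_field (R : realType) (n : nat) (G : lieGroupType R n)
    (X : vfield R G) : Prop :=
  (forall x, tangent_vector x (X x)) /\
  (forall f : G -> R, smooth f -> smooth (fun x => X x f)).

Definition eq_field (R : realType) (n : nat) (G : lieGroupType R n)
    (X Y : vfield R G) : Prop :=
  forall (x : G) (f : G -> R), smooth f -> X x f = Y x f.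

(** [fun f => X x (fun y => f (g * y))] is the image of [X x] under the
    differential at [x] of the left translation by [g]. *)
Definition left_invariant (R : realType) (n : nat) (G : lieGroupType R n)
    (X : vfield R G) : Prop :=
  forall (g x : G) (f : G -> R), smooth f ->
    X (g * x)%g f = X x (fun y => f (g * y)%g).

Definition bracket (R : realType) (G : Type) (X Y : vfield R G) : vfield R G :=
  fun x f => X x (fun y => Y y f) - Y x (fun y => X y f).

Inductive lie_span (R : realType) (G : Type) (m : nat)
    (X : 'I_m -> vfield R G) : vfield R G -> Prop :=
| lie_span_gen i : lie_span X (X i)
| lie_span0 : lie_span X (fun _ _ => 0)
| lie_spanD a Y Z : lie_span X Y -> lie_span X Z ->
    lie_span X (fun x f => a * Y x f + Z x f)
| lie_span_bracket Y Z : lie_span X Y -> lie_span X Z ->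
    lie_span X (bracket Y Z).

(** The Lie algebra of [G] is the space of left-invariant vector fields. *)
Definition hormander (R : realType) (n : nat) (G : lieGroupType R n) (m : nat)
    (X : 'I_m -> vfield R G) : Prop :=
  [/\ forall i, vector_field (X i) /\ left_invariant (X i),
      forall Y : vfield R G, vector_field Y -> left_invariant Y ->
        exists2 Z, lie_span X Z & eq_field Y Z &
      forall a : 'I_m -> R,
        (forall f : G -> R, smooth f -> \sum_(i < m) a i * X i 1%g f = 0) ->
        forall i, a i = 0].

(** * Haar measure *)

Notation borel G := (g_sigma_algebraType (@open G)).

(** On a compact Lie group a Borel probability measure is automatically
    regular. *)
Definition normalized_haar (R : realType) (n : nat) (G : lieGroupType R n)
    (mu : probability (borel G) R) : Prop :=
  forall (g : G) (A : set (borel G)), measurable A ->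
    mu ((fun x : G => (g * x)%g) @` A) = mu A.

(** * Complex L^p spaces and the closure of the subelliptic gradient *)

Section Lp.
Context (R : realType) (n : nat) (G : lieGroupType R n).
Variable mu : probability (borel G) R.

Definition measurable_C (f : G -> R[i]) : Prop :=
  measurable_fun [set: borel G] (fun x : borel G => complex.Re (f x)) /\
  measurable_fun [set: borel G] (fun x : borel G => complex.Im (f x)).

Definition mean (f : G -> R[i]) : R[i] :=
  Complex (\int[mu]_x complex.Re (f x)) (\int[mu]_x complex.Im (f x)).

Definition normLp (p : R) (f : G -> R[i]) : \bar R :=
  Lnorm mu p%:E (fun x : borel G => (ComplexField.Normc.normc (f x))%:E).

Definition mem_Lp (p : R) (f : G -> R[i]) : Prop :=
  measurable_C f /\ (normLp p f < +oo)%E.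

Definition norm_lp (p : R) (m : nat) (v : 'rV[R[i]]_m) : R :=
  (\sum_(i < m) ComplexField.Normc.normc (v 0 i) `^ p) `^ p^-1.

Definition normLp_lp (p : R) (m : nat) (g : G -> 'rV[R[i]]_m) : \bar R :=
  Lnorm mu p%:E (fun x : borel G => (norm_lp p (g x))%:E).

Definition mem_Lp_lp (p : R) (m : nat) (g : G -> 'rV[R[i]]_m) : Prop :=
  (forall i, measurable_C (fun x => g x 0 i)) /\ (normLp_lp p g < +oo)%E.

Definition smooth_compact_support (u : G -> R[i]) : Prop :=
  [/\ smooth (fun x => complex.Re (u x)),
      smooth (fun x => complex.Im (u x)) &
      compact (closure [set x | u x != 0])].

Definition gradient (m : nat) (X : 'I_m -> vfield R G) (u : G -> R[i]) :
    G -> 'rV[R[i]]_m :=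
  fun x => \row_(i < m) Complex (X i x (fun y => complex.Re (u y)))
                                (X i x (fun y => complex.Im (u y))).

(** [nabla_p X p f g]: the pair [(f, g)] is in the closure, in
    L^p(G) x L^p(G, l^p_m), of the graph of the gradient on the smooth compactly
    supported functions, that is, [f] is in the domain of the closed operator
    nabla_p and [g] = nabla_p f. *)
Definition nabla_p (m : nat) (X : 'I_m -> vfield R G) (p : R)
    (f : G -> R[i]) (g : G -> 'rV[R[i]]_m) : Prop :=
  [/\ mem_Lp p f, mem_Lp_lp p g &
      forall eps : R, 0 < eps -> exists u : G -> R[i],
        [/\ smooth_compact_support u,
            (normLp p (fun x => u x - f x)%R < eps%:E)%E &
            (normLp_lp p (fun x => gradient X u x - g x)%R < eps%:E)%E]].

End Lp.

(* Main.v *)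
(** Call a point [g] of [G] of cost [K] if [|f(.g) - f|_p <= K * sum_i |X_i f|_p] for
    every smooth real [f]. By right invariance of [mu], costs add up under products.
    Points reached by following [X_i] for a time [t] have cost [|t|]; a commutator of
    points of cost [O(s)], which moves at scale [s^(a+b)] along a bracket, still has
    cost [O(s)]. By Hormander's condition all directions are obtained in this way, so
    a neighbourhood of [1] has bounded cost, hence so has [G], which is connected and
    compact. Averaging [|f(xg) - f(x)|^p] over [g] and [x] yields the inequality for
    smooth [f], and the closed gradient is reached by density. *)
From HB Require Import structures.
Require Import Defs.
From mathcomp Require Import all_boot all_order all_algebra.
From mathcomp Require Import all_classical all_reals all_analysis measurable_realfun.
From mathcomp Require Import ring lra.
Import Order.TTheory GRing.Theory Num.Theory numFieldNormedType.Exports.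
Local Open Scope classical_set_scope.
Local Open Scope ring_scope.
Set Implicit Arguments.
Unset Strict Implicit.
Unset Printing Implicit Defensive.

(** * Calculus on row vectors *)

(** The fields are derivations on globally defined smooth functions, and no integral curve or
    exponential map is used. Everything is read in one chart centred at the identity: Hadamard's
    lemma gives a left-invariant field constant coordinates, and the second-order expansion of the
    group law turns brackets of fields into an antisymmetric bilinear map, [comm_bil]. A
    displacement of size s^a is realised only up to an error of order s^(a+1); errors of this kind
    are stable under products and commutators, and different orders a are aligned by replacing s
    with a power of s. They are removed by iterating at scales s, s/2, s/4, ..., with summable
    costs. What is left is a factor close to 1, whose effect on a fixed smooth f is uniformly small.
    It can be neglected because the cost is a constant independent of f, so that one may fix f and
    let the remaining factor tend to 1. The final constant is 2mK, where K bounds the cost on G, m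
    counts the fields, and 2 comes from treating real and imaginary parts separately. *)

Lemma coord_le_norm (R : realType) n (v : 'rV[R]_n) i : `|v 0 i| <= `|v|.
Proof.
rewrite [leRHS]/Num.Def.normr/= mx_normrE.
exact: (@le_bigmax _ R _ _ (fun i : 'I_1 * 'I_n => `|v i.1 i.2|) (0, i)).
Qed.

Lemma norm_leP (R : realType) n (v : 'rV[R]_n) (e : R) : 0 <= e ->
  (forall i, `|v 0 i| <= e) -> `|v| <= e.
Proof.
move=> e0 h; rewrite [leLHS]/Num.Def.normr/= mx_normrE.
by apply: bigmax_le => // -[i j] _ /=; rewrite ord1.
Qed.

Lemma line_is_derive (R : realType) (V : normedModType R) (f : V -> R) (a v : V) (s : R) :
  derivable f (a + s *: v) v ->
  is_derive s (1 : R) (fun t : R => f (a + t *: v)) ('D_v f (a + s *: v)).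
Proof.
move=> df.
have E : (fun h : R => h^-1 *: (((fun t => f (a + t *: v)) \o shift s) (h *: 1) - f (a + s *: v)))
   = (fun h => h^-1 *: ((f \o shift (a + s *: v)) (h *: v) - f (a + s *: v))).
  apply/funext => h /=; congr (_ *: (f _ - _)).
  by rewrite [h%:A]mulr1 scalerDl addrCA.
by apply: DeriveDef; rewrite /derivable /derive E.
Qed.

Definition e_ (R : realType) n (i : 'I_n) : 'rV[R]_n := delta_mx 0 i.

Lemma e_E (R : realType) n (i j : 'I_n) : e_ R i 0 j = (j == i)%:R.
Proof. by rewrite mxE eqxx. Qed.

Lemma norm_box (R : realType) n (x y z : 'rV[R]_n) :
  (forall i, `|z 0 i - x 0 i| <= `|y 0 i - x 0 i|) -> `|z - x| <= `|y - x|.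
Proof.
move=> h; apply: norm_leP => // i; rewrite !mxE (le_trans (h i))//.
by have := coord_le_norm (y - x) i; rewrite !mxE.
Qed.

(** Move from [x] to [y] by changing one coordinate at a time and apply the one-variable theorem to
    each leg. For the sup norm all legs stay in the ball about [x] of radius [|y - x|]. Each
    coordinate gets its own intermediate point. *)
Lemma mean_value (R : realType) n (f : 'rV[R]_n -> R) (x y : 'rV[R]_n) :
  (forall z, `|z - x| <= `|y - x| -> forall i, derivable f z (e_ R i)) ->
  exists xi : 'I_n -> 'rV[R]_n,
    (forall i, `|xi i - x| <= `|y - x|) /\
    f y - f x = \sum_(i < n) (y 0 i - x 0 i) * partial i f (xi i).
Proof.
move=> df.
pose z k : 'rV[R]_n := \row_j (if (j < k)%N then y 0 j else x 0 j).
have z0 : z 0%N = x by apply/rowP => j; rewrite !mxE.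
have zn : z n = y by apply/rowP => j; rewrite !mxE ltn_ord.
have zS (i : 'I_n) : z i.+1 = z i + (y 0 i - x 0 i) *: e_ R i.
  apply/rowP => j; rewrite !(e_E, mxE, ltnS).
  case: (ltngtP j i) => [ji|ji|/ord_inj ->].
  - by rewrite -val_eqE /= ltn_eqF// mulr0 addr0.
  - by rewrite -val_eqE /= gtn_eqF// mulr0 addr0.
  - by rewrite eqxx mulr1 addrC subrK.
have step (i : 'I_n) : exists xi, `|xi - x| <= `|y - x| /\
    f (z i.+1) - f (z i) = (y 0 i - x 0 i) * partial i f xi.
  set d := y 0 i - x 0 i.
  have inb (s : R) : `|s| <= `|d| -> `|z i + s *: e_ R i - x| <= `|y - x|.
    move=> sd; apply: norm_box => j; rewrite !(e_E, mxE).
    case: (eqVneq j i) => [->|ji]; first by rewrite ltnn mulr1 addrC addrK.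
    by rewrite mulr0 addr0; case: ifP => // _; rewrite subrr normr0.
  have dg (s : R) : `|s| <= `|d| ->
      is_derive s (1 : R) (fun t : R => f (z i + t *: e_ R i)) (partial i f (z i + s *: e_ R i)).
    by move=> sd; apply: line_is_derive; apply: df; apply: inb.
  have cg (a b : R) : (forall s, s \in `[a, b] -> `|s| <= `|d|) ->
     {within `[a, b], continuous (fun t : R => f (z i + t *: e_ R i))}.
    move=> ab; apply: derivable_within_continuous => s /ab /dg [//].
  (* The one-variable theorem needs an ordered segment, hence the two signs of the increment. *)
  have [d0|d0] := lerP 0 d.
    have [| |c c0] := @MVT_segment R (fun t : R => f (z i + t *: e_ R i)) (fun s => partial i f (z i + s *: e_ R i)) 0 d d0.
    - move=> s; rewrite in_itv /= => /andP[s0 sd]; apply: dg.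
      by rewrite !ger0_norm// ltW.
    - by apply: cg => t; rewrite in_itv /= => /andP[t0 td]; rewrite !ger0_norm.
    - rewrite subr0 scale0r addr0 zS -/d => ->.
      exists (z i + c *: e_ R i); split; last by rewrite mulrC.
      by move: c0; rewrite in_itv /= => /andP[c0 cd]; apply: inb; rewrite !ger0_norm.
  have [| |c c0] := @MVT_segment R (fun t : R => f (z i + t *: e_ R i)) (fun s => partial i f (z i + s *: e_ R i)) d 0 (ltW d0).
  - move=> s; rewrite in_itv /= => /andP[s0 sd]; apply: dg.
    by rewrite !ler0_norm ?lerN2// ltW.
  - apply: cg => t; rewrite in_itv /= => /andP[t0 td]; by rewrite (ler0_norm td) ler0_norm ?lerN2 ?(ltW d0).
  - rewrite sub0r scale0r addr0 zS -/d => h.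
    exists (z i + c *: e_ R i); split; last by rewrite -opprB h mulrN opprK mulrC.
    move: c0; rewrite in_itv /= => /andP[c0 cd]; apply: inb.
    by rewrite !ler0_norm ?lerN2// ltW.
have [xi hxi] := choice step.
exists xi; split; first by move=> i; case: (hxi i).
rewrite -[in LHS]zn -[in LHS]z0.
rewrite -(telescope_sumr (fun k => f (z k)) (leq0n n)) big_mkord.
by apply: eq_bigr => i _; case: (hxi i).
Qed.

Lemma nbhs_rVP (R : realType) n (x : 'rV[R]_n) (P : set 'rV[R]_n) :
  nbhs x P <-> exists2 r : R, 0 < r & forall y, `|y - x| < r -> P y.
Proof.
split=> [/nbhs_ballP[r r0 h]|[r r0 h]].
  by exists r => // y yr; apply: h; rewrite -ball_normE /ball_ /= distrC.
by apply/nbhs_ballP; exists r => // y; rewrite -ball_normE /ball_ /= distrC; apply: h.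
Qed.

Lemma near_continuous_at (T U : topologicalType) (f g : T -> U) (x : T) :
  (\forall y \near x, f y = g y) -> {for x, continuous f} -> {for x, continuous g}.
Proof.
move=> fg cf; rewrite /prop_for /continuous_at -(nbhs_singleton fg).
by apply: cvg_trans cf; apply: near_eq_cvg.
Qed.

Lemma cvg_sumr (R : realType) (T : Type) (F : set_system T) {FF : Filter F} (I : Type) (r : seq I)
  (f : I -> T -> R) (l : I -> R) : (forall i, f i x @[x --> F] --> l i) ->
  \sum_(i <- r) f i x @[x --> F] --> \sum_(i <- r) l i.
Proof.
by move=> h; apply: (@cvg_big R^o I +%R 0) => // x; apply: add_continuous.
Qed.

(** The intermediate points of [mean_value] tend to [x] with the increment, so continuity of the
    partial derivatives at [x] makes the linear approximation error negligible. *)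
Lemma C1_differentiable (R : realType) n (f : 'rV[R]_n -> R) (x : 'rV[R]_n) :
  (\forall z \near x, forall i, derivable f z (e_ R i)) ->
  (forall i, {for x, continuous (partial i f)}) ->
  differentiable f x /\ forall v, 'D_v f x = \sum_(i < n) v 0 i * partial i f x.
Proof.
move=> df cf.
pose d (v : 'rV[R]_n) := \sum_(i < n) v 0 i * partial i f x : R.
have lin_d : linear d.
  move=> a u v; rewrite /d scaler_sumr -big_split/=; apply: eq_bigr => i _.
  by rewrite !mxE mulrDl -mulrA.
pose dM := GRing.isLinear.Build _ _ _ _ _ lin_d.
pose dL : {linear 'rV[R]_n -> R} := HB.pack d dM.
have cd : continuous dL.
  rewrite /dL /= /d; move=> v; apply: (cvg_sumr (F := nbhs v) (l := fun i => v 0 i * partial i f x)) => i.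
  by apply: cvgM; [exact: coord_continuous|exact: cvg_cst].
have fo : (f \o shift x : _ -> R) = cst (f x) + (dL : _ -> R) +o_ (0 : 'rV[R]_n) (id : 'rV[R]_n -> 'rV[R]_n).
  apply/eqaddoP => e e0.
  have /nbhs_rVP[r r0 hr] := df.
  (* Dividing by [n.+1] rather than [n] keeps the divisor nonzero in dimension zero. *)
  have n1 : 0 < n.+1%:R :> R by [].
  have : \forall z \near x, forall i, `|partial i f x - partial i f z| < e / n.+1%:R.
    apply: (@filter_forall _ _ (fun i z => `|partial i f x - partial i f z| < e / n.+1%:R) (nbhs x) _) => i.
    by move/cvgrPdist_lt: (cf i); apply; rewrite divr_gt0.
  move=> /nbhs_rVP[s s0 hs].
  apply/nbhs_rVP; exists (Num.min r s); first by rewrite lt_min r0.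
  move=> v; rewrite subr0 lt_min => /andP[vr vs].
  have [|xi [hxi E]] := @mean_value R n f x (v + x).
    by rewrite addrK => z hz; apply: hr; exact: le_lt_trans vr.
  rewrite addrK in hxi.
  rewrite /= !fctE opprD addrA E /dL /= /d -sumrB.
  apply: (le_trans (ler_norm_sum _ _ _)).
  apply: (@le_trans _ _ (\sum_(i < n) `|v| * (e / n.+1%:R))).
    apply: ler_sum => i _.
    rewrite !mxE addrK -mulrBr normrM ler_pM// ?coord_le_norm// distrC.
    apply/ltW/hs; exact: le_lt_trans vs.
  rewrite sumr_const card_ord -mulrnAr mulrC -mulr_natr.
  rewrite ler_wpM2r// mulrAC ler_pdivrMr// ler_pM2l// ler_nat.
  by [].
have dE := diff_unique cd fo.
have dff : differentiable f x.
  by apply/diff_locallyP; rewrite dE.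
by split=> // v; rewrite deriveE// dE.
Qed.

(** * Calculus rules for functions of class C^k *)

Section class_C.
Variables (R : realType) (n : nat).
Implicit Types (U V : set 'rV[R]_n) (f g : 'rV[R]_n -> R).

Lemma class_C_cont k U f : class_C k U f -> {in U, continuous f}.
Proof. by case: k => [|k] []. Qed.

(** Continuity and derivability are taken in the whole space, not relatively to [U], so the
    condition is pointwise. All localisation arguments rest on this. *)
Lemma class_C_at k U f : class_C k U f <-> forall x, U x -> class_C k [set x] f.
Proof.
elim: k f => [|k IH] f /=; split.
- by move=> [cf _] x Ux; split=> // y /set_mem ->; apply/cf/mem_set.
- move=> h; split=> // x /set_mem Ux; have [cf _] := h x Ux.
  by apply: cf; apply/mem_set.
- move=> [cf df] x Ux; split=> [|i]; first by move=> y /set_mem ->; apply/cf/mem_set.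
  have [dfi Cfi] := df i; split; first by move=> y /set_mem ->; apply/dfi/mem_set.
  by move/IH: Cfi; apply.
- move=> h; split=> [x /set_mem Ux|i].
    by have [cf _] := h x Ux; apply/cf/mem_set.
  split=> [x /set_mem Ux|].
    by have [_ df] := h x Ux; apply: (df i).1; apply/mem_set.
  by apply/IH => x Ux; have [_ df] := h x Ux; apply: (df i).2.
Qed.

Lemma class_C_sub k U V f : U `<=` V -> class_C k V f -> class_C k U f.
Proof. by move=> UV /class_C_at h; apply/class_C_at => x /UV; apply: h. Qed.

Lemma class_CW k U f : class_C k.+1 U f -> class_C k U f.
Proof.
elim: k f => [|k IH] f [cf df]; split=> // i.
have [dfi Cfi] := df i; split=> //; exact: IH.
Qed.

Lemma class_C_near k (x : 'rV[R]_n) f g : (\forall y \near x, f y = g y) ->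
  class_C k [set x] f -> class_C k [set x] g.
Proof.
elim: k f g => [|k IH] f g fg [cf df].
  by split=> // y /set_mem ->; apply: (near_continuous_at fg); apply/cf/mem_set.
split.
  by move=> y /set_mem ->; apply: (near_continuous_at fg); apply/cf/mem_set.
move=> i; have [dfi Cfi] := df i; split.
  move=> y /set_mem ->; apply: near_eq_derivable fg _; exact/dfi/mem_set.
apply: IH Cfi; rewrite /partial.
(* The induction needs the partial derivatives to agree on a neighbourhood of [x], so the equality
   of [f] and [g] is first spread to a neighbourhood of each nearby point. *)
have {}fg : \forall y \near x, \forall z \near y, f z = g z by apply/nbhs_interior.
apply: (@filterS _ (nbhs x) _ _ _ _ fg) => y; exact: near_eq_derive.
Qed.

End class_C.

(** Restricting to the line through [x] along [v] makes the inner map a function of one variable,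
    for which derivability is differentiability. The inner map thus needs no more than a derivative
    along [v]. *)
Lemma is_derive_comp_diff (R : realType) (V W : normedModType R) (f : W -> R) (H : V -> W)
    (x v : V) (dH : W) :
  differentiable f (H x) -> is_derive x v H dH ->
  is_derive x v (f \o H) ('D_dH f (H x)).
Proof.
move=> df [dHx <-].
pose g (h : R) := H (h *: v + x).
have g0 : g 0 = H x by rewrite /g scale0r add0r.
have dg : differentiable g 0 by apply/derivable1_diffP; exact: (derivable1P H x v).1 dHx.
have dfg : differentiable (f \o g) 0 by apply: differentiable_comp; rewrite ?g0.
have E (U : normedModType R) (k : V -> U) : 'D_v k x = 'D_1 (fun h : R => k (h *: v + x)) 0.
  rewrite /derive.
  suff -> : (fun h : R => h^-1 *: ((k \o shift x) (h *: v) - k x)) =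
    (fun h : R => h^-1 *: (((fun h0 : R => k (h0 *: v + x)) \o shift 0) (h *: 1) - k (0 *: v + x))) by [].
  by apply/funext => h /=; rewrite addr0 scale0r add0r [h%:A]mulr1.
apply: DeriveDef; first by apply: (derivable1P (f \o H) x v).2; exact/derivable1_diffP.
rewrite (E _ (f \o H)) [LHS](deriveE _ dfg) diff_comp ?g0//=.
have <- : 'd g 0 (1 : R) = 'D_v H x by rewrite (E _ H) deriveE.
by rewrite deriveE.
Qed.

Lemma continuous_rowv (R : realType) (T : topologicalType) m (h : 'I_m -> T -> R) (x : T) :
  (forall j, {for x, continuous (h j)}) ->
  {for x, continuous (fun y => \row_j h j y)}.
Proof.
move=> ch; apply/cvgrPdist_le => e e0.
have : \forall y \near x, forall j, `|h j x - h j y| <= e.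
  apply: (@filter_forall _ _ (fun j y => `|h j x - h j y| <= e) (nbhs x)) => j.
  by move/cvgrPdist_le: (ch j); apply.
apply: filterS => y hy; apply: norm_leP; first exact: ltW.
by move=> j; rewrite !mxE.
Qed.

Section class_C_closure.
Variables (R : realType) (n : nat).
Implicit Types (U V : set 'rV[R]_n) (f g : 'rV[R]_n -> R).

Lemma class_C_eq k U f g : open U -> (forall x, U x -> f x = g x) ->
  class_C k U f -> class_C k U g.
Proof.
move=> oU fg /class_C_at h; apply/class_C_at => x Ux.
apply: class_C_near (h x Ux); apply: filterS fg _; exact: open_nbhs_nbhs.
Qed.

Lemma class_C_diff U f x : open U -> class_C 1 U f -> U x ->
  differentiable f x /\ forall v, 'D_v f x = \sum_(i < n) v 0 i * partial i f x.
Proof.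
move=> oU [cf df] Ux; apply: C1_differentiable => [|i].
  apply: (@filterS _ (nbhs x) _ U); last exact: open_nbhs_nbhs.
  by move=> z Uz i; apply: (df i).1; apply/mem_set.
exact: (@class_C_cont R n 0 U _ (df i).2 x (mem_set Ux)).
Qed.

Lemma class_C_cst k U (c : R) : class_C k U (fun=> c).
Proof.
have cc (c' : R) : {in U, continuous (fun _ : 'rV[R]_n => c')}.
  by move=> x _; apply: (@cst_continuous 'rV[R]_n R).
elim: k c => [|k IH] c; first by split.
split=> [|i]; first exact: cc.
split=> [x _|]; first exact: derivable_cst.
rewrite (_ : partial i _ = fun=> 0) //.
by apply/funext => x; apply: derive_cst.
Qed.

Lemma class_CD k U f g : open U -> class_C k U f -> class_C k U g ->
  class_C k U (fun x => f x + g x).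
Proof.
move=> oU; elim: k f g => [|k IH] f g [cf df] [cg dg].
  by split=> // x xU; apply: continuousD; [exact: cf|exact: cg].
split=> [x xU|i]; first by apply: continuousD; [exact: cf|exact: cg].
have [dfi Cfi] := df i; have [dgi Cgi] := dg i.
split=> [x xU|]; first by apply: derivableD; [exact: dfi|exact: dgi].
apply: class_C_eq (IH _ _ Cfi Cgi) => // x /mem_set xU.
by rewrite /partial -deriveD//; [exact: dfi|exact: dgi].
Qed.

Lemma class_CM k U f g : open U -> class_C k U f -> class_C k U g ->
  class_C k U (fun x => f x * g x).
Proof.
move=> oU; elim: k f g => [|k IH] f g Cf Cg.
  by split=> // x xU; apply: continuousM; [exact: (class_C_cont Cf)|exact: (class_C_cont Cg)].
have [cf df] := Cf; have [cg dg] := Cg.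
split=> [x xU|i]; first by apply: continuousM; [exact: cf|exact: cg].
have [dfi Cfi] := df i; have [dgi Cgi] := dg i.
split=> [x xU|]; first by apply: derivableM; [exact: dfi|exact: dgi].
apply: class_C_eq (class_CD oU (IH _ _ (class_CW Cf) Cgi) (IH _ _ (class_CW Cg) Cfi)) => //.
move=> x /mem_set xU.
by rewrite /partial [RHS]deriveM//; [exact: dfi|exact: dgi].
Qed.

Lemma class_C_sum k U (I : Type) (r : seq I) (f : I -> 'rV[R]_n -> R) : open U ->
  (forall i, class_C k U (f i)) -> class_C k U (fun x => \sum_(i <- r) f i x).
Proof.
move=> oU h; elim: r => [|i r IH].
  by under eq_fun do rewrite big_nil; exact: class_C_cst.
by under eq_fun do rewrite big_cons; exact: class_CD.
Qed.

Lemma class_C_coord k U (i : 'I_n) : open U -> class_C k U (fun x => x 0 i).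
Proof.
move=> oU.
have D (x v : 'rV[R]_n) : is_derive x v (fun x : 'rV[R]_n => x 0 i) (v 0 i).
  have di : derivable (id : 'rV[R]_n -> 'rV[R]_n) x v by exact: derivable_id.
  apply: DeriveDef; first exact: ((derivable_mxP _ _ _).1 di).
  by have := derive_mx di; rewrite derive_id => /matrixP /(_ 0 i); rewrite mxE.
case: k => [|k]; first by split=> // x _; exact: coord_continuous.
split=> [x _|j]; first exact: coord_continuous.
split=> [x _|]; first by have [] := D x (e_ R j).
rewrite (_ : partial j _ = fun=> (e_ R j) 0 i); first exact: class_C_cst.
by apply/funext => x; have [_] := D x (e_ R j).
Qed.

End class_C_closure.

Lemma class_C_leq (R : realType) n k l (U : set 'rV[R]_n) f : (k <= l)%N -> class_C l U f -> class_C k U f.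
Proof.
by elim: l => [|l IH]; [case: k|rewrite leq_eqVlt ltnS => /orP[/eqP->//|kl] /class_CW/(IH kl)].
Qed.

(** Induction on [k]: a partial derivative of the composite is a sum of products of partials of the
    [h j] with partials of [f] composed with [h], to which the induction hypothesis applies at the
    order below. *)
Lemma class_C_comp (R : realType) n m k (U : set 'rV[R]_n) (W : set 'rV[R]_m)
    (f : 'rV[R]_m -> R) (h : 'I_m -> 'rV[R]_n -> R) :
  open U -> open W -> class_C k W f -> (forall j, class_C k U (h j)) ->
  (forall x, U x -> W (\row_j h j x)) ->
  class_C k U (fun x => f (\row_j h j x)).
Proof.
move=> oU oW; elim: k f h => [|k IH] f h Cf Ch UW.
  split=> // x xU; apply: (@continuous_comp _ _ _ (fun y => \row_j h j y) f).
    by apply: continuous_rowv => j; apply: (class_C_cont (Ch j)).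
  by apply: (class_C_cont Cf); apply/mem_set/UW/set_mem.
have C1f : class_C 1 W f by apply: class_C_leq Cf.
have D i x : U x -> is_derive x (e_ R i) (fun x => f (\row_j h j x))
    (\sum_(j < m) partial i (h j) x * partial j f (\row_j h j x)).
  move=> Ux.
  have Hd : derivable (fun x => \row_j h j x) x (e_ R i).
    apply/derivable_mxP => a j; rewrite (_ : (fun _ => _) = h j).
      by have [_ /(_ i)[+ _]] := Ch j; apply; apply/mem_set.
    by apply/funext => y; rewrite mxE.
  have Hj j : ('D_(e_ R i) (fun x => \row_j h j x) x) 0 j = partial i (h j) x.
    move/matrixP: (derive_mx Hd) => /(_ 0 j) ->; rewrite mxE.
    rewrite (_ : (fun t => (\row_j h j t) 0 j) = h j); first by [].
    by apply/funext => y; rewrite mxE.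
  have [df dE] := class_C_diff oW C1f (UW _ Ux).
  have := is_derive_comp_diff df (derivableP Hd).
  rewrite dE; set s := \sum_(_ < _) _; set s' := \sum_(_ < _) _.
  suff -> : s = s' by [].
  apply: eq_bigr => j _; congr (_ * _).
  by rewrite Hj.
split=> [x xU|i].
  have := class_C_cont (IH _ _ (class_CW Cf) (fun j => class_CW (Ch j)) UW) xU.
  exact.
split=> [x /set_mem Ux|]; first by have [] := D i x Ux.
pose s x := \sum_(j < m) partial i (h j) x * partial j f (\row_j h j x).
apply: (@class_C_eq _ _ _ _ s) => //.
  by move=> x /(D i)[_].
apply: class_C_sum => // j; apply: class_CM => //.
  by have [_ /(_ i)[]] := Ch j.
apply: IH => // [|j']; last exact/class_CW/Ch.
by have [_ /(_ j)[]] := Cf.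
Qed.

Section smooth_on.
Variables (R : realType) (n : nat).
Implicit Types (U V : set 'rV[R]_n) (f g : 'rV[R]_n -> R).

Lemma smooth_on_sub U V f : U `<=` V -> smooth_on V f -> smooth_on U f.
Proof. by move=> UV h k; apply: class_C_sub (h k). Qed.

Lemma smooth_on_eq U f g : open U -> (forall x, U x -> f x = g x) ->
  smooth_on U f -> smooth_on U g.
Proof. by move=> oU e h k; apply: class_C_eq (h k). Qed.

Lemma smooth_on_local U f :
  (forall x, U x -> exists V, [/\ open V, V x & smooth_on V f]) -> smooth_on U f.
Proof.
move=> h k; apply/class_C_at => x /h[V [oV Vx /(_ k)]].
by apply: class_C_sub => y ->.
Qed.

Lemma smooth_on_cst U (c : R) : smooth_on U (fun=> c).
Proof. by move=> k; exact: class_C_cst. Qed.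

Lemma smooth_on_coord U i : open U -> smooth_on U (fun x => x 0 i).
Proof. by move=> oU k; exact: class_C_coord. Qed.

Lemma smooth_onD U f g : open U -> smooth_on U f -> smooth_on U g ->
  smooth_on U (fun x => f x + g x).
Proof. by move=> oU hf hg k; apply: class_CD. Qed.

Lemma smooth_onM U f g : open U -> smooth_on U f -> smooth_on U g ->
  smooth_on U (fun x => f x * g x).
Proof. by move=> oU hf hg k; apply: class_CM. Qed.

Lemma smooth_on_sum U (I : Type) (r : seq I) (f : I -> 'rV[R]_n -> R) : open U ->
  (forall i, smooth_on U (f i)) -> smooth_on U (fun x => \sum_(i <- r) f i x).
Proof. by move=> oU h k; apply: class_C_sum => // i; apply: h. Qed.

Lemma smooth_on_partial U f i : smooth_on U f -> smooth_on U (partial i f).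
Proof. by move=> h k; have [_ /(_ i)[]] := h k.+1. Qed.

Lemma smooth_on_cont U f x : smooth_on U f -> U x -> {for x, continuous f}.
Proof. by move=> h Ux; apply: (class_C_cont (h 0%N)); apply/mem_set. Qed.

Lemma smooth_on_derivable U f x i : smooth_on U f -> U x -> derivable f x (e_ R i).
Proof. by move=> h Ux; have [_ /(_ i)[+ _]] := h 1%N; apply; apply/mem_set. Qed.

Lemma smooth_on_diff U f x : open U -> smooth_on U f -> U x ->
  differentiable f x /\ forall v, 'D_v f x = \sum_(i < n) v 0 i * partial i f x.
Proof. by move=> oU h; apply: (class_C_diff oU (h 1%N)). Qed.

Lemma smooth_on_comp m U (W : set 'rV[R]_m) (f : 'rV[R]_m -> R) (h : 'I_m -> 'rV[R]_n -> R) :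
  open U -> open W -> smooth_on W f -> (forall j, smooth_on U (h j)) ->
  (forall x, U x -> W (\row_j h j x)) ->
  smooth_on U (fun x => f (\row_j h j x)).
Proof. by move=> oU oW hf hh UW k; apply: (class_C_comp oU oW (hf k) _ UW) => j; apply: hh. Qed.

End smooth_on.

(** * Bump functions *)

Lemma derive_real (R : realType) (f : R -> R) (y a : R) : differentiable f y ->
  'D_a f y = a * 'D_1 f y.
Proof. by move=> df; rewrite deriveE// diff1E// derive1E. Qed.

Section bump.
Variable R : realType.

(** The classical function exp(-1/t), extended by zero. The factor t^(-k) makes the family stable
    under differentiation: the derivative of [flat k] combines [flat k.+1] and [flat k.+2]. *)
Definition flat k (t : R) : R := if 0 < t then t ^- k * expR (- t^-1) else 0.

Lemma flat_pos k t : 0 < t -> flat k t = t ^- k * expR (- t^-1).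
Proof. by rewrite /flat => ->. Qed.

Lemma flat_npos k t : t <= 0 -> flat k t = 0.
Proof. by rewrite /flat leNgt => /negbTE ->. Qed.

(** Write exp(1/t) as the power k+2 of exp(1/((k+2)t)) and bound the latter below by its exponent. A
    quadratic bound is what makes the derivative at 0 exist and vanish. *)
Lemma flat_bound k t : 0 < t -> flat k t <= k.+2%:R ^+ k.+2 * t ^+ 2.
Proof.
move=> t0; rewrite flat_pos// expRN.
have e0 := expR_gt0 t^-1.
have tk0 : 0 < t ^+ k by rewrite exprn_gt0.
rewrite -invfM -[leLHS]div1r ler_pdivrMr; last by rewrite mulr_gt0.
have -> : expR t^-1 = expR (t^-1 / k.+2%:R) ^+ k.+2.
  by rewrite -expRM_natl -mulr_natl; congr expR; rewrite mulrC divfK.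
rewrite (_ : _ * _ * _ = (k.+2%:R * t * expR (t^-1 / k.+2%:R)) ^+ k.+2); last first.
  by rewrite !exprMn (_ : t ^+ k.+2 = t ^+ 2 * t ^+ k) ?mulrA// -exprD.
apply: exprn_ege1.
have : t^-1 / k.+2%:R <= expR (t^-1 / k.+2%:R).
  by apply: le_trans (expR_ge1Dx _); rewrite lerDr.
rewrite -(ler_pM2l (_ : 0 < k.+2%:R * t)); last by rewrite mulr_gt0.
apply: le_trans; rewrite le_eqVlt; apply/orP; left; apply/eqP.
by rewrite mulrA mulfK ?gt_eqF// divff// pnatr_eq0.
Qed.

Lemma flat_ge0 k t : 0 <= flat k t.
Proof.
rewrite /flat; case: ifP => // t0.
by rewrite mulr_ge0 ?invr_ge0 ?exprn_ge0 ?expR_ge0// ltW.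
Qed.

Lemma flat_derive k t : is_derive t (1 : R) (flat k) (flat k.+2 t - k%:R * flat k.+1 t).
Proof.
have [t0|t0|->] := ltgtP t 0.
- rewrite !flat_npos ?ltW// mulr0 subr0.
  apply: (@near_eq_is_derive R R R (cst 0)).
  by apply: filterS (lt_nbhsl t0) => y /ltW y0; rewrite flat_npos.
- apply: (@near_eq_is_derive R R R (fun t => t ^- k * expR (- t^-1))).
    by apply: filterS (lt_nbhsr t0) => y y0; rewrite flat_pos.
  rewrite !flat_pos//.
  have tn : t != 0 by rewrite gt_eqF.
  have dV : is_derive t (1 : R) (fun t : R => t^-1) (- t ^- 2).
    have := @is_deriveV R id t 1 1 tn (is_derive_id _ _).
    by rewrite [_ *: 1]mulr1.
  have dX : is_derive t (1 : R) (fun t : R => t ^- k) (- k%:R * t ^- k.+1).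
    rewrite (_ : (fun t : R => t ^- k) = (fun t : R => t^-1) ^+ k); last first.
      by apply/funext => y; rewrite exprfctE exprVn.
    apply: is_derive_eq; rewrite /GRing.scale /=.
    case: k => [|k]; first by rewrite oppr0 !mul0r.
    by rewrite -pred_Sn mulrN mulNr exprVn -mulrA -invfM -exprD addn2.
  have dE : is_derive t (1 : R) (fun t : R => expR (- t^-1)) (t ^- 2 * expR (- t^-1)).
    have := @is_derive1_comp R expR (fun t => - t^-1) t (expR (- t^-1)) (t ^- 2).
    move=> h; rewrite mulrC; apply: h.
    by apply: is_derive_eq; rewrite opprK.
  have := is_deriveM dX dE.
  move/is_derive_eq; apply.
  rewrite /GRing.scale /= [X in X + _]mulrA -invfM -exprD addn2.
  by congr (_ + _); rewrite mulrC !mulNr mulrA.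
- rewrite !flat_npos// mulr0 subr0.
  have C0 : (fun h : R => h^-1 *: ((flat k \o shift 0) (h *: 1) - flat k 0)) @ 0^' --> (0 : R).
    apply/cvgrPdist_le => e e0.
    have M0 : 0 < k.+2%:R ^+ k.+2 :> R by rewrite exprn_gt0.
    have d0 : 0 < e / k.+2%:R ^+ k.+2 by rewrite divr_gt0.
    near=> h.
    have hd : `|h| < e / k.+2%:R ^+ k.+2 by near: h; exact: dnbhs0_lt.
    rewrite /= (flat_npos k (lexx 0)) subr0 sub0r normrN addr0 [h%:A]mulr1 /GRing.scale /=.
    have [h0|h0] := leP h 0; first by rewrite flat_npos// mulr0 normr0 ltW.
    rewrite ger0_norm ?mulr_ge0 ?flat_ge0 ?invr_ge0 ?(ltW h0)//.
    rewrite [leLHS]mulrC ler_pdivrMr//; apply: (le_trans (flat_bound k h0)).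
    rewrite expr2 mulrA ler_pM2r// -ler_pdivlMl// mulrC ltW//.
    by rewrite gtr0_norm in hd.
  apply: DeriveDef; first by apply/cvg_ex; exists 0.
  exact: cvg_lim C0.
Unshelve. all: by end_near. Qed.

(** Differentiation raises the index of [flat], so the induction on the order of differentiability
    must hold for all [k] at once. *)
Lemma smooth_on_flat n (U : set 'rV[R]_n) (q : 'rV[R]_n -> R) k : open U ->
  smooth_on U q -> smooth_on U (fun x => flat k (q x)).
Proof.
move=> oU sq l; elim: l k => [|l IH] k.
  split=> // x /set_mem xU; apply: (@continuous_comp _ _ _ q (flat k)).
    exact: smooth_on_cont sq xU.
  apply: differentiable_continuous; apply/derivable1_diffP.
  by have [] := flat_derive k (q x).
have D i x : U x -> is_derive x (e_ R i) (fun x => flat k (q x))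
    ((flat k.+2 (q x) - k%:R * flat k.+1 (q x)) * partial i q x).
  move=> Ux; have [df dfE] := flat_derive k (q x).
  have dd : differentiable (flat k) (q x) by apply/derivable1_diffP.
  have := is_derive_comp_diff dd (derivableP (smooth_on_derivable (i := i) sq Ux)).
  by rewrite (derive_real _ dd) dfE mulrC.
split=> [x xU|i]; first exact: (class_C_cont (IH k) xU).
split=> [x /set_mem Ux|]; first by have [] := D i x Ux.
apply: (@class_C_eq _ _ _ _
  (fun x => (flat k.+2 (q x) + (- k%:R) * flat k.+1 (q x)) * partial i q x)) => //.
  by move=> x /(D i)[_ E]; rewrite mulNr -E.
apply: class_CM => //; last exact: smooth_on_partial.
apply: class_CD => //; apply: class_CM => //; exact: class_C_cst.
Qed.

End bump.

(** The function [p] is positive at 0 and vanishes for [r <= |z|], since the sum of squares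
    dominates the square of the sup norm. With [c] half of [p 0], a second use of [flat], applied to
    [c - p], gives exactly zero where [p] exceeds [c]: this creates the plateau. *)
Lemma plateau_bump (R : realType) n (r : R) : 0 < r ->
  exists chi : 'rV[R]_n -> R, [/\ smooth_on setT chi,
    \forall z \near (0 : 'rV[R]_n), chi z = 1 &
    forall z, r <= `|z| -> chi z = 0].
Proof.
move=> r0.
pose q (z : 'rV[R]_n) := r ^+ 2 + (-1) * \sum_(i < n) (z 0 i * z 0 i).
have sq : smooth_on setT q.
  apply: smooth_onD; [exact: openT|exact: smooth_on_cst|].
  apply: smooth_onM; [exact: openT|exact: smooth_on_cst|].
  apply: smooth_on_sum => [|i]; first exact: openT.
  by apply: smooth_onM; [exact: openT|apply: smooth_on_coord; exact: openT..].
pose p z := flat 0 (q z).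
have sp : smooth_on setT p by apply: smooth_on_flat => //; exact: openT.
have p0 : 0 < p 0.
  rewrite /p /q big1 ?mulr0 ?addr0; last by move=> i _; rewrite mxE mulr0.
  by rewrite flat_pos ?exprn_gt0// expr0 invr1 mul1r expR_gt0.
pose c := p 0 / 2.
have c0 : 0 < c by rewrite divr_gt0.
have f0 : 0 < flat 0 c by rewrite flat_pos// expr0 invr1 mul1r expR_gt0.
exists (fun z => 1 + (- (flat 0 c)^-1) * flat 0 (c + (-1) * p z)); split.
- apply: smooth_onD; [exact: openT|exact: smooth_on_cst|].
  apply: smooth_onM; [exact: openT|exact: smooth_on_cst|].
  apply: smooth_on_flat; first exact: openT.
  apply: smooth_onD; [exact: openT|exact: smooth_on_cst|].
  by apply: smooth_onM; [exact: openT|exact: smooth_on_cst|].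
- have cp : {for (0 : 'rV[R]_n), continuous p} by exact: smooth_on_cont sp _.
  have : \forall z \near (0 : 'rV[R]_n), c < p z.
    apply: (cvgr_gt (p 0) cp).
    by rewrite /c ltr_pdivrMr// mulr_natr mulr2n ltrDl.
  apply: (@filterS _ (nbhs (0 : 'rV[R]_n))) => z cz.
  have h : c + (-1) * p z <= 0 by rewrite mulN1r subr_le0 ltW.
  by rewrite (flat_npos 0 h) mulr0 addr0.
- move=> z rz; have -> : p z = 0; last first.
    by rewrite mulr0 addr0 mulNr mulVf ?subrr// gt_eqF.
  rewrite /p flat_npos// /q mulN1r subr_le0.
  have n0 : `|z| != 0 by rewrite gt_eqF// (lt_le_trans r0).
  have [i Hi] := mx_norm_neq0 n0.
  rewrite (bigD1 i.2)//= -[leLHS]addr0 lerD//; last first.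
    by apply: sumr_ge0 => j _; rewrite -expr2 sqr_ge0.
  rewrite -(expr2 (z 0 i.2)) -(real_normK (num_real (z 0 i.2))) ler_sqr ?nnegrE ?(ltW r0) //.
  by move: rz; rewrite [in X in X -> _]/Num.Def.normr /= Hi; case: (i) => a j /=; rewrite [a]ord1.
Qed.

(** A tube lemma: continuity at the points of [K] times [y0] becomes uniform over [K]. It supplies
    all uniformity in a point of the group or in an integration variable. *)
Lemma compact_continuous_param (X Y : topologicalType) (R : realType) (K : set X) (F : X -> Y -> R) (y0 : Y) :
  compact K -> (forall x, K x -> {for (x, y0), continuous (fun p => F p.1 p.2)}) ->
  forall e, 0 < e -> \forall y \near y0, forall x, K x -> `|F x y - F x y0| < e.
Proof.
move=> cK cF e e0.
move/compact_near_coveringP: cK => /(_ Y (nbhs y0) (fun y x => `|F x y - F x y0| < e)); apply.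
move=> x Kx.
have e20 : 0 < e / 2 by rewrite divr_gt0.
have /cvgrPdist_lt /(_ _ e20) [[A B] /= [nA nB] AB] := cF x Kx.
exists (A, B) => //= -[x' y] [/= Ax' By].
have h1 := AB (x', y) (conj Ax' By).
have h2 := AB (x', y0) (conj Ax' (nbhs_singleton nB)).
rewrite /= in h1 h2.
rewrite (_ : _ - _ = (F x y0 - F x' y0) - (F x y0 - F x' y)); last by ring.
by rewrite (le_lt_trans (ler_normB _ _))// (splitr e) ltrD.
Qed.

Lemma nbhsS (T : topologicalType) (x : T) (P Q : set T) :
  (forall y, P y -> Q y) -> nbhs x P -> nbhs x Q.
Proof. exact: filterS. Qed.

Lemma nbhsS2 (T : topologicalType) (x : T) (P Q S : set T) :
  (forall y, P y -> Q y -> S y) -> nbhs x P -> nbhs x Q -> nbhs x S.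
Proof. by move=> h; apply: filterS2. Qed.

Lemma continuous_at_le (T : topologicalType) (R : realType) (f : T -> R) (x : T) :
  (forall e, 0 < e -> \forall y \near x, `|f x - f y| <= e) -> {for x, continuous f}.
Proof. by move=> h; apply/cvgrPdist_le => e e0; exact: h. Qed.

Lemma is_derive_line (R : realType) (V : normedModType R) (k : V -> R) (x v : V) l :
  is_derive (0 : R) (1 : R) (fun h : R => k (h *: v + x)) l -> is_derive x v k l.
Proof.
move=> [dk <-]; apply: DeriveDef; first exact: (derivable1P k x v).2.
rewrite /derive.
suff -> : (fun h : R => h^-1 *: ((k \o shift x) (h *: v) - k x)) =
  (fun h : R => h^-1 *: (((fun h0 : R => k (h0 *: v + x)) \o shift 0) (h *: 1) - k (0 *: v + x))) by [].
by apply/funext => h /=; rewrite addr0 scale0r add0r [h%:A]mulr1.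
Qed.

Lemma affine_derive (R : realType) (V : normedModType R) (a b : V) (t : R) :
  is_derive t (1 : R) (fun t : R => t *: a + b) a.
Proof.
have D : is_diff t (fun t : R => t *: a + b) ((fun h : R => h *: a) + (0 : R -> V)).
  exact: (is_diffD (is_diff_scalel t a) (is_diff_cst b t)).
apply: DeriveDef; first exact: diff_derivable.
by rewrite deriveE// diff_val fctE scale1r addr0.
Qed.

Definition oball (R : realType) n (r : R) : set 'rV[R]_n := [set z | `|z| < r].
Arguments oball {R} n r.

Lemma open_oball (R : realType) n (r : R) : open (oball n r).
Proof.
rewrite openE => z zr; apply/nbhs_rVP; exists (r - `|z|); first by rewrite subr_gt0.
move=> y yz; rewrite /oball /= -(subrK z y) (le_lt_trans (ler_normD _ _))//.
by rewrite -ltrBrDr.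
Qed.

Lemma compact_cball (R : realType) n (r : R) : compact [set z : 'rV[R]_n | `|z| <= r].
Proof.
apply: bounded_closed_compact.
  exists r; split; first exact: num_real.
  by move=> M rM z /= zr; rewrite (le_trans zr)// ltW.
apply: (@preimage_closed _ _ (fun z : 'rV[R]_n => `|z|) [set t | t <= r]).
  by move=> z _; exact: norm_continuous.
exact: closed_le.
Qed.

(** * Hadamard's lemma *)

Section radial_integral.
Variables (R : realType) (n : nat) (r : R).
Notation mu := (@lebesgue_measure R).
Notation B := (oball n r).

(** Integral along the ray from the origin to [z]. Differentiation in [z] produces a factor t, which
    the weight t^k absorbs; [k = 0] gives the coefficients in Hadamard's lemma. *)
Definition rint k (F : 'rV[R]_n -> R) (z : 'rV[R]_n) : R :=
  (\int[mu]_(t in `[0, 1]%classic) (t ^+ k * F (t *: z)))%R.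

Lemma oball_scale z (t : R) : B z -> t \in `[0, 1] -> B (t *: z).
Proof.
rewrite in_itv /= /oball /= => zr /andP[t0 t1].
by rewrite normrZ ger0_norm// (le_lt_trans _ zr)// ler_piMl.
Qed.

Lemma ray_continuous k (F : 'rV[R]_n -> R) z : smooth_on B F -> B z ->
  {within `[0, 1], continuous (fun t : R => t ^+ k * F (t *: z))}.
Proof.
move=> sF Bz; apply: continuous_in_subspaceT => t /set_mem t01.
apply: (@continuousM R R (fun t : R => t ^+ k) (fun t : R => F (t *: z))); first exact: exprn_continuous.
apply: (@continuous_comp _ _ _ (fun t : R => t *: z) F); first exact: scalel_continuous.
exact/(smooth_on_cont sF)/oball_scale.
Qed.

Lemma ray_integrable k (F : 'rV[R]_n -> R) z : smooth_on B F -> B z ->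
  mu.-integrable `[0, 1]%classic (EFin \o (fun t : R => t ^+ k * F (t *: z))).
Proof.
move=> sF Bz; apply: continuous_compact_integrable; first exact: segment_compact.
exact: ray_continuous.
Qed.

Lemma rint_continuous k F z : smooth_on B F -> B z -> {for z, continuous (rint k F)}.
Proof.
move=> sF Bz; apply: continuous_at_le => e e0.
have H : \forall y \near z, forall t : R, `[0, 1]%classic t -> `|F (t *: y) - F (t *: z)| < e.
  apply: (@compact_continuous_param R 'rV[R]_n R `[0, 1]%classic (fun t y => F (t *: y))) => //.
    exact: segment_compact.
  move=> t t01; apply: (@continuous_comp _ _ _ (fun p : R * 'rV[R]_n => p.1 *: p.2) F).
    exact: (@scale_continuous R 'rV[R]_n).
  exact/(smooth_on_cont sF)/oball_scale.
have nB : nbhs z B by apply: open_nbhs_nbhs; split => //; exact: open_oball.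
apply: nbhsS2 nB H => y By h.
have If := ray_integrable k sF Bz; have Ig := ray_integrable k sF By.
have I01 : mu.-integrable `[0, 1]%classic (EFin \o (fun=> e)).
  apply: continuous_compact_integrable; first exact: segment_compact.
  by apply: continuous_subspaceT => x; exact: cst_continuous.
have Id : mu.-integrable `[0, 1]%classic (EFin \o (fun t => t ^+ k * F (t *: z) - t ^+ k * F (t *: y))).
  exact: (integrableB _ If Ig).
rewrite /rint -RintegralB//.
apply: (le_trans (le_normr_Rintegral _ _)) => //.
apply: (@le_trans _ _ (\int[mu]_(t in `[0, 1]%classic) e)%R).
  apply: le_Rintegral => //; first exact: integrable_norm.
  move=> t t01; rewrite -mulrBr normrM distrC.
  have t01' := t01; move: t01'; rewrite /= in_itv /= => /andP[t0 t1].
  rewrite (le_trans _ (ltW (h t t01)))// ler_piMl// normrX ger0_norm//.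
  by rewrite exprn_ile1.
have m1 : mu `[0, 1]%classic = 1%E.
  by have := lebesgue_measure_itv (`[0, 1] : interval R); rewrite /= lte_fin ltr01 -EFinB subr0.
rewrite Rintegral_cst// (_ : fine _ = 1) ?mulr1//.
exact: (congr1 fine m1).
Qed.

Lemma rint_derive k F z i : smooth_on B F -> B z ->
  is_derive z (e_ R i) (rint k F) (rint k.+1 (partial i F) z).
Proof.
move=> sF Bz.
have sD := smooth_on_partial i sF.
(* Half the distance to the boundary: increments up to [d] stay in a compact ball inside the domain,
   where the partial derivative has a bound [M]. That constant dominates the integrand's
   derivative. *)
pose d := (r - `|z|) / 2.
have d0 : 0 < d by rewrite divr_gt0// subr_gt0.
have e1 : `|e_ R i| <= 1.
  by apply: norm_leP => // j; rewrite e_E; case: (j == i); rewrite ?normr1 ?normr0.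
pose K := [set y : 'rV[R]_n | `|y| <= `|z| + d].
have KB y : K y -> B y.
  move=> Ky; rewrite /oball /= (le_lt_trans Ky)// -ltrBrDl /d.
  by rewrite ltr_pdivrMr// mulr_natr mulr2n ltrDl subr_gt0.
have inK (h : R) : `|h| <= d -> K (h *: e_ R i + z).
  move=> hd; rewrite /K /= addrC (le_trans (ler_normD _ _))// lerD2l normrZ.
  by rewrite (le_trans _ hd)// ler_piMr.
have tK (t : R) y : t \in `[0, 1] -> K y -> K (t *: y).
  rewrite in_itv /= /K /= => /andP[t0 t1] zr.
  by rewrite normrZ ger0_norm// (le_trans _ zr)// ler_piMl.
have [M hM] : exists M, forall y, K y -> `|partial i F y| <= M.
  have [||| c _ hc] := @compact_EVT_max 'rV[R]_n R (fun y => `|partial i F y|) K.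
  - by exists 0; rewrite /K /= normr0 addr_ge0// ltW.
  - exact: compact_cball.
  - apply: continuous_in_subspaceT => y /set_mem /KB By.
    apply: (@continuous_comp _ _ _ (partial i F) (fun t => `|t|)).
      exact: smooth_on_cont sD By.
    exact: norm_continuous.
  - by exists `|partial i F c| => y Ky; apply: hc; apply/mem_set.
have M0 : 0 <= M.
  by rewrite (le_trans _ (hM 0 _))// /K /= normr0 addr_ge0// ltW.
pose f (h t : R) := t ^+ k * F (t *: (h *: e_ R i + z)).
have line (h t : R) : `|h| <= d -> t \in `[0, 1] ->
    is_derive h (1 : R) (f ^~ t) (t ^+ k.+1 * partial i F (t *: (h *: e_ R i + z))).
  move=> hd t01.
  have By : B (t *: (h *: e_ R i + z)) by apply/KB/tK => //; exact: inK.
  have [dF dFE] := smooth_on_diff (@open_oball R n r) sF By.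
  have dH : is_derive h (1 : R) (fun h : R => t *: (h *: e_ R i + z)) (t *: e_ R i).
    have := affine_derive (t *: e_ R i) (t *: z) h.
    suff -> : (fun t0 : R => t0 *: (t *: e_ R i) + t *: z) = (fun h0 : R => t *: (h0 *: e_ R i + z)) by [].
    by apply/funext => u; rewrite scalerDr !scalerA mulrC.
  have := @is_derive_comp_diff _ _ _ F (fun h : R => t *: (h *: e_ R i + z)) h 1 _ dF dH.
  rewrite dFE (bigD1 i)//= big1 ?addr0; last first.
    by move=> j ji; rewrite mxE e_E (negbTE ji) mulr0 mul0r.
  rewrite mxE e_E eqxx mulr1 => h1.
  have := is_deriveZ (t ^+ k) h1.
  by rewrite /GRing.scale /= mulrA -exprSr.
have Iopen (h : R) : h \in `]-d, d[ -> `|h| <= d.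
  by rewrite in_itv /= => /andP[h1 h2]; rewrite ler_norml !ltW.
have Id0 : [set` `]-d, d[ ] (0 : R) by rewrite /= in_itv /= oppr_lt0 d0.
have p1E (h t : R) : `|h| <= d -> t \in `[0, 1] ->
   partial1of2 f h t = t ^+ k.+1 * partial i F (t *: (h *: e_ R i + z)).
  by move=> hd t01; rewrite partial1of2E; have [_ ->] := line h t hd t01.
have intf (h : R) : [set` `]-d, d[ ] h -> mu.-integrable `[0, 1]%classic (EFin \o f h).
  by move=> /Iopen /inK /KB; apply: ray_integrable.
have derf (h t : R) : [set` `]-d, d[ ] h -> `[0, 1]%classic t -> derivable (f ^~ t) h 1.
  by move=> /Iopen hd t01; have [] := line h t hd t01.
have intM : mu.-integrable `[0, 1]%classic (EFin \o (fun=> M)).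
  apply: continuous_compact_integrable; first exact: segment_compact.
  by apply: continuous_subspaceT => x; exact: cst_continuous.
have ub (h t : R) : [set` `]-d, d[ ] h -> `[0, 1]%classic t -> `|partial1of2 f h t| <= M.
  move=> /Iopen hd t01; rewrite p1E// normrM.
  have t01' := t01; move: t01'; rewrite /= in_itv /= => /andP[t0 t1].
  rewrite (le_trans _ (hM _ (tK _ _ t01 (inK _ hd))))// ler_piMl// normrX ger0_norm//.
  by rewrite exprn_ile1.
have D := @derivable_under_integral R _ _ mu f _ (measurable_itv _) _ _ _ Id0 intf derf (fun=> M) (fun=> M0) intM ub.
have DE := @differentiation_under_integral R _ _ mu f _ (measurable_itv _) _ _ _ Id0 intf derf (fun=> M) (fun=> M0) intM ub.
apply: is_derive_line; apply: DeriveDef; first exact: D.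
rewrite -derive1E [LHS]DE; apply: eq_Rintegral => t /set_mem t01.
by rewrite p1E ?normr0 ?(ltW d0)// scale0r add0r.
Qed.

Lemma rint_smooth k F : smooth_on B F -> smooth_on B (rint k F).
Proof.
move=> sF l; elim: l k F sF => [|l IH] k F sF.
  by split=> // z /set_mem; apply: rint_continuous.
split=> [z /set_mem|i]; first exact: rint_continuous.
split=> [z /set_mem Bz|]; first by have [] := rint_derive k i sF Bz.
apply: class_C_eq (IH k.+1 _ (smooth_on_partial i sF)); first exact: open_oball.
by move=> z Bz; have [] := rint_derive k i sF Bz.
Qed.

(** The fundamental theorem of calculus along the ray. Unlike the intermediate points of
    [mean_value], the coefficients here depend smoothly on [z], so a derivation can be applied to
    them. *)
Lemma hadamard F z : smooth_on B F -> B z ->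
  F z - F 0 = \sum_(i < n) z 0 i * rint 0 (partial i F) z.
Proof.
move=> sF Bz.
pose g (t : R) := \sum_(i < n) z 0 i * (t ^+ 0 * partial i F (t *: z)).
have line (t : R) : B (t *: z) -> is_derive t (1 : R) (fun t => F (t *: z)) (g t).
  move=> Bt; have [dF dFE] := smooth_on_diff (@open_oball R n r) sF Bt.
  have dH : is_derive t (1 : R) (fun t : R => t *: z) z.
    have := affine_derive z 0 t.
    by under eq_fun do rewrite addr0.
  have := @is_derive_comp_diff _ _ _ F (fun t : R => t *: z) t 1 _ dF dH; rewrite dFE /g.
  by under [in X in _ -> X]eq_bigr do rewrite expr0 mul1r.
have cline (t : R) : B (t *: z) -> {for t, continuous (fun t : R => F (t *: z))}.
  by move=> /line[/derivable1_diffP /differentiable_continuous].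
have cg : {within `[0, 1], continuous g}.
  apply: continuous_in_subspaceT => t /set_mem t01.
  apply: (@cvg_sumr _ _ (nbhs t) _ _ _ (fun i t => z 0 i * (t ^+ 0 * partial i F (t *: z)))) => i.
  apply: cvgM; first exact: cvg_cst.
  apply: cvgM; first exact: exprn_continuous.
  apply: (@continuous_comp _ _ _ (fun t : R => t *: z)); first exact: scalel_continuous.
  exact/(smooth_on_cont (smooth_on_partial i sF))/oball_scale.
have B0 : B (0 *: z) by rewrite scale0r /oball /= normr0 (le_lt_trans _ Bz).
have B1 : B (1 *: z) by rewrite scale1r.
have dLR : derivable_oo_LRcontinuous (fun t : R => F (t *: z)) 0 1.
  split.
  - move=> t; rewrite in_itv /= => /andP[/ltW t0 /ltW t1].
    by have [] := line t _; first by apply: oball_scale; rewrite ?in_itv /= ?t0.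
  - exact/cvg_at_right_filter/cline.
  - exact/cvg_at_left_filter/cline.
have := continuous_FTC2 ltr01 cg dLR.
rewrite scale1r scale0r => h.
have {}h : (\int[mu]_(t in `[0, 1]%classic) g t)%R = F z - F 0.
  rewrite /Rintegral h// => t; rewrite in_itv /= => /andP[/ltW t0 /ltW t1].
  by rewrite derive1E; have [] := line t _; first by apply: oball_scale; rewrite ?in_itv /= ?t0.
rewrite -h /g.
have Ii i : mu.-integrable `[0, 1]%classic (EFin \o (fun t => z 0 i * (t ^+ 0 * partial i F (t *: z)))).
  have := @integrableZl _ _ _ mu _ (measurable_itv _) (z 0 i) _ (ray_integrable 0 (smooth_on_partial i sF) Bz).
  by apply: eq_integrable.
have key (s : seq 'I_n) :
    mu.-integrable `[0, 1]%classic (EFin \o (fun t => \sum_(i <- s) z 0 i * (t ^+ 0 * partial i F (t *: z)))) /\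
    (\int[mu]_(t in `[0, 1]%classic) \sum_(i <- s) z 0 i * (t ^+ 0 * partial i F (t *: z)))%R =
    \sum_(i <- s) z 0 i * rint 0 (partial i F) z.
  elim: s => [|i s [Is IHs]].
    rewrite big_nil; under eq_Rintegral do rewrite big_nil.
    split; last by rewrite Rintegral_cst// mul0r.
    apply: (@eq_integrable _ _ _ mu _ (measurable_itv _) (cst 0%E)); last exact: integrable0.
    by move=> t _ /=; rewrite big_nil.
  rewrite big_cons; under eq_Rintegral do rewrite big_cons.
  split.
    apply: (@eq_integrable _ _ _ mu _ (measurable_itv _) _ _ _ (@integrableD _ _ _ mu _ (measurable_itv _) _ _ (Ii i) Is)) => //.
    by move=> t _ /=; rewrite big_cons.
  rewrite RintegralD// IHs RintegralZl//.
  exact: ray_integrable (smooth_on_partial i sF) Bz.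
exact: (key _).2.
Qed.

End radial_integral.

(** * Lie groups in coordinates *)

Lemma smooth_on_compv (R : realType) n m (U : set 'rV[R]_n) (W : set 'rV[R]_m)
    (f : 'rV[R]_m -> R) (H : 'rV[R]_n -> 'rV[R]_m) :
  open U -> open W -> smooth_on W f -> (forall j, smooth_on U (fun x => H x 0 j)) ->
  (forall x, U x -> W (H x)) -> smooth_on U (fun x => f (H x)).
Proof.
move=> oU oW sf sH UW.
have E x : \row_j H x 0 j = H x by apply/rowP => j; rewrite mxE.
apply: (@smooth_on_eq _ _ _ (fun x => f (\row_j H x 0 j))) => //.
  by move=> x _; rewrite E.
by apply: smooth_on_comp sf sH _ => // x Ux; rewrite E; exact: UW.
Qed.

Lemma continuousv (R : realType) (T : topologicalType) m (H : T -> 'rV[R]_m) (x : T) :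
  (forall j, {for x, continuous (fun y => H y 0 j)}) -> {for x, continuous H}.
Proof.
move=> cH; have := continuous_rowv cH.
by rewrite (_ : (fun y => _) = H)//; apply/funext => y; apply/rowP => j; rewrite mxE.
Qed.

Lemma lsubmx_continuous (R : realType) n1 n2 : continuous (@lsubmx R 1 n1 n2).
Proof. by move=> x; apply: differentiable_continuous; exact: differentiable_lsubmx. Qed.

Lemma rsubmx_continuous (R : realType) n1 n2 : continuous (@rsubmx R 1 n1 n2).
Proof. by move=> x; apply: differentiable_continuous; exact: differentiable_rsubmx. Qed.

Lemma row_mx_continuous (R : realType) (T : topologicalType) n1 n2
  (f : T -> 'rV[R]_n1) (g : T -> 'rV[R]_n2) x :
  {for x, continuous f} -> {for x, continuous g} ->
  {for x, continuous (fun y => row_mx (f y) (g y))}.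
Proof.
move=> cf cg; apply: continuousv => j; case: (split_ordP j) => k ->.
  rewrite (_ : (fun y => _) = (fun v : 'rV[R]_n1 => v 0 k) \o f).
    by apply: continuous_comp => //; exact: coord_continuous.
  by apply/funext => y /=; rewrite row_mxEl.
rewrite (_ : (fun y => _) = (fun v : 'rV[R]_n2 => v 0 k) \o g).
  by apply: continuous_comp => //; exact: coord_continuous.
by apply/funext => y /=; rewrite row_mxEr.
Qed.

Lemma open_cont_preimage (T U : topologicalType) (A : set T) (B : set U) (f : T -> U) :
  open A -> open B -> (forall x, A x -> {for x, continuous f}) -> open (A `&` f @^-1` B).
Proof.
move=> oA oB cf; rewrite openE => x [Ax Bfx]; apply: filterI; first exact: open_nbhs_nbhs.
by apply: cf => //; exact: open_nbhs_nbhs.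
Qed.

Lemma derive_reparam (R : realType) (V W : normedModType R) (f : V -> R) (g : W -> R) x v y u :
  (forall h : R, f (h *: v + x) = g (h *: u + y)) -> 'D_v f x = 'D_u g y.
Proof.
move=> fg; rewrite /derive.
suff -> : (fun h : R => h^-1 *: ((f \o shift x) (h *: v) - f x)) =
  (fun h : R => h^-1 *: ((g \o shift y) (h *: u) - g y)) by [].
apply/funext => h /=; rewrite fg; congr (_ *: (_ - _)).
by have := fg 0; rewrite !scale0r !add0r.
Qed.

Lemma partial_row_mxr (R : realType) n1 n2 (F : 'rV[R]_(n1 + n2) -> R) z j w :
  partial j (fun w => F (row_mx z w)) w = partial (rshift n1 j) F (row_mx z w).
Proof.
apply: derive_reparam => h; congr F; apply/rowP => k; rewrite [RHS]mxE.
case: (split_ordP k) => l ->.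
  by rewrite !row_mxEl !mxE eq_lrshift mulr0 add0r.
by rewrite !row_mxEr !mxE eq_rshift.
Qed.

Lemma partial_row_mxl (R : realType) n1 n2 (F : 'rV[R]_(n1 + n2) -> R) w j z :
  partial j (fun z => F (row_mx z w)) z = partial (lshift n2 j) F (row_mx z w).
Proof.
apply: derive_reparam => h; congr F; apply/rowP => k; rewrite [RHS]mxE.
case: (split_ordP k) => l ->.
  by rewrite !row_mxEl !mxE eq_lshift.
by rewrite !row_mxEr !mxE eq_rlshift mulr0 add0r.
Qed.

Section lie_smooth.
Variables (R : realType) (n : nat) (G : lieGroupType R n).
Implicit Types (f : G -> R) (c d : chart R n G).

Lemma mulg_continuous : continuous (fun xy : G * G => (xy.1 * xy.2)%g).
Proof. by case: (@lie_mul_smooth R n G). Qed.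

Lemma invg_continuous : continuous (fun x : G => x^-1%g).
Proof. by case: (@lie_inv_smooth R n G). Qed.

Lemma mulg_cont (T : topologicalType) (f g : T -> G) x :
  {for x, continuous f} -> {for x, continuous g} -> {for x, continuous (fun y => (f y * g y)%g)}.
Proof.
move=> cf cg; apply: (@continuous_comp _ _ _ (fun y => (f y, g y)) (fun p : G * G => (p.1 * p.2)%g)).
  exact: cvg_pair.
exact: mulg_continuous.
Qed.

Section chart.
Variable c : chart R n G.
Hypothesis ac : atlas c.

Let ic : is_chart c. Proof. by have [h _ _] := @atlasP R n G; exact: h. Qed.

Lemma open_chart_dom : open (chart_dom c). Proof. by case: ic. Qed.
Lemma open_chart_im : open (chart_im c). Proof. by case: ic. Qed.
Lemma chart_mapK x : chart_dom c x -> chart_inv c (chart_map c x) = x.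
Proof. by case: ic => _ _ h _ _ xc; apply: h; apply/mem_set. Qed.
Lemma chart_map_im x : chart_dom c x -> chart_im c (chart_map c x).
Proof. by exists x. Qed.
Lemma chart_invK z : chart_im c z -> chart_map c (chart_inv c z) = z.
Proof. by move=> [x xc <-]; rewrite chart_mapK. Qed.
Lemma chart_inv_dom z : chart_im c z -> chart_dom c (chart_inv c z).
Proof. by move=> [x xc <-]; rewrite chart_mapK. Qed.
Lemma chart_map_cont x : chart_dom c x -> {for x, continuous (chart_map c)}.
Proof. by case: ic => _ _ _ h _ xc; apply: h; apply/mem_set. Qed.
Lemma chart_inv_cont z : chart_im c z -> {for z, continuous (chart_inv c)}.
Proof. by case: ic => _ _ _ _ h xc; apply: h; apply/mem_set. Qed.

End chart.

Lemma chart_at (x : G) : exists2 c, atlas c & chart_dom c x.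
Proof. by have [_ h _] := @atlasP R n G; exact: h. Qed.

Lemma smooth_continuous f : smooth f -> continuous f.
Proof.
move=> sf x; have [c ac xc] := chart_at x.
have E : \forall y \near x, f (chart_inv c (chart_map c y)) = f y.
  apply: nbhsS (open_nbhs_nbhs (conj (open_chart_dom ac) xc)) => y yc.
  by rewrite chart_mapK.
apply: (near_continuous_at E).
apply: (@continuous_comp _ _ _ (chart_map c) (fun z => f (chart_inv c z))).
  exact: chart_map_cont.
exact/(smooth_on_cont (sf c ac))/chart_map_im.
Qed.

Definition pim c d : set 'rV[R]_(n + n) :=
  [set z | chart_im c (lsubmx z) /\ chart_im d (rsubmx z)].

Lemma open_pim c d : atlas c -> atlas d -> open (pim c d).
Proof.
move=> ac ad; apply: openI.
  by apply: open_comp (open_chart_im ac) => z _; exact: lsubmx_continuous.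
by apply: open_comp (open_chart_im ad) => z _; exact: rsubmx_continuous.
Qed.

(** The product need not stay in one chart, so smoothness is checked near each point with a chart
    [e] around the product there. *)
Lemma mul_smooth f c d : smooth f -> atlas c -> atlas d ->
  smooth_on (pim c d) (fun z => f (chart_inv c (lsubmx z) * chart_inv d (rsubmx z))%g).
Proof.
move=> sf ac ad; apply: smooth_on_local => z0 z0in.
pose Phi (z : 'rV[R]_(n + n)) : G := (chart_inv c (lsubmx z) * chart_inv d (rsubmx z))%g.
have [e ae z0e] := chart_at (Phi z0).
have cPhi z : pim c d z -> {for z, continuous Phi}.
  move=> [zc zd]; apply: mulg_cont.
    apply: (@continuous_comp _ _ _ (@lsubmx R 1 n n) (chart_inv c)).
      exact: lsubmx_continuous.
    exact: chart_inv_cont.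
  apply: (@continuous_comp _ _ _ (@rsubmx R 1 n n) (chart_inv d)).
    exact: rsubmx_continuous.
  exact: chart_inv_cont.
pose V := pim c d `&` Phi @^-1` chart_dom e.
have oV : open V by apply: open_cont_preimage => //; [exact: open_pim|exact: open_chart_dom].
exists V; split => //.
apply: (@smooth_on_eq _ _ _ (fun z => f (chart_inv e (chart_map e (Phi z))))) => //.
  by move=> z [_ ze]; rewrite chart_mapK.
apply: (@smooth_on_compv _ _ _ _ (chart_im e) (fun u => f (chart_inv e u)) (fun z => chart_map e (Phi z))) => //.
- exact: open_chart_im.
- exact: sf.
- move=> j.
  have [_ h] := @lie_mul_smooth R n G.
  have pa : prod_atlas atlas atlas (prod_chart c d) by exists c, d.
  apply: smooth_on_sub (h _ _ pa ae j) => z [[zc zd] ze].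
  exists (chart_inv c (lsubmx z), chart_inv d (rsubmx z)) => /=.
    by split => //; split; apply: chart_inv_dom.
  by rewrite !chart_invK// hsubmxK.
- by move=> z [_ ze]; exact: chart_map_im.
Qed.

Lemma smooth_left_translate f (g : G) : smooth f -> smooth (fun y => f (g * y)%g).
Proof.
move=> sf d ad; have [c ac gc] := chart_at g.
apply: (@smooth_on_eq _ _ _ (fun z => (fun z => f (chart_inv c (lsubmx z) * chart_inv d (rsubmx z))%g)
   (row_mx (chart_map c g) z))).
- exact: open_chart_im.
- by move=> z zd; rewrite row_mxKl row_mxKr chart_mapK.
apply: smooth_on_compv (mul_smooth sf ac ad) _ _.
- exact: open_chart_im.
- exact: open_pim.
- move=> j; case: (split_ordP j) => k ->.
    by under eq_fun do rewrite row_mxEl; exact: smooth_on_cst.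
  by under eq_fun do rewrite row_mxEr; apply: smooth_on_coord; exact: open_chart_im.
- by move=> z zd; split; rewrite ?row_mxKl ?row_mxKr//; exact: chart_map_im.
Qed.

Lemma smooth_cst (a : R) : smooth (fun _ : G => a).
Proof. by move=> c ac; exact: smooth_on_cst. Qed.

Lemma smoothD f g : smooth f -> smooth g -> smooth (fun x => f x + g x).
Proof. by move=> sf sg c ac; apply: smooth_onD; [exact: open_chart_im|exact: sf|exact: sg]. Qed.

Lemma smoothM f g : smooth f -> smooth g -> smooth (fun x => f x * g x).
Proof. by move=> sf sg c ac; apply: smooth_onM; [exact: open_chart_im|exact: sf|exact: sg]. Qed.

Lemma smooth_sum (I : Type) (r : seq I) (f : I -> G -> R) :
  (forall i, smooth (f i)) -> smooth (fun x => \sum_(i <- r) f i x).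
Proof.
by move=> h c ac; apply: smooth_on_sum => [|i]; [exact: open_chart_im|exact: h].
Qed.

End lie_smooth.

Lemma addr_cont (R : realType) (V : normedModType R) (a : V) : continuous (fun w => w + a).
Proof. by move=> x; apply: cvgD; [exact: cvg_id|exact: cvg_cst]. Qed.

Lemma subr_cont (R : realType) (T : topologicalType) (V : normedModType R) (f : T -> V) (a : V) x :
  {for x, continuous f} -> {for x, continuous (fun y => f y - a)}.
Proof. by move=> cf; apply: cvgB; [exact: cf|exact: cvg_cst]. Qed.

(** * Left-invariant derivatives in a chart centred at the identity *)

Section chart_at_one.
Variables (R : realType) (n : nat) (G : lieGroupType R n).
Variable c : chart R n G.
Hypotheses (ac : atlas c) (c1 : chart_dom c 1%g).
Implicit Types (f : G -> R) (d : chart R n G).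

(* The inverse of the chart, recentred so that [psi 0 = 1]. *)
Definition psi (w : 'rV[R]_n) : G := chart_inv c (w + chart_map c 1%g).
Definition phi (x : G) : 'rV[R]_n := chart_map c x - chart_map c 1%g.
Definition psi_dom : set 'rV[R]_n := [set w | chart_im c (w + chart_map c 1%g)].

Lemma psi0 : psi 0 = 1%g.
Proof. by rewrite /psi add0r chart_mapK. Qed.

Lemma phi1 : phi 1%g = 0.
Proof. by rewrite /phi subrr. Qed.

Lemma psi_dom0 : psi_dom 0.
Proof. by rewrite /psi_dom /= add0r; exact: chart_map_im. Qed.

Lemma open_psi_dom : open psi_dom.
Proof.
apply: open_comp (open_chart_im ac) => z _ /=.
exact: addr_cont.
Qed.

Lemma phiK x : chart_dom c x -> psi (phi x) = x.
Proof. by move=> xc; rewrite /psi /phi subrK chart_mapK. Qed.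

Lemma psiK w : psi_dom w -> phi (psi w) = w.
Proof. by move=> h; rewrite /psi /phi chart_invK// addrK. Qed.

Lemma psi_in w : psi_dom w -> chart_dom c (psi w).
Proof. by move=> h; exact: chart_inv_dom. Qed.

Lemma psi_cont w : psi_dom w -> {for w, continuous psi}.
Proof.
move=> h; rewrite (_ : psi = chart_inv c \o (fun w => w + chart_map c 1%g))//.
apply: continuous_comp.
  exact: addr_cont.
exact: chart_inv_cont.
Qed.

Lemma phi_cont x : chart_dom c x -> {for x, continuous phi}.
Proof.
move=> h; apply: subr_cont; exact: chart_map_cont.
Qed.

Lemma mul_psi_smooth f d : smooth f -> atlas d ->
  smooth_on [set z : 'rV[R]_(n + n) | chart_im d (lsubmx z) /\ psi_dom (rsubmx z)]
    (fun z => f (chart_inv d (lsubmx z) * psi (rsubmx z))%g).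
Proof.
move=> sf ad.
have oU : open [set z : 'rV[R]_(n + n) | chart_im d (lsubmx z) /\ psi_dom (rsubmx z)].
  apply: openI.
    by apply: open_comp (open_chart_im ad) => z _; exact: lsubmx_continuous.
  by apply: open_comp open_psi_dom => z _; exact: rsubmx_continuous.
pose H (z : 'rV[R]_(n + n)) := row_mx (lsubmx z) (rsubmx z + chart_map c 1%g).
apply: (@smooth_on_eq _ _ _ (fun z => (fun z => f (chart_inv d (lsubmx z) * chart_inv c (rsubmx z))%g) (H z))) => //.
  by move=> z _; rewrite /= row_mxKl row_mxKr.
apply: smooth_on_compv (mul_smooth sf ad ac) _ _ => //.
- exact: open_pim.
- move=> j; case: (split_ordP j) => k ->.
    rewrite (_ : (fun x => _) = fun x : 'rV[R]_(n + n) => x 0 (lshift n k)); last first.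
      by apply/funext => x; rewrite /H row_mxEl mxE.
    exact: smooth_on_coord.
  rewrite (_ : (fun x => _) = fun x : 'rV[R]_(n + n) => x 0 (rshift n k) + chart_map c 1%g 0 k); last first.
    by apply/funext => x; rewrite /H row_mxEr 2!mxE.
  by apply: smooth_onD => //; [exact: smooth_on_coord|exact: smooth_on_cst].
- by move=> z [zd zc]; rewrite /pim /= row_mxKl row_mxKr.
Qed.

(* The left-invariant field whose value at [1] is the [j]-th coordinate vector. *)
Definition ld j f (x : G) : R := partial j (fun w => f (x * psi w)%g) 0.

Lemma translate_psi_smooth f (x : G) : smooth f -> smooth_on psi_dom (fun w => f (x * psi w)%g).
Proof.
move=> sf; have [d ad xd] := chart_at x.
apply: (@smooth_on_eq _ _ _ (fun w => (fun z => f (chart_inv d (lsubmx z) * psi (rsubmx z))%g) (row_mx (chart_map d x) w))).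
- exact: open_psi_dom.
- by move=> w _; rewrite /= row_mxKl row_mxKr chart_mapK.
apply: smooth_on_compv (mul_psi_smooth sf ad) _ _.
- exact: open_psi_dom.
- apply: openI.
    by apply: open_comp (open_chart_im ad) => z _; exact: lsubmx_continuous.
  by apply: open_comp open_psi_dom => z _; exact: rsubmx_continuous.
- move=> j; case: (split_ordP j) => k ->.
    by under eq_fun do rewrite row_mxEl; exact: smooth_on_cst.
  by under eq_fun do rewrite row_mxEr; apply: smooth_on_coord; exact: open_psi_dom.
- by move=> z zd; split; rewrite ?row_mxKl ?row_mxKr//; exact: chart_map_im.
Qed.

Lemma psi_smooth f : smooth f -> smooth_on psi_dom (fun w => f (psi w)).
Proof.
move=> sf; have := translate_psi_smooth 1%g sf.
by under eq_fun do rewrite mul1g.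
Qed.

(** The function (z, w) to f(z psi(w)) is jointly smooth in coordinates; [ld j f] is one of its
    partials in the second block, restricted to w = 0. *)
Lemma ld_smooth j f : smooth f -> smooth (ld j f).
Proof.
move=> sf d ad.
pose F z := f (chart_inv d (lsubmx z) * psi (rsubmx z))%g.
have sF := smooth_on_partial (rshift n j) (mul_psi_smooth sf ad).
apply: (@smooth_on_eq _ _ _ (fun z => partial (rshift n j) F (row_mx z 0))).
- exact: open_chart_im.
- move=> z zd; rewrite -partial_row_mxr /ld; congr partial; apply/funext => w.
  by rewrite /F row_mxKl row_mxKr.
apply: smooth_on_compv sF _ _.
- exact: open_chart_im.
- apply: openI.
    by apply: open_comp (open_chart_im ad) => z _; exact: lsubmx_continuous.
  by apply: open_comp open_psi_dom => z _; exact: rsubmx_continuous.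
- move=> k; case: (split_ordP k) => l ->.
    by under eq_fun do rewrite row_mxEl; apply: smooth_on_coord; exact: open_chart_im.
  by under eq_fun do rewrite row_mxEr; exact: smooth_on_cst.
- by move=> z zd; split; rewrite ?row_mxKl ?row_mxKr//; exact: psi_dom0.
Qed.

Lemma ld_vector_field j : vector_field (fun x f => ld j f x).
Proof.
have D f x : smooth f -> derivable (fun w => f (x * psi w)%g) 0 (e_ R j).
  by move=> sf; exact: (smooth_on_derivable (translate_psi_smooth x sf) psi_dom0).
split=> [x|f]; last exact: ld_smooth.
split=> [a f g sf sg|f g sf sg].
  rewrite /ld /partial [LHS](deriveD (f := fun w => a * f (x * psi w)%g)); [|exact/derivableZ/D|exact: D].
  by congr (_ + _); rewrite [LHS]deriveZ//; exact: D.
rewrite /ld /partial [LHS]deriveM; [|exact: D|exact: D].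
by rewrite psi0 mulg1.
Qed.

Lemma ld_translate j f g x : ld j f (g * x)%g = ld j (fun y => f (g * y)%g) x.
Proof. by rewrite /ld; congr partial; apply/funext => w; rewrite mulgA. Qed.

Lemma ld_left_invariant j : left_invariant (fun x f => ld j f x).
Proof. by move=> g x f _; exact: ld_translate. Qed.

(** Continuity jointly in the base point and the displacement: with compactness of the group it
    makes first-order expansions uniform in the base point. *)
Lemma ld_cont j f (x0 : G) w0 : smooth f -> psi_dom w0 ->
  {for (x0, w0), continuous (fun p : G * 'rV[R]_n => partial j (fun w => f (p.1 * psi w)%g) p.2)}.
Proof.
move=> sf w0d; have [d ad x0d] := chart_at x0.
pose F z := f (chart_inv d (lsubmx z) * psi (rsubmx z))%g.
have sF := smooth_on_partial (rshift n j) (mul_psi_smooth sf ad).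
have E : \forall p \near (x0, w0), partial (rshift n j) F (row_mx (chart_map d p.1) p.2)
    = partial j (fun w => f (p.1 * psi w)%g) p.2.
  exists (chart_dom d, setT) => /=.
    split; [exact: open_nbhs_nbhs (conj (open_chart_dom ad) x0d)|exact: filterT].
  move=> [x w] [/= xd _]; rewrite -partial_row_mxr; congr partial; apply/funext => u.
  by rewrite /F row_mxKl row_mxKr chart_mapK.
apply: (near_continuous_at E).
apply: (@continuous_comp _ _ _ (fun p : G * 'rV[R]_n => row_mx (chart_map d p.1) p.2) (partial (rshift n j) F)).
  apply: row_mx_continuous; last exact: cvg_snd.
  apply: (@continuous_comp _ _ _ fst (chart_map d)); first exact: cvg_fst.
  exact: chart_map_cont.
apply: (smooth_on_cont sF); split; rewrite ?row_mxKl ?row_mxKr//; exact: chart_map_im.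
Qed.

End chart_at_one.

Lemma rint00 (R : realType) n (F : 'rV[R]_n -> R) : rint 0 F 0 = F 0.
Proof.
have m1 : @lebesgue_measure R `[0, 1]%classic = 1%E.
  by have := lebesgue_measure_itv (`[0, 1] : interval R); rewrite /= lte_fin ltr01 -EFinB subr0.
rewrite /rint; under eq_Rintegral do rewrite expr0 mul1r scaler0.
rewrite Rintegral_cst; last exact: measurable_itv.
by rewrite (_ : fine _ = 1) ?mulr1//; exact: (congr1 fine m1).
Qed.

Lemma partial_coord (R : realType) n (k : 'I_n) (x v : 'rV[R]_n) :
  'D_v (fun z : 'rV[R]_n => z 0 k) x = v 0 k.
Proof.
by have := derive_mx (@derivable_id R 'rV[R]_n x v); rewrite derive_id => /matrixP /(_ 0 k); rewrite mxE.
Qed.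

(** * Derivations at a point *)

Section tangent_vector_theory.
Variables (R : realType) (n : nat) (G : lieGroupType R n).
Variable v : (G -> R) -> R.
Variable x : G.
Hypothesis tv : tangent_vector x v.

Lemma tangent0 : v (fun=> 0) = 0.
Proof.
have [lin _] := tv.
have := lin (-1) _ _ (@smooth_cst _ _ G 1) (@smooth_cst _ _ G 1).
by rewrite !mulN1r !addNr.
Qed.

Lemma tangentD f g : smooth f -> smooth g -> v (fun y => f y + g y) = v f + v g.
Proof.
move=> sf sg; have [lin _] := tv; have := lin 1 _ _ sf sg.
by rewrite mul1r => <-; apply: (congr1 v); apply/funext => y; rewrite mul1r.
Qed.

Lemma tangent_cst a : v (fun=> a) = 0.
Proof.
have [lin M] := tv; have s1 := @smooth_cst _ _ G (1 : R).
have v1 : v (fun=> 1) = 0.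
  have := M _ _ s1 s1; rewrite !mul1r => /eqP.
  by rewrite -subr_eq0 opprD addrA subrr sub0r oppr_eq0 => /eqP.
have := lin a _ _ s1 (@smooth_cst _ _ G 0).
by rewrite mulr1 addr0 v1 mulr0 tangent0 addr0.
Qed.

Lemma tangent_sum (I : Type) (r : seq I) (f : I -> G -> R) : (forall i, smooth (f i)) ->
  v (fun y => \sum_(i <- r) f i y) = \sum_(i <- r) v (f i).
Proof.
move=> sf; elim: r => [|i r IH].
  by rewrite big_nil -[RHS]tangent0; apply: (congr1 v); apply/funext => y; rewrite big_nil.
rewrite big_cons -IH -tangentD//; last exact: smooth_sum.
by apply: (congr1 v); apply/funext => y; rewrite big_cons.
Qed.

End tangent_vector_theory.

(** * Cutoff coordinates and the components of a derivation *)

Section cutoff.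
Variables (R : realType) (n : nat) (G : lieGroupType R n).
Variable c : chart R n G.
Hypotheses (ac : atlas c) (c1 : chart_dom c 1%g).
Variables (r : R) (chi : 'rV[R]_n -> R).
Hypotheses (r0 : 0 < r) (rdom : forall w : 'rV[R]_n, `|w| < r -> psi_dom c w).
Hypotheses (schi : smooth_on setT chi) (chi0 : forall z, r / 2 <= `|z| -> chi z = 0).

Definition cut_dom : set G := chart_dom c `&` (phi c) @^-1` oball n r.

Lemma open_cut_dom : open cut_dom.
Proof.
apply: open_cont_preimage; [exact: open_chart_dom|exact: open_oball|].
by move=> x xc; exact: phi_cont.
Qed.

Lemma psi_cut_dom w : `|w| < r -> cut_dom (psi c w).
Proof. by move=> wr; split; [exact/psi_in/rdom|rewrite /= psiK//; exact: rdom]. Qed.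

(** The coordinate map is arbitrary off the chart domain, so the value there is prescribed and not
    inherited from the vanishing of [chi]. *)
Definition cutoff (h : 'rV[R]_n -> R) (x : G) : R :=
  if `[< cut_dom x >] then chi (phi c x) * h (phi c x) else 0.

Lemma cutoff_in h x : cut_dom x -> cutoff h x = chi (phi c x) * h (phi c x).
Proof. by move=> xd; rewrite /cutoff; case: asboolP. Qed.

Lemma cutoff_out h x : ~ cut_dom x -> cutoff h x = 0.
Proof. by move=> xd; rewrite /cutoff; case: asboolP. Qed.

Lemma cutoff_psi h w : `|w| < r -> cutoff h (psi c w) = chi w * h w.
Proof. by move=> wr; rewrite cutoff_in ?psiK//; [exact: rdom|exact: psi_cut_dom]. Qed.

Let K : set G := psi c @` [set w : 'rV[R]_n | `|w| <= r / 2].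

Let KE (w : 'rV[R]_n) : `|w| <= r / 2 -> `|w| < r.
Proof. by move=> h; rewrite (le_lt_trans h)// ltr_pdivrMr// mulr_natr mulr2n ltrDl. Qed.

Let closedK : closed K.
Proof.
apply: compact_closed; first exact: lie_hausdorff.
apply: continuous_compact; last exact: compact_cball.
apply: continuous_in_subspaceT => w /set_mem wr.
by apply: psi_cont => //; exact/rdom/KE.
Qed.

(** Inside [cut_dom] the function is smooth in coordinates. Any other point lies outside [K], which
    is compact, hence closed in the Hausdorff space [G], and off [K] the function is zero. The two
    open sets cover [G]. *)
Lemma cutoff_smooth h : smooth_on (oball n r) h -> smooth (cutoff h).
Proof.
move=> sh d ad; apply: smooth_on_local => z zd.
have cd u : chart_im d u -> {for u, continuous (chart_inv d)} by exact: chart_inv_cont.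
have [yd|yd] := pselect (cut_dom (chart_inv d z)).
  pose V := chart_im d `&` (chart_inv d) @^-1` cut_dom.
  have oV : open V.
    by apply: open_cont_preimage => //; [exact: open_chart_im|exact: open_cut_dom].
  exists V; split => //.
  apply: (@smooth_on_eq _ _ _ (fun u => (fun w => chi w * h w) (phi c (chart_inv d u)))) => //.
    by move=> u [_ ud]; rewrite cutoff_in.
  apply: (@smooth_on_compv _ _ _ _ (oball n r) (fun w => chi w * h w) (fun u => phi c (chart_inv d u))) => //.
  - exact: open_oball.
  - apply: smooth_onM => //; first exact: open_oball.
    exact: smooth_on_sub schi.
  - move=> j.
    have [_ _ /(_ d c ad ac j) h'] := @atlasP R n G.
    rewrite (_ : (fun x => _) = fun u => chart_map c (chart_inv d u) 0 j + (- chart_map c 1%g 0 j)); last first.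
      by apply/funext => u; rewrite /phi !mxE.
    apply: smooth_onD => //; last exact: smooth_on_cst.
    apply: smooth_on_sub h' => u [ud [uc _]]; exists (chart_inv d u); last exact: chart_invK.
    by split => //; exact: chart_inv_dom.
  - by move=> u [_ [_ ur]].
have yK : ~ K (chart_inv d z).
  by move=> [w wr wE]; apply: yd; rewrite -wE; apply/psi_cut_dom/KE.
pose V := chart_im d `&` (chart_inv d) @^-1` (~` K).
have oV : open V.
  by apply: open_cont_preimage => //; [exact: open_chart_im|exact: closed_openC].
exists V; split => //.
apply: (@smooth_on_eq _ _ _ (fun=> 0)) => //; last exact: smooth_on_cst.
move=> u [ud uK].
have [uc|uc] := pselect (cut_dom (chart_inv d u)); last by rewrite cutoff_out.
rewrite cutoff_in// chi0 ?mul0r// leNgt; apply/negP => h1; apply: uK.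
by exists (phi c (chart_inv d u)); [exact: ltW|rewrite phiK//; case: uc].
Qed.

(* Global smooth functions which agree with the coordinates near [1]. *)
Definition xi k : G -> R := cutoff (fun w => w 0 k).

Lemma xi_smooth k : smooth (xi k).
Proof. by apply: cutoff_smooth; apply: smooth_on_coord; exact: open_oball. Qed.

(** A derivation is only known on global smooth functions, so Hadamard's lemma is globalised with
    cutoffs: f - f(1) is the sum of the products [xi k * cutoff (g k)] and of
    [(1 - X^2) * (f - f(1))]. In the last product both factors vanish at 1, so the product rule
    kills it. *)
Lemma tangent_coord (v : (G -> R) -> R) f : chi 0 = 1 -> tangent_vector 1%g v -> smooth f ->
  v f = \sum_(k < n) v (xi k) * ld c k f 1%g.
Proof.
move=> chi01 tv sf.
pose F w := f (psi c w).
have sF : smooth_on (oball n r) F by apply: smooth_on_sub (psi_smooth ac sf) => w /rdom.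
pose g k := rint 0 (partial k F).
have sg k : smooth_on (oball n r) (g k) by apply/rint_smooth/smooth_on_partial.
pose X := cutoff (fun=> 1).
have sX : smooth X by apply/cutoff_smooth/smooth_on_cst.
have d1 : cut_dom 1%g by split => //; rewrite /= phi1 /oball /= normr0.
have X1 : X 1%g = 1 by rewrite /X cutoff_in// phi1 chi01 mulr1.
have sf1 : smooth (fun y => f y + - f 1%g) by apply: smoothD => //; exact: smooth_cst.
have sX2 : smooth (fun y => 1 + (-1) * (X y * X y)).
  apply: smoothD; first exact: smooth_cst.
  by apply: smoothM; [exact: smooth_cst|exact: smoothM].
(* [X] appears squared because each [xi k * cutoff (g k)] carries two factors [chi]. *)
have E : f = fun y => f 1%g + ((1 + (-1) * (X y * X y)) * (f y + - f 1%g) + \sum_(k < n) xi k y * cutoff (g k) y).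
  apply/funext => y; have [yd|yd] := pselect (cut_dom y).
    have Bw : oball n r (phi c y) by case: yd.
    have H : \sum_(k < n) xi k y * cutoff (g k) y = chi (phi c y) ^+ 2 * (f y - f 1%g).
      have -> : f y - f 1%g = F (phi c y) - F 0 by rewrite /F phiK ?psi0//; case: yd.
      rewrite (hadamard sF Bw) mulr_sumr; apply: eq_bigr => k _.
      by rewrite /xi !cutoff_in// /g; ring.
    by rewrite H /X cutoff_in//; ring.
  rewrite /X !cutoff_out// big1; last by move=> k _; rewrite /xi cutoff_out// mul0r.
  by ring.
have sxg k : smooth (fun y => xi k y * cutoff (g k) y).
  by apply: smoothM; [exact: xi_smooth|exact: cutoff_smooth].
rewrite {1}E (tangentD tv); [|exact: smooth_cst| ]; last first.
  by apply: smoothD; [exact: smoothM|exact: smooth_sum].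
rewrite (tangent_cst tv) add0r (tangentD tv); [|exact: smoothM|exact: smooth_sum].
rewrite (tangent_sum tv)//.
have [_ M] := tv.
rewrite M// X1 mulr1 mulN1r subrr mul0r subrr mul0r add0r add0r.
apply: eq_bigr => k _; rewrite M//; [|exact: xi_smooth|exact: cutoff_smooth].
rewrite {1}/xi cutoff_in// phi1 mxE mulr0 mul0r add0r cutoff_in// phi1 chi01 mul1r mulrC.
congr (_ * _); rewrite /g rint00 /ld.
by congr partial; apply/funext => w; rewrite mul1g.
Qed.

(** Left invariance moves the base point to 1, so the coefficients do not depend on [x]. *)
Lemma left_invariant_coord (Z : vfield R G) f x : chi 0 = 1 ->
  vector_field Z -> left_invariant Z -> smooth f ->
  Z x f = \sum_(k < n) Z 1%g (xi k) * ld c k f x.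
Proof.
move=> chi01 [tZ _] lZ sf; rewrite -[in LHS](mulg1 x) lZ//.
rewrite (tangent_coord chi01 (tZ _) (smooth_left_translate x sf)).
by apply: eq_bigr => k _; rewrite -ld_translate mulg1.
Qed.

Lemma ld_xi j k : (\forall z \near (0 : 'rV[R]_n), chi z = 1) ->
  ld c j (xi k) 1%g = (k == j)%:R.
Proof.
move=> near1; rewrite /ld.
have E : \forall z \near (0 : 'rV[R]_n), (z : 'rV[R]_n) 0 k = xi k (1 * psi c z)%g.
  have n0 : nbhs (0 : 'rV[R]_n) (oball n r).
    by apply: open_nbhs_nbhs; split; [exact: open_oball|rewrite /oball /= normr0].
  by apply: nbhsS2 n0 near1 => z zr z1; rewrite mul1g /xi cutoff_psi// z1 mul1r.
by rewrite /partial -(near_eq_derive _ E) partial_coord mxE eqxx.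
Qed.

End cutoff.

(** * The group law to second order *)

Lemma norm_row_mx (R : realType) n1 n2 (z : 'rV[R]_n1) (w : 'rV[R]_n2) e :
  `|z| < e -> `|w| < e -> `|row_mx z w| < e.
Proof.
move=> ze we; have e0 : 0 < e by rewrite (le_lt_trans _ ze).
have m : Num.max `|z| `|w| < e by rewrite gt_max ze we.
apply: le_lt_trans m; apply: norm_leP; first by rewrite le_max normr_ge0.
move=> i; case: (split_ordP i) => k ->; rewrite ?row_mxEl ?row_mxEr le_max.
  by rewrite coord_le_norm.
by rewrite coord_le_norm orbT.
Qed.

Lemma norm_row_mxD (R : realType) n1 n2 (z : 'rV[R]_n1) (w : 'rV[R]_n2) :
  `|row_mx z w| <= `|z| + `|w|.
Proof.
apply: norm_leP => [|i]; first exact: addr_ge0.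
case: (split_ordP i) => k ->; rewrite ?row_mxEl ?row_mxEr.
  by rewrite (le_trans (coord_le_norm z k))// lerDl.
by rewrite (le_trans (coord_le_norm w k))// lerDr.
Qed.

Lemma smooth_bounded (R : realType) N (g : 'rV[R]_N -> R) (rho s : R) :
  smooth_on (oball N rho) g -> 0 <= s -> s < rho ->
  exists2 C, 0 <= C & forall p, `|p| <= s -> `|g p| <= C.
Proof.
move=> sg s0 sr.
have [||| c _ hc] := @compact_EVT_max 'rV[R]_N R (fun y => `|g y|) [set p | `|p| <= s].
- by exists 0; rewrite /= normr0.
- exact: compact_cball.
- apply: continuous_in_subspaceT => y /set_mem ys.
  apply: (@continuous_comp _ _ _ g (fun t => `|t|)); last exact: norm_continuous.
  exact: (smooth_on_cont sg (le_lt_trans ys sr)).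
- by exists `|g c| => // y Ky; apply: hc; apply/mem_set.
Qed.

Lemma smooth_lipschitz (R : realType) N (g : 'rV[R]_N -> R) (rho s : R) :
  smooth_on (oball N rho) g -> 0 <= s -> s < rho ->
  exists2 C, 0 <= C & forall p, `|p| <= s -> `|g p - g 0| <= C * `|p|.
Proof.
move=> sg s0 sr.
have /choice[C hC] i := (fun i => let: ex_intro2 C C0 h := smooth_bounded (smooth_on_partial i sg) s0 sr in
  ex_intro (fun C => 0 <= C /\ forall p, `|p| <= s -> `|partial i g p| <= C) C (conj C0 h)) i.
exists (\sum_i C i); first by apply: sumr_ge0 => i _; case: (hC i).
move=> p ps.
have [z zp i|xi [xip ->]] := @mean_value R N g 0 p.
  rewrite !subr0 in zp; apply: (smooth_on_derivable sg).
  by rewrite /oball /= (le_lt_trans _ sr)// (le_trans zp).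
apply: (le_trans (ler_norm_sum _ _ _)); rewrite mulr_suml; apply: ler_sum => i _.
rewrite mxE subr0 normrM mulrC ler_pM//; last exact: coord_le_norm.
by have [_] := hC i; apply; have := xip i; rewrite !subr0 => /le_trans; apply.
Qed.

Lemma smooth_on_row_mxr (R : realType) n1 n2 (g : 'rV[R]_(n1 + n2) -> R) rho (z : 'rV[R]_n1) :
  smooth_on (oball (n1 + n2) rho) g -> `|z| < rho ->
  smooth_on (oball n2 rho) (fun w => g (row_mx z w)).
Proof.
move=> sg zr; apply: smooth_on_compv sg _ _; try exact: open_oball.
  move=> j; case: (split_ordP j) => k ->.
    by under eq_fun do rewrite row_mxEl; exact: smooth_on_cst.
  by under eq_fun do rewrite row_mxEr; apply: smooth_on_coord; exact: open_oball.
by move=> w wr; exact: norm_row_mx.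
Qed.

Lemma smooth_on_row_mxl (R : realType) n1 n2 (g : 'rV[R]_(n1 + n2) -> R) rho (w : 'rV[R]_n2) :
  smooth_on (oball (n1 + n2) rho) g -> `|w| < rho ->
  smooth_on (oball n1 rho) (fun z => g (row_mx z w)).
Proof.
move=> sg wr; apply: smooth_on_compv sg _ _; try exact: open_oball.
  move=> j; case: (split_ordP j) => k ->.
    by under eq_fun do rewrite row_mxEl; apply: smooth_on_coord; exact: open_oball.
  by under eq_fun do rewrite row_mxEr; exact: smooth_on_cst.
by move=> z zr; exact: norm_row_mx.
Qed.

(** On both axes [g] is a coordinate. The mean value theorem in [w], then in [z], therefore leaves
    only terms z_i w_j times mixed second derivatives at intermediate points. Their boundedness
    gives the first estimate, their Lipschitz bound at 0 the second. *)
Lemma law_expansion (R : realType) n (g : 'rV[R]_(n + n) -> R) (rho : R) (k : 'I_n) : 0 < rho ->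
  smooth_on (oball (n + n) rho) g ->
  (forall z, `|z| < rho -> g (row_mx z 0) = z 0 k) ->
  (forall w, `|w| < rho -> g (row_mx 0 w) = w 0 k) ->
  let B i j := partial (lshift n i) (partial (rshift n j) g) 0 in
  exists2 C, 0 <= C & forall z w : 'rV[R]_n, `|z| < rho / 2 -> `|w| < rho / 2 ->
    `|g (row_mx z w) - z 0 k - w 0 k| <= C * (`|z| * `|w|) /\
    `|g (row_mx z w) - z 0 k - w 0 k - \sum_(j < n) \sum_(i < n) z 0 i * w 0 j * B i j| <=
       C * (`|z| * `|w| * (`|z| + `|w|)).
Proof.
move=> rho0 sg gz gw B.
have rho2 : 0 < rho / 2 by rewrite divr_gt0.
have rho2' : rho / 2 < rho by rewrite ltr_pdivrMr// mulr_natr mulr2n ltrDl.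
pose D i j := partial (lshift n i) (partial (rshift n j) g).
have sD i j : smooth_on (oball (n + n) rho) (D i j) by do 2 apply: smooth_on_partial.
have /choice[C1 hC1] (ij : 'I_n * 'I_n) : exists C, 0 <= C /\ forall p, `|p| <= rho / 2 -> `|D ij.1 ij.2 p| <= C.
  by have [C C0 h] := smooth_bounded (sD ij.1 ij.2) (ltW rho2) rho2'; exists C.
have /choice[C2 hC2] (ij : 'I_n * 'I_n) : exists C, 0 <= C /\ forall p, `|p| <= rho / 2 -> `|D ij.1 ij.2 p - D ij.1 ij.2 0| <= C * `|p|.
  by have [C C0 h] := smooth_lipschitz (sD ij.1 ij.2) (ltW rho2) rho2'; exists C.
pose S := \sum_(j < n) \sum_(i < n) (C1 (i, j) + C2 (i, j)).
have S0 : 0 <= S.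
  apply: sumr_ge0 => j _; apply: sumr_ge0 => i _; apply: addr_ge0.
    by case: (hC1 (i, j)).
  by case: (hC2 (i, j)).
exists S => // z w zr wr.
have zr' := lt_trans zr rho2'; have wr' := lt_trans wr rho2'.
have [|a [aw Ea]] := @mean_value R n (fun w => g (row_mx z w)) 0 w.
  move=> u; rewrite !subr0 => uw j.
  by apply: (smooth_on_derivable (smooth_on_row_mxr sg zr')); exact: le_lt_trans uw wr'.
rewrite gz// in Ea.
have aww j : `|a j| <= `|w| by have := aw j; rewrite !subr0.
have aw' j : `|a j| < rho by exact: le_lt_trans (aww j) wr'.
(* The derivative in w_j at (0, a_j) is 1 or 0 because [g] is the coordinate [w 0 k] near that point
   of the second axis. *)
have step j : exists b : 'I_n -> 'rV[R]_n, (forall i, `|b i| <= `|z|) /\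
    partial j (fun w => g (row_mx z w)) (a j) =
    (j == k)%:R + \sum_(i < n) z 0 i * D i j (row_mx (b i) (a j)).
  have sH := smooth_on_partial (rshift n j) sg.
  have [|b [bz Eb]] := @mean_value R n (fun z => partial (rshift n j) g (row_mx z (a j))) 0 z.
    move=> u; rewrite !subr0 => uz i.
    by apply: (smooth_on_derivable (smooth_on_row_mxl sH (aw' j))); exact: le_lt_trans uz zr'.
  exists b; split; first by move=> i; have := bz i; rewrite !subr0.
  rewrite partial_row_mxr -[LHS](subrK (partial (rshift n j) g (row_mx 0 (a j)))) Eb addrC.
  congr (_ + _); last first.
    by apply: eq_bigr => i _; rewrite mxE subr0 partial_row_mxl.
  rewrite -partial_row_mxr.
  have E : \forall w \near a j, g (row_mx 0 w) = (w : 'rV[R]_n) 0 k.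
    by apply: nbhsS (open_nbhs_nbhs (conj (@open_oball R n rho) (aw' j))) => u; exact: gw.
  by rewrite /partial (near_eq_derive _ E) partial_coord mxE eqxx eq_sym.
have [b hb] := choice step.
pose p i j := row_mx (b j i) (a j).
have pz i j : `|p i j| <= `|z| + `|w|.
  by apply: (le_trans (norm_row_mxD _ _)); rewrite lerD//; case: (hb j).
have pr i j : `|p i j| <= rho / 2.
  apply: ltW; apply: norm_row_mx; last exact: le_lt_trans (aww j) wr.
  by case: (hb j) => h _; exact: le_lt_trans (h i) zr.
have E : g (row_mx z w) - z 0 k - w 0 k = \sum_(j < n) \sum_(i < n) z 0 i * w 0 j * D i j (p i j).
  rewrite Ea.
  under eq_bigr => j _.
    have [_ ->] := hb j; rewrite mxE subr0 mulrDr mulr_sumr.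
    over.
  rewrite big_split /= (bigD1 k)//= eqxx mulr1 big1 ?addr0; last first.
    by move=> j jk; rewrite (negbTE jk) mulr0.
  rewrite addrAC subrr add0r; apply: eq_bigr => j _; apply: eq_bigr => i _.
  by rewrite /p mulrCA mulrA.
have zw i j : `|z 0 i * w 0 j| <= `|z| * `|w|.
  by rewrite normrM ler_pM// coord_le_norm.
split.
  rewrite E; apply: (le_trans (ler_norm_sum _ _ _)); rewrite /S mulr_suml.
  apply: ler_sum => j _; apply: (le_trans (ler_norm_sum _ _ _)); rewrite mulr_suml.
  apply: ler_sum => i _; rewrite normrM mulrC ler_pM//.
  have [_ /(_ _ (pr i j)) /= h] := hC1 (i, j); apply: (le_trans h); rewrite lerDl.
  by case: (hC2 (i, j)).
rewrite E -sumrB; apply: (le_trans (ler_norm_sum _ _ _)); rewrite /S mulr_suml.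
apply: ler_sum => j _; rewrite -sumrB; apply: (le_trans (ler_norm_sum _ _ _)); rewrite mulr_suml.
apply: ler_sum => i _; rewrite -mulrBr normrM mulrCA ler_pM//.
have [_ /(_ _ (pr i j)) /= h] := hC2 (i, j); apply: (le_trans h).
have [c10 _] := hC1 (i, j); have [c20 _] := hC2 (i, j).
by rewrite ler_pM// lerDr.
Qed.

Lemma subvE (R : realType) n (x y : 'rV[R]_n) k : (x - y) 0 k = x 0 k - y 0 k.
Proof. by rewrite !mxE. Qed.

Section local_group_law.
Variables (R : realType) (n : nat) (G : lieGroupType R n).
Variable c : chart R n G.
Hypotheses (ac : atlas c) (c1 : chart_dom c 1%g).
Variables (r : R) (chi : 'rV[R]_n -> R).
Hypotheses (r0 : 0 < r) (rdom : forall w : 'rV[R]_n, `|w| < r -> psi_dom c w).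
Hypotheses (schi : smooth_on setT chi) (chi0 : forall z, r / 2 <= `|z| -> chi z = 0).
Hypothesis chi1 : \forall z \near (0 : 'rV[R]_n), chi z = 1.
Notation psi := (psi c).
Notation phi := (phi c).
Notation xi := (xi c r chi).

(** Using the global functions [xi] instead of [phi] keeps this smooth without asking that the
    product remain in the chart; for small arguments the two agree. *)
Definition law (z w : 'rV[R]_n) : 'rV[R]_n := \row_k xi k (psi z * psi w)%g.

Definition law_fun k (p : 'rV[R]_(n + n)) : R := xi k (psi (lsubmx p) * psi (rsubmx p))%g.

Lemma law_fun_row k z w : law_fun k (row_mx z w) = law z w 0 k.
Proof. by rewrite /law_fun row_mxKl row_mxKr mxE. Qed.

Lemma law_fun_smooth k : smooth_on (oball (n + n) r) (law_fun k).
Proof.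
pose H (p : 'rV[R]_(n + n)) := row_mx (lsubmx p + chart_map c 1%g) (rsubmx p).
have sx : smooth (xi k) by exact: xi_smooth.
apply: (@smooth_on_eq _ _ _ (fun p => (fun z => xi k (chart_inv c (lsubmx z) * psi (rsubmx z))%g) (H p))).
- exact: open_oball.
- by move=> p _; rewrite /= row_mxKl row_mxKr.
have sub p : oball (n + n) r p -> `|lsubmx p| < r /\ `|rsubmx p| < r.
  move=> pr; split; apply: le_lt_trans pr.
    apply: norm_leP => // i.
    by rewrite -(row_mxEl (lsubmx p) (rsubmx p)) hsubmxK; exact: coord_le_norm.
  apply: norm_leP => // i.
  by rewrite -(row_mxEr (lsubmx p) (rsubmx p)) hsubmxK; exact: coord_le_norm.
apply: smooth_on_compv (mul_psi_smooth ac sx ac) _ _.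
- exact: open_oball.
- apply: openI.
    by apply: open_comp (open_chart_im ac) => z _; exact: lsubmx_continuous.
  by apply: open_comp (open_psi_dom ac) => z _; exact: rsubmx_continuous.
- move=> j; case: (split_ordP j) => l ->.
    rewrite (_ : (fun x => _) = fun x : 'rV[R]_(n + n) => x 0 (lshift n l) + chart_map c 1%g 0 l); last first.
      by apply/funext => x; rewrite /H row_mxEl 2!mxE.
    by apply: smooth_onD; [exact: open_oball|apply: smooth_on_coord; exact: open_oball|exact: smooth_on_cst].
  rewrite (_ : (fun x => _) = fun x : 'rV[R]_(n + n) => x 0 (rshift n l)); last first.
    by apply/funext => x; rewrite /H row_mxEr mxE.
  by apply: smooth_on_coord; exact: open_oball.
- move=> p /sub[p1 p2]; split; rewrite /H ?row_mxKl ?row_mxKr; last exact: rdom.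
  exact: rdom p1.
Qed.

(* The mixed second-order part of the group law: [law z w = z + w + bil z w + O(3)]. *)
Definition bil (z w : 'rV[R]_n) : 'rV[R]_n := \row_k \sum_(j < n) \sum_(i < n)
  z 0 i * w 0 j * partial (lshift n i) (partial (rshift n j) (law_fun k)) 0.

Let coords x := \row_k xi k x : 'rV[R]_n.

Lemma law_estimates : exists rho C, [/\ 0 < rho, rho <= r, 0 <= C,
  (forall x, chart_dom c x -> `|phi x| < rho -> coords x = phi x) &
  forall z w, `|z| < rho -> `|w| < rho ->
   [/\ psi (law z w) = (psi z * psi w)%g,
       `|law z w - z - w| <= C * (`|z| * `|w|) &
       `|law z w - z - w - bil z w| <= C * (`|z| * `|w| * (`|z| + `|w|))]].
Proof.
have /nbhs_rVP[r1' r1'0 h1'] := chi1.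
pose r1 := Num.min r1' r.
have r10 : 0 < r1 by rewrite lt_min r1'0.
have h1 w : `|w| < r1 -> chi w = 1.
  by rewrite lt_min => /andP[h _]; apply: h1'; rewrite subr0.
have r1r (w : 'rV[R]_n) : `|w| < r1 -> `|w| < r by rewrite lt_min => /andP[].
have cE x : chart_dom c x -> `|phi x| < r1 -> coords x = phi x.
  move=> xc xr; apply/rowP => k; rewrite mxE /xi cutoff_in; first by rewrite h1// mul1r.
  by split => //; exact: r1r.
have cpsi w : `|w| < r1 -> coords (psi w) = w.
  move=> wr; have wd := rdom (r1r _ wr).
  by rewrite (cE _ (psi_in ac wd)) (psiK ac wd).
pose W1 := chart_dom c `&` phi @^-1` oball n r1.
have oW1 : open W1.
  apply: open_cont_preimage; [exact: open_chart_dom|exact: open_oball|].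
  by move=> x xc; exact: phi_cont.
have W11 : W1 1%g by split => //; rewrite /= phi1 /oball /= normr0.
(* By continuity of the product, small factors land where [chi] is 1, so that there the cutoff
   coordinates are true coordinates. *)
have [r2 r20 h2] : exists2 r2, 0 < r2 & forall z w, `|z| < r2 -> `|w| < r2 -> W1 (psi z * psi w)%g.
  have psic : {for (0 : 'rV[R]_n), continuous psi} by apply: psi_cont => //; exact: psi_dom0.
  have cm : {for ((0 : 'rV[R]_n), (0 : 'rV[R]_n)), continuous (fun p : 'rV[R]_n * 'rV[R]_n => (psi p.1 * psi p.2)%g)}.
    apply: mulg_cont.
      by apply: (@continuous_comp _ _ _ fst psi); [exact: cvg_fst|].
    by apply: (@continuous_comp _ _ _ snd psi); [exact: cvg_snd|].
  have nW : nbhs (psi 0 * psi 0)%g W1 by rewrite psi0// mulg1; exact: open_nbhs_nbhs.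
  have [[A B] /= [/nbhs_rVP[a a0 hA] /nbhs_rVP[b b0 hB]] AB] := cm _ nW.
  exists (Num.min a b); first by rewrite lt_min a0.
  move=> z w; rewrite !lt_min => /andP[za _] /andP[_ wb].
  by apply: (AB (z, w)); split; [apply: hA; rewrite subr0|apply: hB; rewrite subr0].
have law0 z : `|z| < r1 -> law z 0 = z.
  by move=> zr; rewrite /law psi0// mulg1; exact: cpsi.
have lawr w : `|w| < r1 -> law 0 w = w.
  by move=> wr; rewrite /law psi0// mul1g; exact: cpsi.
have /choice[C hC] k : exists C, 0 <= C /\ forall z w : 'rV[R]_n, `|z| < r1 / 2 -> `|w| < r1 / 2 ->
    `|law z w 0 k - z 0 k - w 0 k| <= C * (`|z| * `|w|) /\
    `|law z w 0 k - z 0 k - w 0 k - bil z w 0 k| <= C * (`|z| * `|w| * (`|z| + `|w|)).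
  have sg : smooth_on (oball (n + n) r1) (law_fun k).
    by apply: smooth_on_sub (law_fun_smooth k) => p; rewrite /oball /= lt_min => /andP[].
  have [||C C0 hC] := law_expansion (k := k) r10 sg.
  - by move=> z zr; rewrite law_fun_row law0.
  - by move=> w wr; rewrite law_fun_row lawr.
  exists C; split => // z w zr wr; have := hC z w zr wr.
  by rewrite law_fun_row [bil z w 0 k]mxE.
have C0 : 0 <= \sum_k C k by apply: sumr_ge0 => k _; case: (hC k).
have CS k : C k <= \sum_k C k.
  by rewrite (bigD1 k)//= lerDl; apply: sumr_ge0 => j _; case: (hC j).
have r120 : 0 < r1 / 2 by rewrite divr_gt0.
have r12 : r1 / 2 < r1 by rewrite ltr_pdivrMr// mulr_natr mulr2n ltrDl.
exists (Num.min r2 (r1 / 2)), (\sum_k C k); split => //.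
- by rewrite lt_min r20.
- by rewrite ge_min (le_trans (ltW r12)) ?orbT// /r1 ge_min lexx orbT.
- move=> x xc; rewrite lt_min => /andP[_ xr]; apply: cE => //; exact: lt_trans r12.
- move=> z w; rewrite !lt_min => /andP[z2 z1] /andP[w2 w1].
  have [xc xr] := h2 z w z2 w2.
  split.
  + by rewrite /law -[RHS](phiK _ xc)//; congr psi; exact: cE.
  + apply: norm_leP => [|k]; first by rewrite !mulr_ge0.
    rewrite 2!subvE; have [_ /(_ z w z1 w1)[h _]] := hC k.
    by apply: (le_trans h); rewrite ler_wpM2r// mulr_ge0.
  + apply: norm_leP => [|k]; first by rewrite !mulr_ge0// addr_ge0.
    rewrite 3!subvE; have [_ /(_ z w z1 w1)[_ h]] := hC k.
    by apply: (le_trans h); rewrite ler_wpM2r// !mulr_ge0// addr_ge0.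
Qed.

Lemma bilDl u v w : bil (u + v) w = bil u w + bil v w.
Proof.
apply/rowP => k; rewrite !mxE -big_split /=; apply: eq_bigr => j _.
by rewrite -big_split /=; apply: eq_bigr => i _; rewrite mxE !mulrDl.
Qed.

Lemma bilDr u v w : bil w (u + v) = bil w u + bil w v.
Proof.
apply/rowP => k; rewrite !mxE -big_split /=; apply: eq_bigr => j _.
by rewrite -big_split /=; apply: eq_bigr => i _; rewrite mxE mulrDr mulrDl.
Qed.

Lemma bilZl a u w : bil (a *: u) w = a *: bil u w.
Proof.
apply/rowP => k; rewrite !mxE mulr_sumr; apply: eq_bigr => j _.
by rewrite mulr_sumr; apply: eq_bigr => i _; rewrite mxE !mulrA.
Qed.

Lemma bilZr a u w : bil w (a *: u) = a *: bil w u.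
Proof.
apply/rowP => k; rewrite !mxE mulr_sumr; apply: eq_bigr => j _.
by rewrite mulr_sumr; apply: eq_bigr => i _; rewrite mxE !mulrA (mulrC (w 0 i)).
Qed.

Lemma bil_bound : exists2 C, 0 <= C & forall z w, `|bil z w| <= C * (`|z| * `|w|).
Proof.
pose B k (j i : 'I_n) := partial (lshift n i) (partial (rshift n j) (law_fun k)) 0.
pose S k := \sum_(j < n) \sum_(i < n) `|B k j i|.
have S0 k : 0 <= S k by do 2 apply: sumr_ge0 => ? _.
exists (\sum_k S k); first by apply: sumr_ge0.
move=> z w; apply: norm_leP => [|k]; first by rewrite !mulr_ge0// sumr_ge0.
apply: (@le_trans _ _ (S k * (`|z| * `|w|))); last first.
  by rewrite ler_wpM2r ?mulr_ge0// [leRHS](bigD1 k)//= lerDl sumr_ge0.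
rewrite mxE /S mulr_suml; apply: (le_trans (ler_norm_sum _ _ _)); apply: ler_sum => j _.
rewrite mulr_suml; apply: (le_trans (ler_norm_sum _ _ _)); apply: ler_sum => i _.
by rewrite normrM mulrC ler_wpM2l// normrM ler_pM// coord_le_norm.
Qed.

(** The Lie bracket of the tangent space at 1 in these coordinates; [vec_bracket] identifies it with
    the bracket of left-invariant fields. *)
Definition comm_bil z w := bil z w - bil w z.

(** The facts on the group law that the approximation argument uses. For division, u = w^-1 z
    satisfies [law w u = z], so u differs from z - w by at most C|w||u|, half of which size is
    absorbed into |u|. For the commutator, divide p = [law z w] by q = [law w z]: then u is p - q up
    to C|q||u|, and p - q is [comm_bil z w] up to third order. *)
Lemma local_group : exists rho C, [/\ 0 < rho, rho <= r, 0 <= C &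
  forall z w, `|z| < rho -> `|w| < rho ->
   [/\ exists q, psi q = (psi z * psi w)%g /\ `|q - z - w| <= C * (`|z| * `|w|),
       exists u, psi z = (psi w * psi u)%g /\ `|u| <= 2 * `|z - w| &
       exists u, (psi z * psi w = psi w * psi z * psi u)%g /\
         `|u - comm_bil z w| <= C * (`|z| * `|w| * (`|z| + `|w|))]].
Proof.
have [rho [C [rho0 rhor C0 cE est]]] := law_estimates.
(* Chosen so that [C * e <= 1/2], which lets the error C|w||u| be absorbed. *)
pose e := Num.min rho (2 * (C + 1))^-1.
have C10 : 0 < C + 1 by rewrite ltr_wpDl.
have e0 : 0 < e by rewrite lt_min rho0 invr_gt0 mulr_gt0.
have erho t : t < e -> t < rho by rewrite lt_min => /andP[].
have eC t : 0 <= t -> t < e -> C * t <= 2^-1.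
  move=> t0; rewrite lt_min invfM => /andP[_ /ltW te].
  rewrite (@le_trans _ _ ((C + 1) * t))// ?ler_wpM2r ?lerDl//.
  by rewrite -ler_pdivlMl// mulrC.
have rd (w : 'rV[R]_n) : `|w| < rho -> psi_dom c w by move=> h; apply/rdom/(lt_le_trans h).
pose W := chart_dom c `&` phi @^-1` oball n e.
have oW : open W.
  apply: open_cont_preimage; [exact: open_chart_dom|exact: open_oball|].
  by move=> x xc; exact: phi_cont.
have W1 : W 1%g by split => //; rewrite /= phi1 /oball /= normr0.
have [r2 r20 h2] : exists2 r2, 0 < r2 & forall z w, `|z| < r2 -> `|w| < r2 -> W ((psi w)^-1 * psi z)%g.
  have psic : {for (0 : 'rV[R]_n), continuous psi} by apply: psi_cont => //; exact: psi_dom0.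
  have cm : {for ((0 : 'rV[R]_n), (0 : 'rV[R]_n)), continuous (fun p : 'rV[R]_n * 'rV[R]_n => ((psi p.2)^-1 * psi p.1)%g)}.
    apply: mulg_cont.
      apply: (@continuous_comp _ _ _ (fun p : 'rV[R]_n * 'rV[R]_n => psi p.2) (fun x : G => x^-1%g)); last exact: invg_continuous.
      by apply: (@continuous_comp _ _ _ snd psi); [exact: cvg_snd|].
    by apply: (@continuous_comp _ _ _ fst psi); [exact: cvg_fst|].
  have nW : nbhs ((psi 0)^-1 * psi 0)%g W by rewrite mulVg; exact: open_nbhs_nbhs.
  have [[A B] /= [/nbhs_rVP[a a0 hA] /nbhs_rVP[b b0 hB]] AB] := cm _ nW.
  exists (Num.min a b); first by rewrite lt_min a0.
  move=> z w; rewrite !lt_min => /andP[za _] /andP[_ wb].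
  by apply: (AB (z, w)); split; [apply: hA; rewrite subr0|apply: hB; rewrite subr0].
pose r3 := Num.min r2 e.
have r30 : 0 < r3 by rewrite lt_min r20.
have div z w : `|z| < r3 -> `|w| < r3 -> exists u,
    [/\ psi z = (psi w * psi u)%g, `|u| <= 2 * `|z - w|, `|u| < rho & law w u = z].
  move=> z3 w3.
  have [z2 ze] : `|z| < r2 /\ `|z| < e by apply/andP; rewrite -lt_min.
  have [w2 we] : `|w| < r2 /\ `|w| < e by apply/andP; rewrite -lt_min.
  have [xc xe] := h2 z w z2 w2.
  set x := ((psi w)^-1 * psi z)%g in xc xe.
  have E : psi z = (psi w * psi (phi x))%g by rewrite (phiK ac xc) /x mulgA mulgV mul1g.
  have zd := rd _ (erho _ ze).
  have lE : law w (phi x) = z.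
    rewrite /law -E -[LHS]/(coords (psi z)) cE; first exact: (psiK ac zd).
      exact: (psi_in ac zd).
    by rewrite (psiK ac zd); exact: erho.
  exists (phi x); split => //; last exact: erho.
  have [_ + _] := est w (phi x) (erho _ we) (erho _ xe); rewrite lE => h.
  have : `|phi x| <= `|z - w| + `|phi x| / 2.
    rewrite -[X in `|X| <= _](subKr (z - w)) (le_trans (ler_normB _ _))// lerD2l.
    rewrite (le_trans h)// mulrA mulrC ler_wpM2l//.
    by apply: eC.
  by move=> h'; lra.
(* The bound 1 gives ab <= a for a = |z| and b = |w|; the second bound keeps a + b + Cab below [r3],
   so both products can be divided. In the constant, 2C comes from the two third-order remainders,
   and 4C^2(1+C) from C|q||u| with |q| <= (1+C)(a+b) and |u| <= 4Cab. *)
exists (Num.min (Num.min 1 (r3 / (3 * (C + 1)))) r3), (4 * C ^+ 2 * (1 + C) + 2 * C).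
have mle : Num.min (Num.min 1 (r3 / (3 * (C + 1)))) r3 <= r3 by rewrite ge_min lexx orbT.
have r3rho : r3 <= rho by rewrite /r3 /e !ge_min lexx !orbT.
split.
- by rewrite lt_min lt_min ltr01 r30 divr_gt0 ?mulr_gt0.
- by rewrite (le_trans mle)// (le_trans r3rho).
- by rewrite addr_ge0 ?mulr_ge0 ?exprn_ge0// addr_ge0.
move=> z w zr wr.
have z3 := lt_le_trans zr mle; have w3 := lt_le_trans wr mle.
have zrho := lt_le_trans z3 r3rho; have wrho := lt_le_trans w3 r3rho.
have [pE p1 p2] := est z w zrho wrho.
have [qE q1 q2] := est w z wrho zrho.
move: zr; rewrite lt_min lt_min => /andP[/andP[z1 zC] _].
move: wr; rewrite lt_min lt_min => /andP[/andP[w1 wC] _].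
set a := `|z| in z1 zC p1 p2 q1 q2 *; set b := `|w| in w1 wC p1 p2 q1 q2 *.
have a0 : 0 <= a := normr_ge0 z. have b0 : 0 <= b := normr_ge0 w.
have K0 : 0 <= 4 * C ^+ 2 * (1 + C) by rewrite !mulr_ge0 ?exprn_ge0// addr_ge0.
have ab0 : 0 <= a * b by rewrite mulr_ge0.
split.
- exists (law z w); split => //; apply: (le_trans p1); rewrite ler_wpM2r//; lra.
- by have [u [uE ul _ _]] := div z w z3 w3; exists u.
set p := law z w in pE p1 p2; set q := law w z in qE q1 q2.
have abC : a + b + C * (a * b) < r3.
  rewrite ltr_pdivlMr in zC; last by rewrite mulr_gt0.
  rewrite ltr_pdivlMr in wC; last by rewrite mulr_gt0.
  have : C * (a * b) <= C * a by rewrite ler_wpM2l// ler_piMr// ltW.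
  have : 0 <= C * a by rewrite mulr_ge0. have : 0 <= C * b by rewrite mulr_ge0.
  nra.
have pl : `|p| <= a + b + C * (a * b).
  rewrite (_ : p = (z + w) + (p - z - w)); last by rewrite addrC -[p - z - w]addrA -opprD subrK.
  by rewrite (le_trans (ler_normD _ _))// lerD// ler_normD.
have ql : `|q| <= a + b + C * (a * b).
  rewrite (_ : q = (z + w) + (q - w - z)); last by rewrite addrC -[q - w - z]addrA -opprD (addrC w) subrK.
  by rewrite (le_trans (ler_normD _ _))// ?(mulrC a) lerD// ler_normD.
have [u [uE ul urho lqu]] := div p q (le_lt_trans pl abC) (le_lt_trans ql abC).
exists u; split; first by rewrite -pE uE qE.
have pq : `|p - q| <= 2 * C * (a * b).
  rewrite (_ : p - q = (p - z - w) - (q - w - z)); last first.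
    by rewrite -[p - z - w]addrA -[q - w - z]addrA -!opprD (addrC w z) opprB addrA subrK.
  rewrite (le_trans (ler_normB _ _))//; move: p1 q1; rewrite (mulrC b) => *; lra.
have [_ + _] := est q u (lt_le_trans (le_lt_trans ql abC) r3rho) urho; rewrite lqu => h.
rewrite (_ : u - _ = ((p - z - w - bil z w) - (q - w - z - bil w z)) - (p - q - u)); last first.
  by apply/rowP => k; rewrite !mxE; ring.
rewrite (le_trans (ler_normB _ _))//.
have h1 := le_trans (ler_normB (p - z - w - bil z w) (q - w - z - bil w z)) (lerD p2 q2).
have ul' : `|u| <= 4 * C * (a * b) by lra.
have h3 : `|p - q - u| <= 4 * C ^+ 2 * (1 + C) * (a * b * (a + b)).
  apply: (le_trans h).
  apply: (@le_trans _ _ (C * ((a + b + C * (a * b)) * (4 * C * (a * b))))).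
    by rewrite ler_wpM2l// ler_pM.
  have : C * (a * b) <= C * (a + b).
    rewrite ler_wpM2l//; apply: (@le_trans _ _ a); last by rewrite lerDl.
    by rewrite ler_piMr// ltW.
  move=> h4.
  rewrite (_ : 4 * C ^+ 2 * (1 + C) * (a * b * (a + b)) = C * (((a + b) + C * (a + b)) * (4 * C * (a * b)))); last by ring.
  by rewrite ler_wpM2l// ler_wpM2r ?mulr_ge0// lerD2l.
rewrite (mulrC b) (addrC b) in h1.
lra.
Qed.

End local_group_law.

(** * Directions reached by products of flows *)

Section approximation.
Variables (R : realType) (n : nat) (G : groupType).
Notation V := 'rV[R]_n.
Variables (psi : V -> G) (rho C0 : R) (bk : V -> V -> V) (N : G -> R -> Prop).
Hypotheses (rho0 : 0 < rho) (C00 : 0 <= C0).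
Hypothesis local_mul : forall z w, `|z| < rho -> `|w| < rho ->
  exists q, psi q = (psi z * psi w)%g /\ `|q - z - w| <= C0 * (`|z| * `|w|).
Hypothesis local_div : forall z w, `|z| < rho -> `|w| < rho ->
  exists u, psi z = (psi w * psi u)%g /\ `|u| <= 2 * `|z - w|.
Hypothesis local_comm : forall z w, `|z| < rho -> `|w| < rho ->
  exists u, (psi z * psi w = psi w * psi z * psi u)%g /\
    `|u - bk z w| <= C0 * (`|z| * `|w| * (`|z| + `|w|)).
Hypothesis bkBl : forall u v w, bk (u - v) w = bk u w - bk v w.
Hypothesis bkBr : forall u v w, bk w (u - v) = bk w u - bk w v.
Hypothesis bk_bound : forall u v, `|bk u v| <= C0 * (`|u| * `|v|).
Hypothesis psi0 : psi 0 = 1%g.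
Hypothesis N1 : N 1%g 0.
Hypothesis NM : forall g h a b, N g a -> N h b -> N (g * h)%g (a + b).
Hypothesis NV : forall g a, N g a -> N g^-1%g a.
Hypothesis Nle : forall g a b, a <= b -> N g a -> N g b.

(* [S s] is a set of displacements of size [s^a], each realised up to a relative
   error [O(s)] by a point of cost [O(s)]. *)
Definition approx a (S : R -> set V) := exists M d, [/\ 0 <= M, 0 < d, d <= 1 &
  forall s v, 0 < s -> s < d -> S s v ->
    `|v| <= M * s ^+ a /\
    exists z, [/\ `|z - v| <= M * s ^+ a.+1, N (psi z) (M * s), `|z| <= M * s ^+ a & `|z| < rho]].

Lemma pow_le (s : R) i j : 0 < s -> s <= 1 -> (i <= j)%N -> s ^+ j <= s ^+ i.
Proof. by move=> s0 s1 ij; apply: ler_wiXn2l => //; rewrite ltW. Qed.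

(** The bounds on [z] itself follow from those on [v] and [z - v] once [s] is small. They are built
    into [approx] for later use and recovered here by enlarging [M] and shrinking [d]. *)
Lemma approx_intro a S : (0 < a)%N ->
  (exists M d, [/\ 0 <= M, 0 < d & forall s v, 0 < s -> s < d -> s < 1 -> S s v ->
     `|v| <= M * s ^+ a /\
     exists z, `|z - v| <= M * s ^+ a.+1 /\ N (psi z) (M * s)]) -> approx a S.
Proof.
move=> a0 [M [d [M0 d0 h]]].
have MK0 : 0 <= M + M by rewrite addr_ge0.
have MK1 : 0 < M + M + 1 by rewrite ltr_wpDl.
exists (M + M), (Num.min (Num.min d 1) (rho / (M + M + 1))); split => //.
- by rewrite lt_min lt_min d0 ltr01 divr_gt0.
- by rewrite !ge_min lexx orbT.
move=> s v s0; rewrite lt_min lt_min => /andP[/andP[sd s1] srho] Sv.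
have [vl [z [zv Nz]]] := h s v s0 sd s1 Sv.
have sa0 k : 0 <= s ^+ k by rewrite exprn_ge0 ?ltW.
have zl : `|z| <= (M + M) * s ^+ a.
  rewrite -(subrK v z) (le_trans (ler_normD _ _))// addrC mulrDl lerD//.
  by rewrite (le_trans zv)// ler_wpM2l// pow_le// ltW.
split.
  by rewrite (le_trans vl)// ler_wpM2r// lerDl.
exists z; split => //.
- by rewrite (le_trans zv)// ler_wpM2r// lerDr.
- by apply: Nle Nz; rewrite ler_wpM2r ?(ltW s0)// lerDr.
- rewrite (le_lt_trans zl)//.
  apply: (@le_lt_trans _ _ ((M + M + 1) * s)); last by rewrite mulrC -ltr_pdivlMr.
  rewrite ler_pM// ?lerDl//.
  by have := pow_le s0 (ltW s1) a0; rewrite expr1.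
Qed.

Lemma approx_sub a (S T : R -> set V) :
  (forall s v, 0 < s -> s < 1 -> T s v -> S s v) -> approx a S -> approx a T.
Proof.
move=> TS [M [d [M0 d0 d1 h]]]; exists M, d; split => // s v s0 sd Tv.
by apply: h => //; apply: TS => //; exact: lt_le_trans d1.
Qed.

(** The product of the realising points errs by at most a multiple of |z||y|, of order s^(2a), hence
    of order s^(a+1) since a is positive. *)
Lemma approx_add a S T : (0 < a)%N -> approx a S -> approx a T ->
  approx a (fun s x => exists v w, [/\ S s v, T s w & x = v + w]).
Proof.
move=> a0 [M [d [M0 d0 d1 hS]]] [M' [d' [M'0 d'0 d'1 hT]]].
apply: approx_intro => //.
have CM : 0 <= C0 * (M * M') by rewrite !mulr_ge0.
exists (M + M' + C0 * (M * M')), (Num.min d d'); split.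
- by rewrite !addr_ge0.
- by rewrite lt_min d0.
move=> s _ s0 + s1 [v [w [Sv Tw ->]]]; rewrite lt_min => /andP[sd sd'].
have sa0 k : 0 <= s ^+ k by rewrite exprn_ge0 ?ltW.
have [vl [z [zv Nz zl zr]]] := hS _ _ s0 sd Sv.
have [wl [y [yw Ny yl yr]]] := hT _ _ s0 sd' Tw.
split.
  rewrite (le_trans (ler_normD _ _))// (le_trans (lerD vl wl))// -mulrDl.
  by rewrite ler_wpM2r// lerDl.
have [q [qE ql]] := local_mul zr yr.
exists q; rewrite qE; split.
  rewrite (_ : q - (v + w) = ((z - v) + (y - w)) + (q - z - y)); last by apply/rowP => i; rewrite !mxE; ring.
  rewrite (le_trans (ler_normD _ _))// mulrDl lerD//.
    by rewrite mulrDl (le_trans (ler_normD _ _))// lerD.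
  rewrite (le_trans ql)// -mulrA ler_wpM2l//.
  rewrite (@le_trans _ _ (M * s ^+ a * (M' * s ^+ a)))//.
    by rewrite ler_pM.
  rewrite mulrACA -exprD ler_wpM2l ?mulr_ge0// pow_le// ?(ltW s1)//.
  by rewrite -addn1 leq_add2l.
apply: Nle (NM Nz Ny); rewrite -mulrDl ler_wpM2r ?(ltW s0)//.
by rewrite lerDl.
Qed.

(** Replacing [s] by [s ^+ k.+1] only lowers the cost, as s < 1. This is how different orders are
    brought to a common multiple. *)
Lemma approx_up a k S : (0 < a)%N -> approx a S -> approx (a * k.+1) (fun s => S (s ^+ k.+1)).
Proof.
move=> a0 [M [d [M0 d0 d1 h]]]; apply: approx_intro; first by rewrite muln_gt0 a0.
exists M, d; split => // s v s0 sd s1 Sv.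
have sk : s ^+ k.+1 <= s by have := pow_le s0 (ltW s1) (ltn0Sn k); rewrite expr1.
have [|vl [z [zv Nz _ _]]] := h (s ^+ k.+1) v (exprn_gt0 _ s0) _ Sv.
  exact: le_lt_trans sd.
split; first by rewrite mulnC exprM.
exists z; split; last by apply: Nle Nz; rewrite ler_wpM2l.
rewrite (le_trans zv)// ler_wpM2l// -exprM pow_le// ?(ltW s1)//.
by rewrite (mulnS k.+1 a) (mulnC a) -add1n leq_add2r.
Qed.

(** The group commutator of the realising points [z], [y] has leading term [bk z y]. Replacing [z],
    [y] by the ideal displacements [v], [w] costs one more power of [s], as does the remainder of
    the commutator formula. *)
Lemma approx_comm a b S T : (0 < a)%N -> (0 < b)%N -> approx a S -> approx b T ->
  approx (a + b) (fun s x => exists v w, [/\ S s v, T s w & x = bk v w]).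
Proof.
move=> a0 b0 [M [d [M0 d0 d1 hS]]] [M' [d' [M'0 d'0 d'1 hT]]].
apply: approx_intro; first by rewrite addn_gt0 a0.
have CM : 0 <= C0 * (M * M') by rewrite !mulr_ge0.
(* M + M' comes from the commutator remainder, 2 from the replacements of [z] by [v] and of [y] by
   [w]; the last summand is the cost, since each of the two points occurs twice in the
   commutator. *)
pose L := C0 * (M * M') * (M + M' + 2) + 2 * (M + M').
have L1 : C0 * (M * M') <= L.
  by rewrite /L -[leLHS]mulr1 ler_wpDr ?mulr_ge0 ?addr_ge0// ler_wpM2l//; lra.
exists L, (Num.min d d'); split.
- exact: le_trans L1.
- by rewrite lt_min d0.
move=> s _ s0 + s1 [v [w [Sv Tw ->]]]; rewrite lt_min => /andP[sd sd'].
have sa0 k : 0 <= s ^+ k by rewrite exprn_ge0 ?ltW.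
have [vl [z [zv Nz zl zr]]] := hS _ _ s0 sd Sv.
have [wl [y [yw Ny yl yr]]] := hT _ _ s0 sd' Tw.
have prod (t u : R) k l : 0 <= t -> 0 <= u -> t <= M * s ^+ k -> u <= M' * s ^+ l ->
    C0 * (t * u) <= C0 * (M * M') * s ^+ (k + l).
  move=> t0 u0 tl ul; rewrite -mulrA ler_wpM2l// exprD -mulrACA.
  by rewrite ler_pM.
split.
  rewrite (le_trans (bk_bound _ _))// (le_trans (prod _ _ _ _ _ _ vl wl))//.
  by rewrite ler_wpM2r.
have [u [uE ul]] := local_comm zr yr.
exists u; split; last first.
  have -> : psi u = ((psi y * psi z)^-1 * (psi z * psi y))%g by rewrite uE mulgA mulVg mul1g.
  apply: Nle (NM (NV (NM Ny Nz)) (NM Nz Ny)).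
  rewrite -!mulrDl ler_wpM2r ?(ltW s0)// /L.
  by have := mulr_ge0 CM (addr_ge0 (addr_ge0 M0 M'0) (ler0n R 2)); lra.
rewrite (_ : u - bk v w = (u - bk z y) + (bk (z - v) y + bk v (y - w))); last first.
  by rewrite bkBl bkBr; apply/rowP => i; rewrite !mxE; ring.
have e1 : `|bk (z - v) y| <= C0 * (M * M') * s ^+ (a + b).+1.
  by rewrite (le_trans (bk_bound _ _))// -addSn; apply: prod.
have e2 : `|bk v (y - w)| <= C0 * (M * M') * s ^+ (a + b).+1.
  by rewrite (le_trans (bk_bound _ _))// -addnS; apply: prod.
have e3 : `|u - bk z y| <= C0 * (M * M') * (M + M') * s ^+ (a + b).+1.
  rewrite (le_trans ul)// mulrA (exprS s (a + b)) [s * _]mulrC.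
  rewrite (_ : _ * (s ^+ (a + b) * s) = (C0 * (M * M') * s ^+ (a + b)) * ((M + M') * s)); last by ring.
  rewrite ler_pM ?mulr_ge0 ?addr_ge0//; first exact: prod.
  rewrite mulrDl lerD//.
    by rewrite (le_trans zl)// ler_wpM2l//; have := pow_le s0 (ltW s1) a0; rewrite expr1.
  by rewrite (le_trans yl)// ler_wpM2l//; have := pow_le s0 (ltW s1) b0; rewrite expr1.
rewrite (le_trans (ler_normD _ _))// (le_trans (lerD e3 (le_trans (ler_normD _ _) (lerD e1 e2))))//.
rewrite -!mulrDl ler_wpM2r// /L.
have := addr_ge0 M0 M'0; nra.
Qed.

(* Size [s^a] along [v] for cost [s], as for a commutator of length [a]. *)
Definition reach a v := (0 < a)%N /\ forall K : R, approx a (fun s x => exists2 c, `|c| <= K & x = (c * s ^+ a) *: v).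

Lemma reach_up a k v : reach a v -> reach (a * k.+1) v.
Proof.
move=> [a0 h]; split; first by rewrite muln_gt0 a0.
move=> K; apply: approx_sub (approx_up k a0 (h K)) => s x s0 s1 [c cK ->].
by exists c => //; rewrite -exprM mulnC.
Qed.

Lemma reach0 : reach 1 0.
Proof.
split=> // K; apply: approx_intro => //; exists 0, 1; split => // s v s0 _ s1 [c _ ->].
rewrite scaler0 normr0 !mul0r; split => //; exists 0.
by rewrite psi0 subrr normr0.
Qed.

Lemma reach_scale a t v : reach a v -> reach a (t *: v).
Proof.
move=> [a0 h]; split=> // K.
apply: approx_sub (h (K * `|t|)) => s x s0 s1 [c cK ->].
by exists (c * t); [rewrite normrM ler_wpM2r|rewrite scalerA mulrAC].
Qed.

Lemma reach_add a v w : reach a v -> reach a w -> reach a (v + w).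
Proof.
move=> [a0 hv] [_ hw]; split=> // K.
apply: approx_sub (approx_add a0 (hv K) (hw K)) => s x s0 s1 [c cK ->].
by rewrite scalerDr; exists ((c * s ^+ a) *: v), ((c * s ^+ a) *: w); split; [exists c|exists c|].
Qed.

Hypothesis bkZ : forall a b u v, bk (a *: u) (b *: v) = (a * b) *: bk u v.

(** The whole coefficient, with its sign, is put on the first factor and the second gets coefficient
    1. Thus neither roots of the coefficient nor a separate treatment of its sign is required. *)
Lemma reach_comm a b v w : reach a v -> reach b w -> reach (a + b) (bk v w).
Proof.
move=> [a0 hv] [b0 hw]; split=> [|K]; first by rewrite addn_gt0 a0.
apply: approx_sub (approx_comm a0 b0 (hv K) (hw 1)) => s x s0 s1 [c cK ->].
exists ((c * s ^+ a) *: v), ((1 * s ^+ b) *: w); split; [by exists c|by exists 1; rewrite ?normr1|].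
by rewrite bkZ mul1r exprD mulrA.
Qed.

(** The product of the orders is a common multiple of them, so all basis vectors are reached at one
    order m. A vector of norm at most s^m then splits into coordinate pieces with coefficients at
    most 1 times s^m. *)
Lemma reach_basis : (forall j, exists a, reach a (e_ R j)) ->
  exists a, (0 < a)%N /\ approx a (fun s x => `|x| <= s ^+ a).
Proof.
move=> /choice[a ha].
have {ha} [m [m0 hm]] : exists m, (0 < m)%N /\ forall j, reach m (e_ R j).
  exists (\prod_j a j)%N; split.
    by rewrite prodn_gt0// => j; case: (ha j).
  move=> j; rewrite (bigD1 j)//=.
  have : (0 < \prod_(i < n | i != j) a i)%N.
    by rewrite prodn_cond_gt0// => i _; case: (ha i).
  by case: (\prod_(i < n | i != j) a i)%N => // k _; exact: reach_up.
exists m; split => //.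
have key (r : seq 'I_n) : uniq r ->
    approx m (fun s x => exists2 y : V, `|y| <= s ^+ m & x = \sum_(j <- r) y 0 j *: e_ R j).
  elim: r => [_|j r IH /= /andP[jr ur]].
    apply: approx_intro => //; exists 0, 1; split => // s v s0 _ s1 [y _ ->].
    by rewrite big_nil normr0 !mul0r; split => //; exists 0; rewrite psi0 subrr normr0.
  have [_ hj] := hm j.
  apply: approx_sub (approx_add m0 (hj 1) (IH ur)) => s x s0 s1 [y ys ->].
  exists (y 0 j *: e_ R j), (\sum_(j <- r) y 0 j *: e_ R j).
  split; [|by exists y|by rewrite big_cons].
  have sm : 0 < s ^+ m by rewrite exprn_gt0.
  exists (y 0 j / s ^+ m); last by rewrite divfK// gt_eqF.
  rewrite normrM normfV (gtr0_norm sm) ler_pdivrMr// mul1r.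
  exact: le_trans (coord_le_norm _ _) ys.
apply: approx_sub (key (index_enum 'I_n) (index_enum_uniq _)) => s x s0 s1 xs.
by exists x => //; rewrite {1}(row_sum_delta x).
Qed.

(* Successive approximation [g = h_0 h_1 ... h_j r_j] with [h_i] of cost
   [O(2^-i s)] and [r_j -> 1]: the costs sum up, so no implicit function theorem
   is needed to reach a whole neighbourhood of [1]. *)
Lemma approx_exhaust a : (0 < a)%N -> approx a (fun s x => `|x| <= s ^+ a) ->
  exists r K, [/\ 0 < r, 0 <= K & forall z, `|z| <= r -> forall e, 0 < e -> exists p y,
    [/\ psi z = (p * psi y)%g, N p K & `|y| <= e]].
Proof.
move=> a0 [M [d [M0 d0 d1 h]]].
have t0 : 0 < 2^-1 ^+ a :> R by rewrite exprn_gt0.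
have M10 : 0 < 2 * M + 1 by rewrite ltr_wpDl ?mulr_ge0.
(* The last bound gives [2 * M * s <= 2^-1 ^+ a]: after one step at scale t_j the remainder, at most
   2M t_j^(a+1), is at most t_(j+1)^a, and the iteration continues at half the scale. *)
pose s := Num.min (d / 2) (Num.min (rho / 2) (2^-1 ^+ a / (2 * M + 1))).
have s0 : 0 < s by rewrite lt_min lt_min !divr_gt0.
have sd : s < d.
  by rewrite (@le_lt_trans _ _ (d / 2)) ?ge_min ?lexx// ltr_pdivrMr// mulr_natr mulr2n ltrDl.
have srho : s < rho.
  rewrite (@le_lt_trans _ _ (rho / 2))//; first by rewrite /s !ge_min lexx !orbT.
  by rewrite ltr_pdivrMr// mulr_natr mulr2n ltrDl.
have sM : 2 * M * s <= 2^-1 ^+ a.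
  have : s <= 2^-1 ^+ a / (2 * M + 1) by rewrite /s !ge_min lexx !orbT.
  rewrite ler_pdivlMr// mulrDr mulr1 mulrC => h1.
  by rewrite (le_trans _ h1)// mulrC lerDl ltW.
pose t j := s * 2^-1 ^+ j.
have tj0 j : 0 < t j by rewrite mulr_gt0// exprn_gt0.
have ts j : t j <= s by rewrite ler_piMr ?(ltW s0)// exprn_ile1//; lra.
have step j z : `|z| <= t j ^+ a -> exists p y,
    [/\ psi z = (p * psi y)%g, N p (M * t j) & `|y| <= t j.+1 ^+ a].
  move=> zt; have [_ [x [xz Nx _ xr]]] := h (t j) z (tj0 j) (le_lt_trans (ts j) sd) zt.
  have zr : `|z| < rho.
    rewrite (le_lt_trans zt)// (le_lt_trans _ srho)// (le_trans _ (ts j))//.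
    have t1 : t j <= 1 by rewrite (le_trans (ts j))// (le_trans (ltW sd)).
    by have := pow_le (tj0 j) t1 a0; rewrite expr1.
  have [u [uE ul]] := local_div zr xr.
  exists (psi x), u; split => //.
  rewrite (le_trans ul)// distrC (@le_trans _ _ (2 * (M * t j ^+ a.+1)))//.
    by rewrite ler_pM2l.
  have -> : t j.+1 ^+ a = t j ^+ a * 2^-1 ^+ a by rewrite -exprMn /t exprSr mulrA.
  rewrite (_ : 2 * (M * t j ^+ a.+1) = t j ^+ a * (2 * M * t j)); last by rewrite exprS; ring.
  rewrite ler_wpM2l ?exprn_ge0 ?(ltW (tj0 j))// (le_trans _ sM)// ler_wpM2l//.
  by rewrite mulr_ge0.
exists (s ^+ a), (2 * M * s); split; [by rewrite exprn_gt0|by rewrite !mulr_ge0 ?(ltW s0)|].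
move=> z zs.
(* The cost is the partial geometric sum of the M t_i for i < j. *)
have ind j : exists p y, [/\ psi z = (p * psi y)%g, N p (2 * M * s * (1 - 2^-1 ^+ j)) & `|y| <= t j ^+ a].
  elim: j => [|j [p [y [E Np yt]]]].
    exists 1%g, z; rewrite mul1g expr0 subrr mulr0; split => //.
    by rewrite /t expr0 mulr1.
  have [q [x [E' Nq xt]]] := step j y yt.
  exists (p * q)%g, x; split => //; first by rewrite E E' mulgA.
  apply: Nle (NM Np Nq); rewrite /t exprSr; lra.
move=> e e0.
have [j je] : exists j, s * 2^-1 ^+ j <= e.
  have : (fun j => s * 2^-1 ^+ j) @ \oo --> (s * 0 : R).
    by apply: cvgM; [exact: cvg_cst|apply: cvg_expr; rewrite ger0_norm; lra].
  rewrite mulr0 => /cvgr0_norm_le /(_ _ e0) [j _ /(_ j (leqnn j)) /= hj].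
  by exists j; rewrite (le_trans (ler_norm _)).
have [p [y [E Np yt]]] := ind j.
exists p, y; split => //.
  apply: Nle Np; rewrite ler_piMr ?mulr_ge0 ?(ltW s0)// lerBlDr lerDl exprn_ge0//.
rewrite (le_trans yt)// (le_trans _ je)//.
have t1 : t j <= 1 by rewrite (le_trans (ts j))// (le_trans (ltW sd)).
by have := pow_le (tj0 j) t1 a0; rewrite expr1.
Qed.

End approximation.

(** * Haar measure and the mean deviation *)

Section haar.
Variables (R : realType) (n : nat) (G : lieGroupType R n).
Variable mu : probability (borel G) R.
Hypothesis hmu : normalized_haar mu.
Notation B := (borel G).

Lemma open_borel (A : set G) : open A -> measurable (A : set B).
Proof. by move=> oA; apply: sub_sigma_algebra. Qed.

Lemma continuous_measurable_R (f : G -> R) : continuous f -> measurable_fun [set: B] (f : B -> R).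
Proof.
move=> /continuousP cf; apply: (measurability _ (RGenOInfty.measurableE R)).
move=> _ [_ [x ->] <-]; rewrite setTI; apply: open_borel; apply: cf.
exact: interval_open.
Qed.

Lemma continuous_measurable_map (h : G -> G) : continuous h -> measurable_fun [set: B] (h : B -> B).
Proof.
move=> /continuousP ch; apply: (@measurability _ _ B B setT h (@open G)) => //.
by move=> _ [A oA <-]; rewrite setTI; apply: open_borel; exact: ch.
Qed.

(** By second countability an open set of the product is a countable union of open rectangles.
    Functions such as u(xg) are thus measurable for the product of the Borel sigma-algebras, as
    Tonelli's theorem requires. *)
Lemma open_prod_measurable (O : set (G * G)) : open O -> measurable (O : set (B * B)).
Proof.
move=> oO; have [B0 cB0 [B0o B0b]] := @lie_second_countable R n G.
pose D := [set UV : set G * set G | [/\ B0 UV.1, B0 UV.2 & UV.1 `*` UV.2 `<=` O]].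
have cD : countable D.
  apply: (@sub_countable _ _ _ (B0 `*` B0)); last exact: countableX.
  by apply: subset_card_le => -[U V] [].
have -> : O = \bigcup_(UV : D) ((sval UV).1 `*` (sval UV).2).
  apply/seteqP; split => [[x y] Oxy|[x y] [[[U V] /= UVD] _ /=]]; last first.
    by move=> [Ux Vy]; have [_ _] := set_mem UVD; apply.
  have /= [[P Q] /= [nP nQ] PQ] : nbhs (x, y) O by exact: open_nbhs_nbhs.
  have [U [BU Ux] UP] := B0b x _ nP; have [V [BV Vy] VQ] := B0b y _ nQ.
  have UVD : (U, V) \in D.
    apply/mem_set; split => // -[a b] [/= Ua Vb]; apply: PQ; split; [exact: UP|exact: VQ].
  by exists (exist _ (U, V) UVD).
apply: countable_bigcupT_measurable.
  by rewrite (eq_countable (card_setT _)).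
move=> [[U V] /= UVD]; have [BU BV _] := set_mem UVD.
by apply: measurableX; apply: open_borel; apply: B0o.
Qed.

Lemma continuous_measurable_prod (h : G * G -> G) : continuous h -> measurable_fun [set: B * B] (h : B * B -> B).
Proof.
move=> /continuousP ch; apply: (@measurability _ _ (B * B)%type B setT h (@open G)) => //.
by move=> _ [A oA <-]; rewrite setTI; apply: open_prod_measurable; exact: ch.
Qed.

Lemma left_mul_continuous (g : G) : continuous (fun x : G => (g * x)%g).
Proof. by move=> x; apply: mulg_cont; [exact: cst_continuous|exact: cvg_id]. Qed.

Lemma right_mul_continuous (g : G) : continuous (fun x : G => (x * g)%g).
Proof. by move=> x; apply: mulg_cont; [exact: cvg_id|exact: cst_continuous]. Qed.

Lemma invariant_integral (h : G -> G) (F : B -> \bar R) :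
  measurable_fun [set: B] (h : B -> B) ->
  (forall A : set B, measurable A -> mu (h @^-1` A) = mu A) ->
  measurable_fun setT F -> (forall x, (0 <= F x)%E) ->
  (\int[mu]_x F (h x) = \int[mu]_x F x)%E.
Proof.
move=> mh ih mF F0.
have := @ge0_integral_pushforward _ _ _ _ R (h : B -> B) mh mu setT F measurableT mF (fun y _ => F0 y).
rewrite preimage_setT => E.
transitivity (\int[pushforward mu (h : B -> B)]_(y in setT) F y)%E; first by rewrite E.
by apply: eq_measure_integral => A mA _; exact: ih.
Qed.

Lemma left_invariant_preimage (g : G) (A : set B) : measurable A -> mu ((fun x => (g * x)%g) @^-1` A) = mu A.
Proof.
move=> mA; rewrite -[RHS](hmu g^-1%g mA); congr (mu _); apply/seteqP; split => x /=.
  by move=> h; exists (g * x)%g => //; rewrite mulgA mulVg mul1g.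
by move=> [y Ay <-]; rewrite mulgA mulgV mul1g.
Qed.

Lemma left_invariant_integral (g : G) (F : B -> \bar R) :
  measurable_fun setT F -> (forall x, (0 <= F x)%E) ->
  (\int[mu]_x F (g * x)%g = \int[mu]_x F x)%E.
Proof.
move=> mF F0; apply: (@invariant_integral (fun x => g * x)%g) => //.
  apply: continuous_measurable_map. exact: left_mul_continuous.
by move=> A; exact: left_invariant_preimage.
Qed.

Lemma invg_measurable : measurable_fun [set: B] ((fun x => x^-1%g) : B -> B).
Proof. by apply: continuous_measurable_map; exact: invg_continuous. Qed.

(* Unimodularity of compact groups: integrate [1_A(x^-1 y)] in both orders. *)
Lemma inverse_invariant_preimage (A : set B) : measurable A -> mu ((fun x : G => x^-1%g) @^-1` A) = mu A.
Proof.
move=> mA.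
have mA' : measurable (((fun x => x^-1%g) : B -> B) @^-1` A).
  by rewrite -[X in measurable X]setTI; exact: invg_measurable.
pose h (p : G * G) : G := (p.1^-1 * p.2)%g.
have mh : measurable_fun [set: B * B] (h : B * B -> B).
  apply: continuous_measurable_prod => p; apply: (@mulg_cont R n G (G * G)%type (fun p => p.1^-1%g) snd); last exact: cvg_snd.
  apply: (@continuous_comp _ _ _ fst (fun x : G => x^-1%g)); first exact: cvg_fst.
  exact: invg_continuous.
pose f (p : B * B) : \bar R := (\1_A (h p))%:E.
have mf : measurable_fun setT f.
  by apply/measurable_EFinP; apply: measurableT_comp mh; exact: measurable_indic.
have cstI (a : \bar R) : (\int[mu]_x a = a)%E.
  rewrite integral_cst//. rewrite -[RHS]mule1. congr (_ * _)%E. exact: (probability_setT mu).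
have FT : (\int[mu]_x \int[mu]_y (\1_A (x^-1 * y)%g)%:E =
    \int[mu]_y \int[mu]_x (\1_A (x^-1 * y)%g)%:E)%E.
  by apply: (@fubini_tonelli _ _ _ _ R mu mu f mf) => q; rewrite lee_fin.
have m1 : measurable_fun [set: B] (fun x => (\1_A x)%:E : \bar R).
  by apply/measurable_EFinP; exact: measurable_indic.
have m2 : measurable_fun [set: B] (fun x : B => (\1_A (x^-1)%g)%:E : \bar R).
  by apply/measurable_EFinP; apply: measurableT_comp invg_measurable; exact: measurable_indic.
have E1 (x : G) : (\int[mu]_y (\1_A (x^-1 * y)%g)%:E = mu A)%E.
  by rewrite (@left_invariant_integral x^-1%g _ m1)// integral_indic// setIT.
have E2 (y : G) : (\int[mu]_x (\1_A (x^-1 * y)%g)%:E = mu ((fun x : G => x^-1%g) @^-1` A))%E.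
  transitivity (\int[mu]_x (\1_A ((y^-1 * x)^-1)%g)%:E)%E.
    by apply: eq_integral => x _; rewrite invgM invgK.
  rewrite (@left_invariant_integral y^-1%g _ m2)//.
  transitivity (\int[mu]_x (\1_(((fun x => x^-1%g) : B -> B) @^-1` A) x)%:E)%E.
    by apply: eq_integral => x _; rewrite !indicE.
  by rewrite integral_indic// setIT.
rewrite -[LHS]cstI -[RHS]cstI.
transitivity (\int[mu]_y \int[mu]_x (\1_A (x^-1 * y)%g)%:E)%E.
  by apply: eq_integral => y _; rewrite E2.
by rewrite -FT; apply: eq_integral => x _; rewrite E1.
Qed.

(** Right translation is left translation conjugated by inversion, and both preserve [mu]. *)
Lemma right_invariant_integral (g : G) (F : B -> \bar R) :
  measurable_fun setT F -> (forall x, (0 <= F x)%E) ->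
  (\int[mu]_x F (x * g)%g = \int[mu]_x F x)%E.
Proof.
move=> mF F0.
have mFi : measurable_fun setT (fun x : B => F (x^-1)%g) by apply: measurableT_comp invg_measurable.
have mFg : measurable_fun setT (fun x : B => F (g^-1 * x)^-1%g).
  have := measurableT_comp mFi (continuous_measurable_map (@left_mul_continuous g^-1%g)).
  exact.
have inv (H : B -> \bar R) : measurable_fun setT H -> (forall x, 0 <= H x)%E ->
    (\int[mu]_x H (x^-1)%g = \int[mu]_x H x)%E.
  move=> mH H0; apply: (@invariant_integral (fun x => x^-1)%g) => //; first exact: invg_measurable.
  by move=> A; exact: inverse_invariant_preimage.
transitivity (\int[mu]_x F (g^-1 * x^-1)^-1%g)%E.
  by apply: eq_integral => x _; rewrite invgM !invgK.
rewrite (inv _ mFg)// (@left_invariant_integral g^-1%g _ mFi)//.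
exact: inv.
Qed.

End haar.

(** * L^p norms on a probability space *)

Section Lp_norm.
Context d (T : measurableType d) (R : realType) (mu : probability T R) (p : R).
Hypothesis hp : 1 < p.
Implicit Types u v : T -> R.

Let p0 : 0 < p. Proof. exact: lt_trans hp. Qed.
Let pn0 : p != 0. Proof. by rewrite gt_eqF. Qed.
Let p1 : 1 <= p. Proof. exact: ltW. Qed.

Definition LpN u : \bar R := Lnorm mu p%:E (EFin \o u).

Lemma LpN_pow u : (LpN u `^ p = \int[mu]_x (`|u x| `^ p)%:E)%E.
Proof. by rewrite powR_Lnorm. Qed.

Lemma pow_measurable u : measurable_fun setT u -> measurable_fun setT (fun x => (`|u x| `^ p)%:E).
Proof.
move=> mu'; apply/measurable_EFinP; apply: (measurableT_comp (measurable_powR _)).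
exact: measurableT_comp.
Qed.

Lemma le_LpN_pow (a b : \bar R) : (0 <= a)%E -> (0 <= b)%E -> (a `^ p <= b `^ p)%E -> (a <= b)%E.
Proof.
move=> a0 b0 ab.
have := @gt0_ler_poweR R p^-1 _ (a `^ p)%E (b `^ p)%E.
rewrite -!poweRrM mulfV// !poweRe1//; apply => //; first by rewrite invr_ge0 ltW.
- by rewrite in_itv /= poweR_ge0 leey.
- by rewrite in_itv /= poweR_ge0 leey.
Qed.

Lemma LpN_le u v : measurable_fun setT u -> measurable_fun setT v ->
  (forall x, `|u x| <= `|v x|) -> (LpN u <= LpN v)%E.
Proof.
move=> mu1 mv uv; apply: le_LpN_pow; try exact: Lnorm_ge0.
rewrite !LpN_pow; apply: ge0_le_integral => //.
- exact: pow_measurable.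
- exact: pow_measurable.
- by move=> x _; rewrite lee_fin ge0_ler_powR ?nnegrE// ltW.
Qed.

Lemma integral_cst1 (a : \bar R) : (\int[mu]_x a = a)%E.
Proof.
rewrite integral_cst// -[RHS]mule1; congr (_ * _)%E.
exact: (probability_setT mu).
Qed.

Lemma LpN_cst (a : R) : LpN (fun=> a) = `|a|%:E.
Proof.
have h : (LpN (fun=> a) `^ p = `|a|%:E `^ p)%E by rewrite LpN_pow integral_cst1.
by apply/le_anti/andP; split; apply: le_LpN_pow; rewrite ?h// ?Lnorm_ge0// lee_fin.
Qed.

Lemma LpN_triangle u v : measurable_fun setT u -> measurable_fun setT v ->
  (LpN (fun x => u x + v x)%R <= LpN u + LpN v)%E.
Proof. by move=> mu1 mv; apply: minkowski_EFin. Qed.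

(** Hölder's inequality against the constant 1, whose norm is 1 because the total mass is 1. *)
Lemma L1_le_LpN u : measurable_fun setT u -> (\int[mu]_x `|u x|%:E <= LpN u)%E.
Proof.
move=> mu1.
have q0 : 0 < (1 - p^-1)^-1 by rewrite invr_gt0 subr_gt0 invf_lt1.
have := @hoelder _ _ _ mu u (fun=> 1) p (1 - p^-1)^-1 mu1 (measurable_cst _) p0 q0.
rewrite invrK addrC subrK => /(_ erefl).
rewrite Lnorm_cst1 (_ : poweR _ _ = 1%E) ?mule1 ?Lnorm1; last first.
  exact: (etrans (congr1 (fun t => poweR t _) (probability_setT mu)) (poweR1r _)).
by under eq_integral do rewrite /= mulr1.
Qed.

Lemma LpN_Z (a : R) u : measurable_fun setT u -> LpN (fun x => a * u x)%R = (`|a|%:E * LpN u)%E.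
Proof.
move=> mu1.
have h : (LpN (fun x => a * u x)%R `^ p = (`|a|%:E * LpN u) `^ p)%E.
  rewrite poweRM ?lee_fin// ?Lnorm_ge0// !LpN_pow.
  under eq_integral do rewrite normrM powRM// EFinM.
  by rewrite ge0_integralZl ?lee_fin ?powR_ge0//; exact: pow_measurable.
have n0 : (0 <= `|a|%:E * LpN u)%E by rewrite mule_ge0 ?lee_fin// Lnorm_ge0.
by apply/le_anti/andP; split; apply: le_LpN_pow; rewrite ?h// ?Lnorm_ge0.
Qed.

End Lp_norm.

(** * Right translations and mean deviation on a compact group *)

Section compact_group_norm.
Variables (R : realType) (n : nat) (G : lieGroupType R n).
Hypothesis hcomp : compact [set: G].
Variable mu : probability (borel G) R.
Hypothesis hmu : normalized_haar mu.
Variable p : R.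
Hypothesis hp : 1 < p.
Notation B := (borel G).
Notation LpN := (@LpN _ (borel G) R mu p).
Implicit Types u v : G -> R.

(** A real number rather than an extended one. By [LpN_fin] nothing is lost for continuous
    functions, which are bounded on the compact group. *)
Definition nrm u : R := fine (LpN u).

Lemma continuous_bounded u : continuous u -> exists2 M, 0 <= M & forall x, `|u x| <= M.
Proof.
move=> cu; have [|| |c _ hc] := @compact_EVT_max G R (fun y => `|u y|) setT.
- by exists 1%g.
- exact: hcomp.
- apply: continuous_subspaceT => y; apply: (@continuous_comp _ _ _ u (fun t => `|t|)); first exact: cu.
  exact: norm_continuous.
- by exists `|u c| => // x; apply: hc; exact/mem_set.
Qed.

Lemma LpN_fin u : continuous u -> LpN u = (nrm u)%:E.
Proof.
move=> cu; rewrite /nrm fineK// ge0_fin_numE ?Lnorm_ge0//.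
have [M M0 h] := continuous_bounded cu.
apply: le_lt_trans (ltry M); rewrite -[X in (_ <= X%:E)%E](ger0_norm M0) -(LpN_cst mu hp).
apply: LpN_le => //; first exact: continuous_measurable_R.
by move=> x; rewrite (le_trans (h x))// ler_norm.
Qed.

Lemma nrm_ge0 u : 0 <= nrm u.
Proof. by rewrite fine_ge0// Lnorm_ge0. Qed.

Lemma nrmD u v : continuous u -> continuous v -> nrm (fun x => u x + v x) <= nrm u + nrm v.
Proof.
move=> cu cv; have cuv : continuous (fun x => u x + v x) by move=> x; apply: cvgD; [exact: cu|exact: cv].
rewrite -lee_fin EFinD -!LpN_fin//; apply: LpN_triangle => //; exact: continuous_measurable_R.
Qed.

Lemma nrmZ (a : R) u : continuous u -> nrm (fun x => a * u x) = `|a| * nrm u.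
Proof.
move=> cu; have cau : continuous (fun x => a * u x) by move=> x; apply: cvgM; [exact: cvg_cst|exact: cu].
apply: EFin_inj; rewrite EFinM -!LpN_fin//; apply: LpN_Z => //; exact: continuous_measurable_R.
Qed.

Lemma nrm_sup u M : continuous u -> (forall x, `|u x| <= M) -> nrm u <= M.
Proof.
move=> cu h; have M0 : 0 <= M by rewrite (le_trans _ (h 1%g)).
rewrite -lee_fin -LpN_fin// -[X in (_ <= X%:E)%E](ger0_norm M0) -(LpN_cst mu hp).
apply: LpN_le => //; first exact: continuous_measurable_R.
by move=> x; rewrite (le_trans (h x))// ler_norm.
Qed.

Lemma continuous_right u (g : G) : continuous u -> continuous (fun x => u (x * g)%g).
Proof.
move=> cu x; apply: (@continuous_comp _ _ _ (fun x => x * g)%g u); last exact: cu.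
exact: right_mul_continuous.
Qed.

Lemma nrm_right u (g : G) : continuous u -> nrm (fun x => u (x * g)%g) = nrm u.
Proof.
move=> cu; have cg : continuous (fun x => u (x * g)%g) by exact: continuous_right.
have E : (LpN (fun x => u (x * g)%g) `^ p = LpN u `^ p)%E.
  rewrite !(LpN_pow mu hp).
  apply: (right_invariant_integral hmu g (F := fun x : B => (`|u x| `^ p)%:E)).
    by apply: pow_measurable; exact: continuous_measurable_R.
  by move=> x; rewrite lee_fin powR_ge0.
rewrite /nrm; congr fine.
by apply/le_anti/andP; split; apply: (le_LpN_pow hp); rewrite ?E// Lnorm_ge0.
Qed.

Lemma continuous_integrable u : continuous u -> mu.-integrable setT (EFin \o u : B -> \bar R).
Proof.
move=> cu; have mcu := continuous_measurable_R cu.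
apply/Lfun1_integrable; rewrite inE; apply/andP; split; rewrite inE//=.
rewrite /finite_norm Lnorm1; apply: le_lt_trans (L1_le_LpN mu hp mcu) _.
by rewrite LpN_fin// ltry.
Qed.

Lemma mean_translate u (x : G) : continuous u -> (\int[mu]_y u (x * y)%g = \int[mu]_y u y)%R.
Proof.
move=> cu; have [M M0 hM] := continuous_bounded cu.
have cM : continuous (fun _ : G => M) by move=> y; exact: cst_continuous.
have cxu : continuous (fun y => u (x * y)%g).
  move=> y; apply: (@continuous_comp _ _ _ (fun g => x * g)%g u); last exact: cu.
  exact: left_mul_continuous.
have cuM : continuous (fun y => u y + M) by move=> y; apply: cvgD; [exact: cu|exact: cM].
(* Adding the constant [M] makes the integrand nonnegative, as the invariance of extended integrals
   is stated for such functions. *)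
apply: (addIr (\int[mu]_(y in setT) M)).
rewrite -!RintegralD//; try exact: continuous_integrable.
rewrite /Rintegral; congr fine.
apply: (left_invariant_integral hmu x (F := fun y : B => (u y + M)%:E)).
  by apply/measurable_EFinP; exact: continuous_measurable_R.
by move=> y; rewrite lee_fin -lerBlDr sub0r; have := hM y; rewrite ler_norml => /andP[].
Qed.

(* Jensen's inequality, then Tonelli and the invariance of [mu]. *)
Lemma mean_deviation u (K : R) : continuous u -> (forall g : G, nrm (fun x => u (x * g)%g - u x) <= K) ->
  (LpN (fun x => u x - \int[mu]_y u y)%R <= K%:E)%E.
Proof.
move=> cu hK.
have K0 : 0 <= K by rewrite (le_trans _ (hK 1%g))// nrm_ge0.
have mcu := continuous_measurable_R cu.
set m := (\int[mu]_y u y)%R.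
have cum : continuous (fun x => u x - m) by move=> x; apply: cvgB; [exact: cu|exact: cvg_cst].
have mcum := continuous_measurable_R cum.
apply: (le_LpN_pow hp); rewrite ?Lnorm_ge0 ?lee_fin//.
have pt (x : G) : ((`|u x - m| `^ p)%:E <= \int[mu]_g (`|u (x * g)%g - u x| `^ p)%:E)%E.
  have cxu : continuous (fun g => u (x * g)%g).
    move=> g; apply: (@continuous_comp _ _ _ (fun g => x * g)%g u); last exact: cu.
    exact: left_mul_continuous.
  have cx : continuous (fun g => u (x * g)%g - u x).
    by move=> g; apply: cvgB; [exact: cxu|exact: cvg_cst].
  have mcx := continuous_measurable_R cx.
  rewrite -[leRHS](LpN_pow mu hp (fun g : B => u (x * g)%g - u x)).
  rewrite -poweR_EFin; apply: gt0_ler_poweR; rewrite ?(ltW (lt_trans _ hp))//.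
  - by rewrite in_itv /= lee_fin normr_ge0 leey.
  - by rewrite in_itv /= Lnorm_ge0 leey.
  apply: le_trans (L1_le_LpN mu hp mcx).
  (* By left invariance [m] is also the mean of u(xg) over g, so u(x) - m is an average of
     differences. *)
  have -> : u x - m = - (\int[mu]_g (u (x * g)%g - u x))%R.
    rewrite RintegralB//; [|exact: continuous_integrable|apply: continuous_integrable => y; exact: cst_continuous].
    rewrite mean_translate// Rintegral_cst// opprB; congr (_ - _).
    by rewrite (_ : fine _ = 1) ?mulr1//; exact: (congr1 fine (probability_setT mu)).
  rewrite normrN.
  have := le_normr_Rintegral measurableT (continuous_integrable cx).
  rewrite -lee_fin => /le_trans; apply.
  rewrite /Rintegral fineK//; apply: integrable_fin_num => //.
  apply: (integrable_norm (continuous_integrable cx)).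
pose F (q : B * B) : \bar R := (`|u (q.1 * q.2)%g - u q.1| `^ p)%:E.
have mF : measurable_fun setT F.
  apply: pow_measurable.
  apply: (@measurable_funB _ _ R setT (fun q : B * B => u (q.1 * q.2)%g) (fun q : B * B => u q.1)).
    have := measurableT_comp mcu (continuous_measurable_prod (@mulg_continuous R n G)).
    exact.
  exact: (measurableT_comp mcu measurable_fst).
have F0 q : (0 <= F q)%E by rewrite lee_fin powR_ge0.
have FT : (\int[mu]_x \int[mu]_g F (x, g) = \int[mu]_g \int[mu]_x F (x, g))%E.
  exact: (@fubini_tonelli _ _ _ _ R mu mu F mF F0).
have mF1 : measurable_fun [set: B] (fun x => \int[mu]_g F (x, g))%E.
  exact: (@measurable_fun_fubini_tonelli_F _ _ _ _ R mu F mF F0).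
have mF2 : measurable_fun [set: B] (fun g => \int[mu]_x F (x, g))%E.
  exact: (@measurable_fun_fubini_tonelli_G _ _ _ _ R mu F mF F0).
have pw0 (x : B) : [set: B] x -> (0 <= (`|u x - m| `^ p)%:E)%E by rewrite lee_fin powR_ge0.
have G0 (g : B) : [set: B] g -> (0 <= \int[mu]_x F (x, g))%E by move=> _; apply: integral_ge0 => x _; exact: F0.
have mK : measurable_fun [set: B] (fun _ : B => K%:E `^ p)%E by exact: measurable_cst.
have step1 := @ge0_le_integral _ _ R mu setT measurableT _ _ pw0 (pow_measurable p mcum) mF1 (fun x _ => pt x).
have pt2 (g : B) : [set: B] g -> (\int[mu]_x F (x, g) <= K%:E `^ p)%E.
  move=> _; have cg : continuous (fun x => u (x * g)%g - u x).
    by move=> x; apply: cvgB; [exact: continuous_right|exact: cu].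
  have -> : (\int[mu]_x F (x, g) = LpN (fun x => u (x * g)%g - u x)%R `^ p)%E.
    by rewrite (LpN_pow mu hp).
  rewrite (LpN_fin cg) !poweR_EFin lee_fin.
  by apply: ge0_ler_powR; rewrite ?nnegrE ?nrm_ge0 ?(ltW (lt_trans ltr01 hp)).
have step2 := @ge0_le_integral _ _ R mu setT measurableT _ _ G0 mF2 mK pt2.
rewrite (LpN_pow mu hp); apply: (le_trans step1); rewrite FT; apply: (le_trans step2).
by rewrite integral_cst1.
Qed.

End compact_group_norm.

(** * The cost of a right translation *)

Section transport.
Variables (R : realType) (n : nat) (G : lieGroupType R n).
Hypothesis hcomp : compact [set: G].
Variable mu : probability (borel G) R.
Hypothesis hmu : normalized_haar mu.
Variable p : R.
Hypothesis hp : 1 < p.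
Notation nrm := (nrm mu p).
Variables (m : nat) (X : 'I_m -> vfield R G).
Hypothesis vX : forall i, vector_field (X i).

Definition energy (f : G -> R) : R := \sum_(i < m) nrm (fun x => X i x f).

Definition transport_cost (g : G) (K : R) : Prop :=
  forall f, smooth f -> nrm (fun x => f (x * g)%g - f x) <= K * energy f.
Notation N := transport_cost.

Lemma energy_ge0 f : 0 <= energy f.
Proof. by apply: sumr_ge0 => i _; exact: nrm_ge0. Qed.

Lemma energy_term i f : nrm (fun x => X i x f) <= energy f.
Proof.
by rewrite /energy (bigD1 i)//= lerDl; apply: sumr_ge0 => j _; exact: nrm_ge0.
Qed.

Lemma diff_continuous_right (f : G -> R) g : continuous f -> continuous (fun x => f (x * g)%g - f x).
Proof.
by move=> cf x; apply: cvgB; [exact: continuous_right|exact: cf].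
Qed.

Lemma nrm_telescope (f : G -> R) (g h : G) : continuous f ->
  nrm (fun x => f (x * (g * h))%g - f x) <=
  nrm (fun x => f (x * g)%g - f x) + nrm (fun x => f (x * h)%g - f x).
Proof.
move=> cf.
have ch := @diff_continuous_right f h cf; have cg := @diff_continuous_right f g cf.
rewrite -(nrm_right hmu hp g ch) addrC.
have chg : continuous (fun x => f (x * g * h)%g - f (x * g)%g).
  exact: (@continuous_right _ _ _ (fun x => f (x * h)%g - f x) g ch).
have := nrmD hcomp mu hp chg cg.
by rewrite (_ : (fun x => _ + _) = (fun x => f (x * (g * h))%g - f x))//; apply/funext => x; rewrite mulgA subrKA.
Qed.

Lemma transport1 : N 1%g 0.
Proof.
move=> f sf; rewrite mul0r (_ : (fun x => _) = fun=> 0).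
  by apply: (nrm_sup hcomp mu hp) => [x|x]; [exact: cst_continuous|rewrite normr0].
by apply/funext => x; rewrite mulg1 subrr.
Qed.

Lemma transportM g h a b : N g a -> N h b -> N (g * h)%g (a + b).
Proof.
move=> Ng Nh f sf; rewrite mulrDl.
by apply: le_trans (nrm_telescope g h (smooth_continuous sf)) _; rewrite lerD ?Ng ?Nh.
Qed.

Lemma nrm_opp (u : G -> R) : continuous u -> nrm (fun x => - u x) = nrm u.
Proof.
move=> cu; have := nrmZ hcomp mu hp (-1) cu; rewrite normrN normr1 mul1r => <-.
by congr nrm; apply/funext => x; rewrite mulN1r.
Qed.

Lemma transportV g a : N g a -> N g^-1%g a.
Proof.
move=> Ng f sf; have cf := smooth_continuous sf.
apply: le_trans (Ng f sf).
rewrite -(nrm_right hmu hp g (@diff_continuous_right f g^-1%g cf)).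
rewrite (_ : (fun x => _) = (fun x => - (f (x * g)%g - f x))).
  by rewrite nrm_opp//; exact: diff_continuous_right.
by apply/funext => x; rewrite -mulgA mulgV mulg1 opprB.
Qed.

Lemma transport_le g a b : a <= b -> N g a -> N g b.
Proof. by move=> ab Ng f sf; rewrite (le_trans (Ng f sf))// ler_wpM2r// energy_ge0. Qed.

Lemma nrm_pow (f : G -> R) (h : G) k : continuous f ->
  nrm (fun x => f (x * h ^+ k)%g - f x) <= k%:R * nrm (fun x => f (x * h)%g - f x).
Proof.
move=> cf; elim: k => [|k IH].
  rewrite mul0r (_ : (fun x => _) = fun=> 0).
    by apply: (nrm_sup hcomp mu hp) => [x|x]; [exact: cst_continuous|rewrite normr0].
  by apply/funext => x; rewrite expg0 mulg1 subrr.
rewrite expgS -natr1 mulrDl mul1r addrC.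
by apply: le_trans (nrm_telescope h (h ^+ k)%g cf) _; rewrite lerD2l.
Qed.

(** A bound on translation norms along a sequence thus passes to its cluster points. Compactness of
    [G] makes f(xh) close to f(xg) uniformly in x. *)
Lemma nrm_near (f : G -> R) (g : G) e : continuous f -> 0 < e ->
  \forall h \near g, nrm (fun x => f (x * g)%g - f x) <= nrm (fun x => f (x * h)%g - f x) + e.
Proof.
move=> cf e0.
have H : \forall h \near g, forall x, [set: G] x -> `|f (x * h)%g - f (x * g)%g| < e.
  apply: (compact_continuous_param (F := fun x h => f (x * h)%g)) => // x _.
  apply: (@continuous_comp _ _ _ (fun q : G * G => q.1 * q.2)%g f); last exact: cf.
  exact: mulg_continuous.
apply: nbhsS H => h hh.
have c1 := @diff_continuous_right f h cf.
have c2 : continuous (fun x => f (x * g)%g - f (x * h)%g).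
  by move=> x; apply: cvgB; exact: continuous_right.
have := nrmD hcomp mu hp c2 c1.
rewrite (_ : (fun x => _ + _) = (fun x => f (x * g)%g - f x)); last first.
  by apply/funext => x; rewrite subrKA.
move/le_trans; apply; rewrite addrC lerD2l.
by apply: (nrm_sup hcomp mu hp c2) => x; rewrite distrC ltW// hh.
Qed.

Section local_transport.
Variable c : chart R n G.
Hypotheses (ac : atlas c) (c1 : chart_dom c 1%g).
Variables (r : R) (chi : 'rV[R]_n -> R).
Hypotheses (r0 : 0 < r) (rdom : forall w : 'rV[R]_n, `|w| < r -> psi_dom c w).
Hypotheses (schi : smooth_on setT chi) (chi0 : forall z, r / 2 <= `|z| -> chi z = 0).
Hypothesis chi1 : \forall z \near (0 : 'rV[R]_n), chi z = 1.
Notation psi := (psi c).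
Notation xi := (xi c r chi).

(** The components of [Z] in the left-invariant frame [ld]; see [vec_coord]. *)
Definition vec (Z : vfield R G) : 'rV[R]_n := \row_k Z 1%g (xi k).

Lemma vec_coord (Z : vfield R G) f x : vector_field Z -> left_invariant Z -> smooth f ->
  Z x f = \sum_(k < n) vec Z 0 k * ld c k f x.
Proof.
move=> vZ lZ sf; rewrite (left_invariant_coord ac c1 r0 rdom schi chi0 x (nbhs_singleton chi1) vZ lZ sf).
by apply: eq_bigr => k _; rewrite mxE.
Qed.

(** The mean value theorem on the segment from 0 to [t *: vec Z], with partial derivatives close to
    those at 0 uniformly over the compact group. *)
Lemma uniform_derivative (Z : vfield R G) f e : vector_field Z -> left_invariant Z -> smooth f -> 0 < e ->
  exists2 d, 0 < d & forall (t : R) x, `|t| < d ->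
    `|f (x * psi (t *: vec Z))%g - f x - t * Z x f| <= e * `|t|.
Proof.
move=> vZ lZ sf e0; set v := vec Z.
pose S := \sum_(k < n) `|v 0 k|.
have S0 : 0 <= S by apply: sumr_ge0.
have S1 : 0 < S + 1 by rewrite ltr_wpDl.
pose P k x (w : 'rV[R]_n) := partial k (fun w => f (x * psi w)%g) w.
have e'0 : 0 < e / (S + 1) by rewrite divr_gt0.
have : \forall w \near (0 : 'rV[R]_n), forall k : 'I_n, forall x, [set: G] x -> `|P k x w - P k x 0| < e / (S + 1).
  apply: (@filter_forall _ _ (fun k w => forall x, [set: G] x -> `|P k x w - P k x 0| < e / (S + 1)) (nbhs (0 : 'rV[R]_n)) _) => k.
  apply: (@compact_continuous_param G 'rV[R]_n R setT (fun x w => P k x w) 0) => // x _.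
  by apply: ld_cont => //; exact: psi_dom0.
move=> /nbhs_rVP[d d0 hd].
have v1 : 0 < `|v| + 1 by rewrite ltr_wpDl.
exists (Num.min d r / (`|v| + 1)); first by rewrite divr_gt0// lt_min d0.
move=> t x; rewrite ltr_pdivlMr// lt_min => /andP[td tr].
have tv : `|t *: v| <= `|t| * (`|v| + 1) by rewrite normrZ ler_wpM2l// lerDl.
have sF := translate_psi_smooth ac x sf.
have [|a [al E]] := @mean_value R n (fun w => f (x * psi w)%g) 0 (t *: v).
  move=> z; rewrite !subr0 => zl i; apply: (smooth_on_derivable sF).
  by apply: rdom; rewrite (le_lt_trans zl)// (le_lt_trans tv).
rewrite psi0// mulg1 in E.
rewrite E (vec_coord x vZ lZ sf) mulr_sumr -sumrB.
apply: (@le_trans _ _ (\sum_(k < n) `|t| * (`|v 0 k| * (e / (S + 1))))).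
  apply: (le_trans (ler_norm_sum _ _ _)); apply: ler_sum => k _.
  rewrite [X in `|X|](_ : _ = t * (v 0 k * (P k x (a k) - P k x 0))); last first.
    by rewrite -subvE subr0 /P /ld -/v mxE; ring.
  rewrite normrM ler_wpM2l// normrM ler_wpM2l// ltW//.
  apply: hd => //; have := al k; rewrite !subr0 => /le_lt_trans; apply.
  exact: le_lt_trans td.
rewrite -mulr_sumr -mulr_suml -/S mulrC ler_wpM2r// mulrCA ger_pMr//.
by rewrite ler_pdivrMr// mul1r lerDl.
Qed.

End local_transport.
End transport.

(** * Flows of left-invariant fields *)

Section horizontal_flow.
Variables (R : realType) (n : nat) (G : lieGroupType R n).
Hypothesis hcomp : compact [set: G].
Variable mu : probability (borel G) R.
Hypothesis hmu : normalized_haar mu.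
Variable p : R.
Hypothesis hp : 1 < p.
Variables (m : nat) (X : 'I_m -> vfield R G).
Notation N := (transport_cost mu p X).
Variable c : chart R n G.
Hypotheses (ac : atlas c) (c1 : chart_dom c 1%g).
Variables (r : R) (chi : 'rV[R]_n -> R).
Hypotheses (r0 : 0 < r) (rdom : forall w : 'rV[R]_n, `|w| < r -> psi_dom c w).
Hypotheses (schi : smooth_on setT chi) (chi0 : forall z, r / 2 <= `|z| -> chi z = 0).
Hypothesis chi1 : \forall z \near (0 : 'rV[R]_n), chi z = 1.
Notation psi := (psi c).
Variables (rho C : R).
Hypotheses (rho0 : 0 < rho) (rhor : rho <= r) (C0 : 0 <= C).
Hypothesis local_mul : forall z w, `|z| < rho -> `|w| < rho ->
  exists q, psi q = (psi z * psi w)%g /\ `|q - z - w| <= C * (`|z| * `|w|).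

(** Each further factor adds [w] with an error at most C|z||w|, that is 2Cj|w|^2, because |z| <=
    2j|w|. These errors sum to less than 2C(j|w|)^2. The two hypotheses keep the iterates in the
    ball where the group law is controlled. *)
Lemma psi_pow (w : 'rV[R]_n) (k : nat) :
  2 * C * (k%:R * `|w|) <= 1 -> 2 * (k%:R * `|w|) < rho ->
  forall j, (j <= k)%N -> exists z, psi z = (psi w ^+ j)%g /\
    `|z - j%:R *: w| <= 2 * C * (j%:R * `|w|) ^+ 2.
Proof.
move=> h1 h2; elim=> [_|j IH jk].
  by exists 0; rewrite psi0// expg0 scale0r subrr normr0 mul0r expr0n mulr0.
have [z [zE zl]] := IH (ltnW jk).
set W := `|w| in h1 h2 zl *.
have W0 : 0 <= W := normr_ge0 w.
have jW : j%:R * W <= k%:R * W by rewrite ler_wpM2r// ler_nat ltnW.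
have j1W : (j%:R + 1) * W <= k%:R * W by rewrite natr1 ler_wpM2r// ler_nat.
have j0 : 0 <= j%:R :> R by [].
have jW0 : 0 <= j%:R * W by rewrite mulr_ge0.
have zn : `|z| <= 2 * (j%:R * W).
  have zl' : `|z - j%:R *: w| <= j%:R * W.
    rewrite (le_trans zl)// (_ : 2 * C * (j%:R * W) ^+ 2 = (2 * C * (j%:R * W)) * (j%:R * W)); last by ring.
    by rewrite ler_piMl// (le_trans _ h1)// ler_wpM2l// mulr_ge0.
  rewrite -(subrK (j%:R *: w) z) (le_trans (ler_normD _ _))// normrZ normr_nat -/W.
  lra.
have zr : `|z| < rho by rewrite (le_lt_trans zn)// (le_lt_trans _ h2)// ler_pM2l.
have wr : W < rho.
  apply: le_lt_trans h2; have : W <= (j%:R + 1) * W by rewrite ler_peMl// lerDr.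
  by move=> h; have := le_trans h j1W; have := mulr_ge0 (ler0n R k) W0; lra.
have [q [qE ql]] := local_mul zr wr.
exists q; split; first by rewrite qE zE expgSr.
rewrite (_ : q - _ = (q - z - w) + (z - j%:R *: w)); last first.
  by apply/rowP => i; rewrite !mxE -natr1; ring.
rewrite (le_trans (ler_normD _ _))// (le_trans (lerD ql zl))// -/W.
have : C * (`|z| * W) <= C * (2 * (j%:R * W) * W) by rewrite ler_wpM2l// ler_wpM2r.
rewrite -natr1 => h3; have := mulr_ge0 C0 (sqr_ge0 W); have := mulr_ge0 C0 (mulr_ge0 j0 (sqr_ge0 W)).
nra.
Qed.

(* Euler's polygons [psi(t v / k)^k] stay close to [psi(t v)], and their cluster
   points replace the exponential of [t Z]. *)
Lemma flow_point (Z : vfield R G) : vector_field Z -> left_invariant Z ->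
  exists M d, [/\ 0 <= M, 0 < d & forall t, `|t| < d -> exists z,
    `|z - t *: vec c r chi Z| <= M * t ^+ 2 /\
    forall f, smooth f -> nrm mu p (fun x => f (x * psi z)%g - f x) <= `|t| * nrm mu p (fun x => Z x f)].
Proof.
move=> vZ lZ; set v := vec c r chi Z.
pose V := `|v| + 1.
have V0 : 0 < V by rewrite ltr_wpDl.
have vV : `|v| <= V by rewrite lerDl.
have C10 : 0 < C + 1 by rewrite ltr_wpDl.
(* The error bound is that of [psi_pow] for k+1 steps [t v / (k+1)], of total length |t||v|; the two
   bounds on [t] are the hypotheses of that lemma. *)
exists (2 * C * V ^+ 2), (Num.min (rho / (2 * V)) ((2 * (C + 1) * V)^-1)); split.
- by rewrite !mulr_ge0 ?exprn_ge0// ltW.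
- by rewrite lt_min divr_gt0 ?invr_gt0 ?mulr_gt0.
move=> t; rewrite lt_min => /andP[t1 t2].
have {}t1 : 2 * (`|t| * V) < rho by move: t1; rewrite ltr_pdivlMr ?mulr_gt0// mulrCA.
have {}t2 : 2 * C * (`|t| * V) <= 1.
  move: t2; rewrite -[X in _ < X]mul1r ltr_pdivlMr ?mulr_gt0// => /ltW; apply: le_trans.
  rewrite (_ : `|t| * (2 * (C + 1) * V) = 2 * C * (`|t| * V) + 2 * (`|t| * V)); last by ring.
  by rewrite lerDl !mulr_ge0// ltW.
have tV : `|t| * `|v| <= `|t| * V by rewrite ler_wpM2l.
pose A := [set z : 'rV[R]_n | `|z - t *: v| <= 2 * C * V ^+ 2 * t ^+ 2].
have Ar z : A z -> `|z| < r.
  move=> Az; apply: lt_le_trans rhor; apply: le_lt_trans t1.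
  rewrite -(subrK (t *: v) z) (le_trans (ler_normD _ _))// normrZ.
  apply: (le_trans (lerD Az tV)); rewrite -(real_normK (num_real t)).
  have : (2 * C * (`|t| * V)) * (`|t| * V) <= 1 * (`|t| * V) by rewrite ler_wpM2r// mulr_ge0// ltW.
  by nra.
have cA : compact A.
  apply: (@subclosed_compact _ _ [set z : 'rV[R]_n | `|z| <= r]); last first.
  - by move=> z /Ar /ltW.
  - exact: compact_cball.
  apply: (@preimage_closed _ _ (fun z : 'rV[R]_n => `|z - t *: v|) [set u | u <= 2 * C * V ^+ 2 * t ^+ 2]).
    move=> z _; apply: (@continuous_comp _ _ _ (fun z : 'rV[R]_n => z - t *: v) (fun z : 'rV[R]_n => `|z|)); last exact: norm_continuous.
    exact: addr_cont.
  exact: closed_le.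
have cpA : compact (psi @` A).
  apply: continuous_compact cA; apply: continuous_in_subspaceT => z /set_mem /Ar zr.
  by apply: psi_cont => //; exact: rdom.
pose g k := (psi ((t / k.+1%:R) *: v) ^+ k.+1)%g.
have kn0 k : k.+1%:R != 0 :> R by rewrite pnatr_eq0.
have wE k : k.+1%:R * `|(t / k.+1%:R) *: v| = `|t| * `|v|.
  by rewrite normrZ normrM normfV normr_nat mulrA (mulrCA k.+1%:R) divff// mulr1.
have gA k : (psi @` A) (g k).
  have [|||z [zE zl]] := @psi_pow ((t / k.+1%:R) *: v) k.+1 _ _ k.+1.
  - by rewrite wE (le_trans _ t2)// ler_wpM2l// mulr_ge0.
  - by rewrite wE (le_lt_trans _ t1)// ler_pM2l.
  - by [].
  exists z => //; move: zl; rewrite scalerA mulrCA divff// mulr1 wE => /le_trans; apply.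
  rewrite -[leRHS]mulrA ler_wpM2l ?mulr_ge0// exprMn -(real_normK (num_real t)) mulrC.
  by rewrite ler_wpM2r ?exprn_ge0// ler_sqr ?nnegrE// ltW.
have [h [[z Az zE] clh]] : (psi @` A) `&` cluster (g @ \oo) !=set0.
  by apply: cpA; exists 0%N => // k _; exact: gA.
exists z; split => // f sf; rewrite zE.
have cf := smooth_continuous sf.
have cZf : continuous (fun x => Z x f) by apply: smooth_continuous; case: vZ => _; exact.
apply/ler_addgt0Pr => e e0.
(* Half of [e] pays for all the Euler steps together, whose lengths add up to |t|; the other half
   pays for passing from the polygon [g k] to the cluster point. *)
have e1 : 0 < e / (2 * (`|t| + 1)) by rewrite divr_gt0// mulr_gt0// ltr_wpDl.
have e2 : 0 < e / 2 by rewrite divr_gt0.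
have [d d0 hd] := uniform_derivative hcomp ac c1 r0 rdom schi chi0 chi1 vZ lZ sf e1.
have tk : \forall k \near \oo, `|t / k.+1%:R| < d.
  have [K Kd] : exists K : nat, `|t| / d < K%:R.
    by exists (Num.truncn (`|t| / d)).+1; rewrite truncnS_gt.
  exists K => // k /= Kk; rewrite normrM normfV normr_nat ltr_pdivrMr// mulrC -ltr_pdivrMr//.
  by rewrite (lt_le_trans Kd)// ler_nat leqW.
have near1 := nrm_near hcomp mu hp h cf e2.
have [k [hk1 hk2]] : exists k, `|t / k.+1%:R| < d /\
   nrm mu p (fun x => f (x * h)%g - f x) <= nrm mu p (fun x => f (x * g k)%g - f x) + e / 2.
  case: tk => K _ hK.
  have [|x [[k Kk gk] Ux]] := clh (g @` [set k | (K <= k)%N]) _ _ near1.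
    by exists K => // k Kk; exists k.
  by exists k; split; [exact: hK|rewrite gk].
apply: (le_trans hk2).
have step : nrm mu p (fun x => f (x * psi ((t / k.+1%:R) *: v))%g - f x) <=
    `|t / k.+1%:R| * nrm mu p (fun x => Z x f) + e / (2 * (`|t| + 1)) * `|t / k.+1%:R|.
  have cd : continuous (fun x => f (x * psi ((t / k.+1%:R) *: v))%g - f x - (t / k.+1%:R) * Z x f).
    move=> x; apply: cvgB; first exact: diff_continuous_right.
    by apply: cvgM; [exact: cvg_cst|exact: cZf].
  have ctZ : continuous (fun x => (t / k.+1%:R) * Z x f).
    by move=> x; apply: cvgM; [exact: cvg_cst|exact: cZf].
  rewrite -(nrmZ hcomp mu hp _ cZf) addrC.
  apply: le_trans (_ : nrm mu p (fun x => (f (x * psi ((t / k.+1%:R) *: v))%g - f x - (t / k.+1%:R) * Z x f) + (t / k.+1%:R) * Z x f) <= _).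
    by under [X in _ <= nrm mu p X]eq_fun do rewrite subrK.
  apply: le_trans (nrmD hcomp mu hp cd ctZ) _; rewrite lerD2r.
  by apply: (nrm_sup hcomp mu hp cd) => x; exact: hd.
have := nrm_pow hcomp hmu hp (psi ((t / k.+1%:R) *: v)) k.+1 cf.
move=> h1; have {h1 step} := le_trans h1 (ler_wpM2l (ler0n _ _) step).
rewrite -/(g k) => h1; apply: (le_trans (lerD h1 (lexx _))).
have kt : k.+1%:R * `|t / k.+1%:R| = `|t|.
  by rewrite normrM normfV normr_nat mulrCA divff// mulr1.
rewrite mulrDr mulrA kt [k.+1%:R * (_ * _)]mulrCA kt -addrA lerD2l.
rewrite invfM mulrA -mulrA mulrC.
have t10 : 0 < `|t| + 1 by rewrite ltr_wpDl.
have : (`|t| + 1)^-1 * `|t| <= 1 by rewrite mulrC ler_pdivrMr// mul1r lerDl.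
by nra.
Qed.

Lemma reach_field i : (forall i, vector_field (X i)) -> left_invariant (X i) ->
  reach psi rho N 1 (vec c r chi (X i)).
Proof.
move=> vX lX; split=> // K.
have [M [d [M0 d0 h]]] := flow_point (vX i) lX.
have K1 : 0 < `|K| + 1 by rewrite ltr_wpDl.
apply: approx_intro => //.
  by move=> g a b ab; exact: transport_le ab.
set v := vec c r chi (X i) in h *.
(* [K] may be negative, hence [|K| + 1]. The first summand bounds the quadratic error of the flow
   point, the second both the displacement and the cost. *)
exists (M * (`|K| + 1) ^+ 2 + (`|K| + 1) * (`|v| + 1)), (d / (`|K| + 1)).
have L0 : 0 <= M * (`|K| + 1) ^+ 2 by rewrite mulr_ge0 ?exprn_ge0// ltW.
have L1 : 0 <= (`|K| + 1) * (`|v| + 1) by rewrite mulr_ge0 ?addr_ge0// ltW.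
split; [exact: addr_ge0|by rewrite divr_gt0|].
move=> s _ s0 sd s1 [a aK ->]; rewrite expr1.
have aK' : `|a| <= `|K| + 1 by rewrite (le_trans aK)// (le_trans (ler_norm _))// lerDl.
have as_ : `|a * s| <= (`|K| + 1) * s by rewrite normrM (gtr0_norm s0) ler_wpM2r// ltW.
have asd : `|a * s| < d by rewrite (le_lt_trans as_)// mulrC -ltr_pdivlMr.
split.
  rewrite normrZ (@le_trans _ _ ((`|K| + 1) * s * (`|v| + 1)))//.
    by rewrite ler_pM// lerDl.
  by rewrite mulrAC ler_wpM2r ?(ltW s0)// lerDr.
have [z [zl zN]] := h _ asd.
exists z; split.
  rewrite (le_trans zl)// -(real_normK (num_real (a * s))).
  rewrite (@le_trans _ _ (M * ((`|K| + 1) * s) ^+ 2))//.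
    by rewrite ler_wpM2l// ler_sqr ?nnegrE// mulr_ge0// ltW.
  by rewrite exprMn mulrA ler_wpM2r ?sqr_ge0// lerDl.
move=> f sf; rewrite (le_trans (zN f sf))// ler_pM ?nrm_ge0//; last exact: energy_term.
rewrite (le_trans as_)// ler_wpM2r ?(ltW s0)// (@le_trans _ _ ((`|K| + 1) * (`|v| + 1)))//.
  by rewrite ler_peMr ?(ltW K1)// lerDr.
by rewrite lerDr.
Qed.

End horizontal_flow.

(** * Reaching the Lie algebra *)

Section vector_field_algebra.
Variables (R : realType) (n : nat) (G : lieGroupType R n).

Lemma vector_field0 : vector_field (fun (_ : G) _ => 0).
Proof.
split=> [x|f _]; last exact: smooth_cst.
by split=> *; rewrite !mulr0 addr0.
Qed.

Lemma vector_fieldD a (Y Z : vfield R G) : vector_field Y -> vector_field Z ->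
  vector_field (fun x f => a * Y x f + Z x f).
Proof.
move=> [tY sY] [tZ sZ]; split=> [x|f sf]; last first.
  apply: smoothD; last exact: sZ.
  by apply: smoothM; [exact: smooth_cst|exact: sY].
have [lY mY] := tY x; have [lZ mZ] := tZ x.
by split=> [b f g sf sg|f g sf sg]; rewrite ?lY ?lZ ?mY ?mZ//; ring.
Qed.

Lemma vector_field_bracket (Y Z : vfield R G) : vector_field Y -> vector_field Z ->
  vector_field (bracket Y Z).
Proof.
move=> [tY sY] [tZ sZ]; split=> [x|f sf].
  split=> [b f g sf sg|f g sf sg]; rewrite /bracket.
    rewrite (_ : (fun y => Z y _) = (fun y => b * Z y f + Z y g)); last first.
      by apply/funext => y; have [l _] := tZ y; rewrite l.
    rewrite (_ : (fun y => Y y _) = (fun y => b * Y y f + Y y g)); last first.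
      by apply/funext => y; have [l _] := tY y; rewrite l.
    have [lY _] := tY x; have [lZ _] := tZ x.
    by rewrite (lY _ _ _ (sZ _ sf) (sZ _ sg)) (lZ _ _ _ (sY _ sf) (sY _ sg)); ring.
  have E (W : vfield R G) : (forall x, tangent_vector x (W x)) ->
      (fun y => W y (fun y => f y * g y)) = (fun y => f y * W y g + g y * W y f).
    by move=> tW; apply/funext => y; have [_ M] := tW y; rewrite M.
  rewrite !E//.
  have E2 (W V : vfield R G) : vector_field W -> vector_field V ->
      V x (fun y => f y * W y g + g y * W y f) =
      f x * V x (fun y => W y g) + W x g * V x f + (g x * V x (fun y => W y f) + W x f * V x g).
    move=> [tW sW] [tV sV]; have [lV mV] := tV x.
    by rewrite (tangentD (tV x)) ?mV//; try (by apply: smoothM => //; exact: sW); exact: sW.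
  by rewrite (E2 Z Y)// (E2 Y Z)//; ring.
rewrite /bracket (_ : (fun x => _) = fun x => Y x (fun y => Z y f) + (-1) * Z x (fun y => Y y f)).
  apply: smoothD; first by apply: sY; exact: sZ.
  by apply: smoothM; [exact: smooth_cst|apply: sZ; exact: sY].
by apply/funext => x; ring.
Qed.

Lemma left_invariant_bracket (Y Z : vfield R G) : vector_field Y -> vector_field Z ->
  left_invariant Y -> left_invariant Z -> left_invariant (bracket Y Z).
Proof.
move=> [_ sY] [_ sZ] lY lZ g x f sf; rewrite /bracket lY ?lZ; try by [exact: sZ|exact: sY].
congr (_ - _).
  by congr Y; apply/funext => y; rewrite lZ.
by congr Z; apply/funext => y; rewrite lY.
Qed.

End vector_field_algebra.

Section reachable_span.
Variables (R : realType) (n : nat) (G : lieGroupType R n).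
Variable c : chart R n G.
Hypotheses (ac : atlas c) (c1 : chart_dom c 1%g).
Variables (r : R) (chi : 'rV[R]_n -> R).
Hypotheses (r0 : 0 < r) (rdom : forall w : 'rV[R]_n, `|w| < r -> psi_dom c w).
Hypotheses (schi : smooth_on setT chi) (chi0 : forall z, r / 2 <= `|z| -> chi z = 0).
Hypothesis chi1 : \forall z \near (0 : 'rV[R]_n), chi z = 1.
Notation vec := (vec c r chi).
Notation bk := (comm_bil c r chi).

(** The link between the group law and the fields: its mixed second-order coefficients are iterated
    left-invariant derivatives of the coordinates at 1. *)
Lemma ld_ld_xi i j k : ld c i (ld c j (xi c r chi k)) 1%g =
  partial (lshift n i) (partial (rshift n j) (law_fun c r chi k)) 0.
Proof.
have E : (fun z => partial (rshift n j) (law_fun c r chi k) (row_mx z 0)) =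
    (fun z => ld c j (xi c r chi k) (1 * psi c z)%g).
  apply/funext => z; rewrite -(partial_row_mxr (law_fun c r chi k) z j 0) /ld.
  rewrite (_ : (fun w => law_fun c r chi k (row_mx z w)) = fun w => xi c r chi k (1 * psi c z * psi c w)%g)//.
  by apply/funext => w; rewrite /law_fun row_mxKl row_mxKr mul1g.
have := partial_row_mxl (partial (rshift n j) (law_fun c r chi k)) 0 i 0.
by rewrite E row_mx0 => <-.
Qed.

(** [Z] has constant coefficients in the frame, so [Y] differentiates only the functions
    [ld j xi_k], whose derivatives at 1 are given by [ld_ld_xi]. *)
Lemma vec_compose (Y Z : vfield R G) k : vector_field Y ->
  vector_field Z -> left_invariant Z ->
  Y 1%g (fun y => Z y (xi c r chi k)) = bil c r chi (vec Y) (vec Z) 0 k.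
Proof.
move=> [tY _] vZ lZ.
have sx := xi_smooth ac r0 rdom schi chi0 k.
have sl j := ld_smooth ac c1 j sx.
under eq_fun do rewrite (vec_coord ac c1 r0 rdom schi chi0 chi1 _ vZ lZ sx).
rewrite (tangent_sum (tY _)); last first.
  by move=> j; apply: smoothM; [exact: smooth_cst|exact: sl].
rewrite mxE; apply: eq_bigr => j _.
have [_ M] := tY 1%g.
rewrite M; [|exact: smooth_cst|exact: sl]; rewrite (tangent_cst (tY _)) mulr0 addr0.
rewrite (tangent_coord ac c1 r0 rdom schi chi0 (nbhs_singleton chi1) (tY _) (sl j)) mulr_sumr.
by apply: eq_bigr => i _; rewrite ld_ld_xi (_ : Y 1%g _ = vec Y 0 i) ?[RHS]mxE//; ring.
Qed.

Lemma vec_bracket (Y Z : vfield R G) : vector_field Y -> left_invariant Y ->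
  vector_field Z -> left_invariant Z -> vec (bracket Y Z) = bk (vec Y) (vec Z).
Proof.
move=> vY lY vZ lZ; apply/rowP => k.
by rewrite /comm_bil subvE -!vec_compose// mxE.
Qed.

Lemma comm_bilBl u v w : bk (u - v) w = bk u w - bk v w.
Proof.
rewrite /comm_bil bilDl bilDr -[in bil c r chi (- v) w]scaleN1r -[in bil c r chi w (- v)]scaleN1r bilZl bilZr !scaleN1r.
by rewrite !opprD !opprK addrACA.
Qed.

Lemma comm_bilBr u v w : bk w (u - v) = bk w u - bk w v.
Proof.
rewrite /comm_bil bilDl bilDr -[in bil c r chi (- v) w]scaleN1r -[in bil c r chi w (- v)]scaleN1r bilZl bilZr !scaleN1r.
by rewrite !opprD !opprK addrACA.
Qed.

Lemma comm_bilZ a b u v : bk (a *: u) (b *: v) = (a * b) *: bk u v.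
Proof. by rewrite /comm_bil !bilZl !bilZr !scalerA (mulrC b) scalerBr. Qed.

Lemma comm_bil_bound : exists2 C, 0 <= C & forall z w, `|bk z w| <= C * (`|z| * `|w|).
Proof.
have [C C0 h] := bil_bound c r chi; exists (C + C); first exact: addr_ge0.
move=> z w; rewrite /comm_bil (le_trans (ler_normB _ _))// mulrDl lerD//.
by rewrite [`|z| * _]mulrC.
Qed.

End reachable_span.

(** * Bounded cost, from a neighbourhood of the identity to the whole group *)

Section connectivity.
Variables (R : realType) (n : nat) (G : lieGroupType R n).
Hypothesis hcomp : compact [set: G].
Variable mu : probability (borel G) R.
Hypothesis hmu : normalized_haar mu.
Variable p : R.
Hypothesis hp : 1 < p.
Variables (m : nat) (X : 'I_m -> vfield R G).
Hypothesis hX : hormander X.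
Notation N := (transport_cost mu p X).

Let vX i : vector_field (X i). Proof. by case: hX => h _ _; case: (h i). Qed.
Let lX i : left_invariant (X i). Proof. by case: hX => h _ _; case: (h i). Qed.

Section near_one.
Variable c : chart R n G.
Hypotheses (ac : atlas c) (c1 : chart_dom c 1%g).
Variables (r : R) (chi : 'rV[R]_n -> R).
Hypotheses (r0 : 0 < r) (rdom : forall w : 'rV[R]_n, `|w| < r -> psi_dom c w).
Hypotheses (schi : smooth_on setT chi) (chi0 : forall z, r / 2 <= `|z| -> chi z = 0).
Hypothesis chi1 : \forall z \near (0 : 'rV[R]_n), chi z = 1.
Notation psi := (psi c).
Notation vec := (vec c r chi).

(** Induction on the Lie span. Smoothness and left invariance travel with the induction because
    [vec_bracket] needs them. In a sum the two fields may be reached at different orders k and l,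
    and are both brought to order kl. *)
Lemma reach_span : exists rho C, [/\ 0 < rho, 0 <= C,
  forall z w, `|z| < rho -> `|w| < rho ->
    exists q, psi q = (psi z * psi w)%g /\ `|q - z - w| <= C * (`|z| * `|w|),
  forall z w, `|z| < rho -> `|w| < rho ->
    exists u, psi z = (psi w * psi u)%g /\ `|u| <= 2 * `|z - w| &
  forall Z, lie_span X Z ->
    [/\ vector_field Z, left_invariant Z & exists a, reach psi rho N a (vec Z)]].
Proof.
have [rho [C [rho0 rhor C0 loc]]] := local_group ac c1 r0 rdom schi chi0 chi1.
have [C' C'0 bb] := comm_bil_bound c r chi.
(* One constant must serve both the group law and the bound on the bracket. *)
have C''0 : 0 <= C + C' by exact: addr_ge0.
have lm z w : `|z| < rho -> `|w| < rho ->
    exists q, psi q = (psi z * psi w)%g /\ `|q - z - w| <= (C + C') * (`|z| * `|w|).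
  move=> zr wr; have [[q [qE ql]] _ _] := loc z w zr wr; exists q; split=> //.
  by rewrite (le_trans ql)// ler_wpM2r ?mulr_ge0// lerDl.
have ld z w : `|z| < rho -> `|w| < rho ->
    exists u, psi z = (psi w * psi u)%g /\ `|u| <= 2 * `|z - w|.
  by move=> zr wr; have [] := loc z w zr wr.
have lc z w : `|z| < rho -> `|w| < rho -> exists u, (psi z * psi w)%g = (psi w * psi z * psi u)%g /\
    `|u - comm_bil c r chi z w| <= (C + C') * (`|z| * `|w| * (`|z| + `|w|)).
  move=> zr wr; have [_ _ [q [qE ql]]] := loc z w zr wr; exists q; split=> //.
  by rewrite (le_trans ql)// ler_wpM2r ?lerDl// !mulr_ge0// addr_ge0.
have bb' u v : `|comm_bil c r chi u v| <= (C + C') * (`|u| * `|v|).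
  by rewrite (le_trans (bb u v))// ler_wpM2r ?mulr_ge0// lerDr.
have N1 : N 1%g 0 := transport1 hcomp mu hp X.
have NM := @transportM _ _ _ hcomp mu hmu p hp m X.
have NV := @transportV _ _ _ hcomp mu hmu p hp m X.
have Nle := @transport_le _ _ _ mu p m X.
have psi01 := psi0 ac c1.
exists rho, (C + C'); split => // Z; elim => {Z} [i| |a Y Z _ [vY lY [k hY]] _ [vZ lZ [l hZ]]|Y Z _ [vY lY [k hY]] _ [vZ lZ [l hZ]]].
- split=> //; exists 1%N.
  exact: (reach_field hcomp hmu hp ac c1 r0 rdom schi chi0 chi1 rho0 rhor C''0 lm vX (lX i)).
- split; [exact: vector_field0|by []|exists 1%N].
  rewrite (_ : vec _ = 0); last by apply/rowP => k; rewrite !mxE.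
  exact: (reach0 rho0 psi01 N1 Nle).
- split; first exact: vector_fieldD.
    by move=> g x f sf; rewrite lY ?lZ.
  rewrite (_ : vec _ = a *: vec Y + vec Z); last by apply/rowP => j; rewrite !mxE.
  exists (k * l)%N; apply: (reach_add rho0 C''0 lm NM Nle).
    apply: reach_scale; have [l0 _] := hZ; rewrite -(prednK l0).
    exact: (reach_up rho0 Nle).
  have [k0 _] := hY; rewrite mulnC -(prednK k0).
  exact: (reach_up rho0 Nle).
- split; [exact: vector_field_bracket|exact: left_invariant_bracket|].
  exists (k + l)%N; rewrite (vec_bracket ac c1 r0 rdom schi chi0 chi1)//.
  exact: (reach_comm rho0 C''0 lc (comm_bilBl c r chi) (comm_bilBr c r chi) bb' NM NV Nle (comm_bilZ c r chi) hY hZ).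
Qed.

(** The exhaustion leaves a factor [psi y] with [y] as small as desired. For a fixed smooth [f] it
    changes f(x) by at most [e], uniformly in x, while [K] depends neither on [f] nor on [e]; then
    let [e] tend to 0. *)
Lemma transport_cost_chart : exists r1 K, 0 < r1 /\ forall z, `|z| <= r1 -> N (psi z) K.
Proof.
have [rho [C [rho0 C0 lm ldv span]]] := reach_span.
have N1 : N 1%g 0 := transport1 hcomp mu hp X.
have NM := @transportM _ _ _ hcomp mu hmu p hp m X.
have Nle := @transport_le _ _ _ mu p m X.
have [|a [a0 ha]] := reach_basis rho0 C0 lm (psi0 ac c1) N1 NM Nle.
  (* The Hormander condition writes the left-invariant field with value [e_j] at 1 as an element of
     the span, up to its values on nonsmooth functions; its components are read off on the smooth
     [xi]. *)
  move=> j; case: hX => _ hgen _.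
  have [Z sZ eZ] := hgen _ (ld_vector_field ac c1 j) (@ld_left_invariant _ _ _ c j).
  have [_ _ [k hk]] := span Z sZ; exists k.
  rewrite (_ : e_ R j = vec Z)//; apply/rowP => k'.
  rewrite e_E [RHS]mxE -eZ; last exact: (xi_smooth ac r0 rdom schi chi0).
  by rewrite (ld_xi ac r0 rdom j k' chi1).
have [r1 [K [r10 K0 hK]]] := approx_exhaust rho0 ldv N1 NM Nle a0 ha.
exists r1, K; split => // z zr f sf.
have cf := smooth_continuous sf.
apply/ler_addgt0Pr => e e0.
have H : \forall w \near (0 : 'rV[R]_n), forall x, [set: G] x -> `|f (x * psi w)%g - f (x * psi 0)%g| < e.
  apply: (@compact_continuous_param G 'rV[R]_n R setT (fun x w => f (x * psi w)%g) 0) => // x _.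
  apply: (@continuous_comp _ _ _ (fun q : G * 'rV[R]_n => q.1 * psi q.2)%g f); last exact: cf.
  apply: (@mulg_cont R n G _ (fun q : G * 'rV[R]_n => q.1) (fun q : G * 'rV[R]_n => psi q.2) (x, 0)).
    exact: cvg_fst.
  apply: (@continuous_comp _ _ _ (fun q : G * 'rV[R]_n => q.2) psi); first exact: cvg_snd.
  exact: (psi_cont ac (psi_dom0 c1)).
move/nbhs_rVP: H => [d d0 hd].
have d20 : 0 < d / 2 by rewrite divr_gt0.
have [q [y [zE Nq yd]]] := hK z zr (d / 2) d20.
rewrite zE; apply: le_trans (nrm_telescope hcomp hmu hp q (psi y) cf) _.
apply: lerD; first exact: Nq.
apply: (nrm_sup hcomp mu hp (@diff_continuous_right _ _ _ f (psi y) cf)) => x.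
have yd' : `|y| < d by rewrite (le_lt_trans yd)// ltr_pdivrMr// mulr_natr mulr2n ltrDl.
have := hd y; rewrite subr0 => /(_ yd' x I); rewrite (psi0 ac c1) mulg1; exact: ltW.
Qed.

End near_one.

Lemma transport_cost_near1 : exists2 K, 0 <= K & \forall g \near (1%g : G), N g K.
Proof.
have [c ac c1] := chart_at (1%g : G).
have [r r0 hr] : exists2 r, 0 < r & forall w : 'rV[R]_n, `|w| < r -> psi_dom c w.
  have /nbhs_rVP[r r0 hr] : nbhs (0 : 'rV[R]_n) (psi_dom c).
    by apply: open_nbhs_nbhs; split; [exact: open_psi_dom|exact: psi_dom0].
  by exists r => // w wr; apply: hr; rewrite subr0.
have r20 : 0 < r / 2 by rewrite divr_gt0.
have [chi [schi chi1 chi0]] := plateau_bump n r20.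
have [r1 [K [r10 hK]]] := transport_cost_chart ac c1 r0 hr schi chi0 chi1.
exists `|K|; first by [].
have : \forall g \near (1%g : G), chart_dom c g /\ `|phi c g| < r1.
  have cn : {for 1%g, continuous (fun g => `|phi c g|)}.
    apply: (@continuous_comp _ _ _ (phi c) (fun z : 'rV[R]_n => `|z|)); last exact: norm_continuous.
    exact: phi_cont.
  have n1 : nbhs (1%g : G) (chart_dom c).
    by apply: open_nbhs_nbhs; split; [exact: open_chart_dom|].
  have n2 : nbhs (1%g : G) [set g | `|phi c g| < r1].
    apply: (cn [set u | u < r1]); apply: open_nbhs_nbhs; split; first exact: open_lt.
    by rewrite /= phi1 normr0.
  by apply: nbhsS2 n1 n2.
apply: nbhsS => g [gc gr]; rewrite -(phiK ac gc).
by apply: transport_le (ler_norm K) _; apply: hK; exact: ltW.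
Qed.

Lemma transport_cost_near (x : G) : exists2 K, 0 <= K & \forall y \near x, N (x^-1 * y)%g K.
Proof.
have [K K0 hK] := transport_cost_near1; exists K => //.
have cx : {for x, continuous (fun y => x^-1 * y)%g} by exact: left_mul_continuous.
by have := cx [set h | N h K]; rewrite mulVg => /(_ hK).
Qed.

(** The points of finite cost form a subgroup [H] containing a neighbourhood of each of its points.
    The complement is open for the same reason, so [H = G] by connectedness. This gives a finite
    cost at each point, and compactness is needed for a common bound. *)
Lemma transport_cost_bounded : connected [set: G] -> exists2 K, 0 <= K & forall g, N g K.
Proof.
move=> hconn.
pose H : set G := [set g | exists K, N g K].
have HM g h : H g -> H h -> H (g * h)%g.
  by move=> [a Ng] [b Nh]; exists (a + b); exact: (transportM hcomp hmu hp Ng Nh).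
have oH : open H.
  rewrite openE => x Hx; have [K _] := transport_cost_near x.
  apply: nbhsS => y Ny; rewrite -(mul1g y) -(mulgV x) -mulgA.
  by apply: HM => //; exists K.
have oHC : open (~` H).
  rewrite openE => x Hx; have [K _] := transport_cost_near x.
  apply: nbhsS => y Ny Hy; apply: Hx.
  rewrite (_ : x = y * (x^-1 * y)^-1)%g; last by rewrite invgM invgK mulgA mulgV mul1g.
  by apply: HM => //; exists K; exact: (transportV hcomp hmu hp Ny).
have HT : H = setT.
  apply: hconn; first by exists 1%g; exists 0; exact: (transport1 hcomp mu hp X).
    by exists H => //; rewrite setTI.
  by exists H; [rewrite -openC|rewrite setTI].
(* Compactness as a covering property along the filter of large [K]: near a point x of cost k, every
   point has cost at most k plus the local constant. *)
have := hcomp; rewrite compact_near_coveringP => /(_ R (pinfty_nbhs R) (fun K g => N g K)) [].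
  move=> x _; have [K K0 hK] := transport_cost_near x.
  have [k Nx] : H x by rewrite HT.
  exists ([set y | N (x^-1 * y)%g K], [set l | k + K < l]).
    by split=> //=; exists (k + K); split => //; exact: num_real.
  move=> [y l] [/= Ny kl].
  rewrite -(mul1g y) -(mulgV x) -mulgA.
  exact: (transport_le (ltW kl) (transportM hcomp hmu hp Nx Ny)).
move=> K [_ hK]; exists (`|K| + 1); first exact: addr_ge0.
move=> g; apply: hK => //; by rewrite (le_lt_trans (ler_norm K))// ltrDl.
Qed.

End connectivity.

(** * Complex functions and the closed gradient *)

Local Notation normc := ComplexField.Normc.normc.

Section complex_norm.
Variable R : realType.
Implicit Types z w : R[i].

Lemma normcD z w : normc (z + w) <= normc z + normc w.
Proof. exact: (@le_normcD R z w). Qed.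

Lemma normc_ge0 z : 0 <= normc z.
Proof. by case: z => a b; rewrite /= sqrtr_ge0. Qed.

Lemma Re_le_normc z : `|complex.Re z| <= normc z.
Proof. by case: z => a b /=; rewrite -sqrtr_sqr ler_wsqrtr// lerDl sqr_ge0. Qed.

Lemma Im_le_normc z : `|complex.Im z| <= normc z.
Proof. by case: z => a b /=; rewrite -sqrtr_sqr ler_wsqrtr// lerDr sqr_ge0. Qed.

Lemma normc_le z : normc z <= `|complex.Re z| + `|complex.Im z|.
Proof.
case: z => a b /=; rewrite -[leRHS]ger0_norm ?addr_ge0// -sqrtr_sqr ler_wsqrtr//.
rewrite sqrrD !real_normK ?num_real// addrAC lerDl mulrn_wge0// mulr_ge0//.
Qed.

Lemma ReB z w : complex.Re (z - w) = complex.Re z - complex.Re w.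
Proof. by case: z; case: w. Qed.

Lemma ImB z w : complex.Im (z - w) = complex.Im z - complex.Im w.
Proof. by case: z; case: w. Qed.

Lemma normc_le_norm_lp (p : R) m (v : 'rV[R[i]]_m) i : 0 < p -> normc (v 0 i) <= norm_lp p v.
Proof.
move=> p0; rewrite /norm_lp -[leLHS](powRr1 (normc_ge0 _)) -(mulfV (lt0r_neq0 p0)) powRrM.
apply: ge0_ler_powR; rewrite ?nnegrE ?invr_ge0 ?powR_ge0 ?(ltW p0)//.
  by apply: sumr_ge0 => j _; exact: powR_ge0.
by rewrite (bigD1 i)//= lerDl; apply: sumr_ge0 => j _; exact: powR_ge0.
Qed.

End complex_norm.

Section complex_measurability.
Variables (R : realType) (n : nat) (G : lieGroupType R n).
Notation B := (borel G).

Lemma measurable_normc (f : G -> R[i]) : measurable_C f ->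
  measurable_fun [set: B] (fun x : B => normc (f x)).
Proof.
move=> [mR mI].
rewrite (_ : (fun x => _) = (fun x : B => Num.sqrt (complex.Re (f x) ^+ 2 + complex.Im (f x) ^+ 2))); last first.
  by apply/funext => x; case: (f x).
apply: (@measurableT_comp _ _ _ _ _ _ (@Num.sqrt R)).
  exact: continuous_measurable_fun (@sqrt_continuous R).
by apply: measurable_funD; apply: measurable_funX.
Qed.

Lemma measurable_norm_lp (p : R) m (g : G -> 'rV[R[i]]_m) :
  (forall i, measurable_C (fun x => g x 0 i)) ->
  measurable_fun [set: B] (fun x : B => norm_lp p (g x)).
Proof.
move=> mg; apply: (measurableT_comp (measurable_powR _)).
apply: measurable_sum => i.
by apply: (measurableT_comp (measurable_powR _)); exact: measurable_normc.
Qed.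

Lemma measurable_CB (f g : G -> R[i]) : measurable_C f -> measurable_C g ->
  measurable_C (fun x => f x - g x).
Proof.
move=> [fR fI] [gR gI]; split.
  by under eq_fun do rewrite ReB; exact: measurable_funB.
by under eq_fun do rewrite ImB; exact: measurable_funB.
Qed.

Lemma measurable_C_cst (z : R[i]) : measurable_C (fun _ : G => z).
Proof. by split; exact: measurable_cst. Qed.

Lemma smooth_measurable_C (a b : G -> R) : smooth a -> smooth b ->
  measurable_C (fun x => Complex (a x) (b x)).
Proof. by move=> sa sb; split; apply: continuous_measurable_R; exact: smooth_continuous. Qed.

End complex_measurability.

(** * The inequality for smooth functions and for the closed gradient *)

Section poincare.
Variables (R : realType) (n : nat) (G : lieGroupType R n).
Hypothesis hcomp : compact [set: G].
Variable mu : probability (borel G) R.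
Hypothesis hmu : normalized_haar mu.
Variable p : R.
Hypothesis hp : 1 < p.
Notation B := (borel G).
Notation LpN := (@LpN _ (borel G) R mu p).

(** On a probability space L^p lies in L^1, so the mean of such a function is a genuine integral and
    not a default value. *)
Lemma normLp_integrable f : mem_Lp mu p f ->
  mu.-integrable setT (fun x : B => (complex.Re (f x))%:E) /\
  mu.-integrable setT (fun x : B => (complex.Im (f x))%:E).
Proof.
move=> [mf fin]; have mn := measurable_normc mf; have [mR mI] := mf.
have H (h : B -> R) : measurable_fun setT h -> (forall x, `|h x| <= normc (f x)) ->
    mu.-integrable setT (EFin \o h).
  move=> mh hf; apply/Lfun1_integrable; rewrite inE; apply/andP; split; rewrite inE//=.
  rewrite /finite_norm Lnorm1; apply: le_lt_trans (L1_le_LpN mu hp mh) _.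
  apply: le_lt_trans fin; apply: (LpN_le mu hp mh mn) => x.
  by rewrite (ger0_norm (normc_ge0 _)).
by split; apply: H => // x; [exact: Re_le_normc|exact: Im_le_normc].
Qed.

(** The factor 2 comes from bounding the real and imaginary parts of the mean separately. *)
Lemma normc_mean_le f : mem_Lp mu p f -> ((normc (mean mu f))%:E <= 2%:E * normLp mu p f)%E.
Proof.
move=> fp; have [iR iI] := normLp_integrable fp; have [mf fin] := fp.
have mn := measurable_normc mf; have [mR mI] := mf.
have H (h : B -> R) : measurable_fun setT h -> mu.-integrable setT (EFin \o h) ->
    (forall x, `|h x| <= normc (f x)) -> (`|\int[mu]_x h x|%:E <= normLp mu p f)%E.
  move=> mh ih hf; have := le_normr_Rintegral measurableT ih.
  rewrite -lee_fin => /le_trans; apply.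
  rewrite /Rintegral fineK; last exact: (integrable_fin_num measurableT (integrable_norm ih)).
  apply: le_trans (L1_le_LpN mu hp mh) _.
  by apply: (LpN_le mu hp mh mn) => x; rewrite (ger0_norm (normc_ge0 _)).
apply: (@le_trans _ _ (`|\int[mu]_x complex.Re (f x)|%:E + `|\int[mu]_x complex.Im (f x)|%:E)%E).
  by rewrite -EFinD lee_fin; exact: normc_le.
rewrite (_ : 2%:E = 1%:E + 1%:E)%E; last by rewrite -EFinD.
rewrite ge0_muleDl ?lee_fin// !mul1e; apply: leeD; apply: H => // x; [exact: Re_le_normc|exact: Im_le_normc].
Qed.

Lemma mean_sub f g : mem_Lp mu p f -> mem_Lp mu p g ->
  mean mu f - mean mu g = mean mu (fun x => f x - g x).
Proof.
move=> fp gp; have [fR fI] := normLp_integrable fp; have [gR gI] := normLp_integrable gp.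
rewrite /mean; congr Complex.
  by under [RHS]eq_Rintegral do rewrite ReB; rewrite RintegralB.
by under [RHS]eq_Rintegral do rewrite ImB; rewrite RintegralB.
Qed.

Variables (m : nat) (X : 'I_m -> vfield R G).
Hypothesis vX : forall i, vector_field (X i).

Lemma measurable_gradient u : smooth_compact_support u ->
  forall i, measurable_C (fun x => gradient X u x 0 i).
Proof.
move=> [sR sI _] i; under eq_fun do rewrite mxE.
by apply: smooth_measurable_C; case: (vX i) => _; apply.
Qed.

(** Each component of the gradient is dominated pointwise by the l^p norm of the whole vector;
    summing over the fields gives the factor [m]. *)
Lemma energy_le_gradient u g e : smooth_compact_support u -> mem_Lp_lp mu p g ->
  (normLp_lp mu p (fun x => gradient X u x - g x)%R <= e)%E ->
  ((energy mu p X (fun x => complex.Re (u x)))%:E <= m%:R%:E * (e + normLp_lp mu p g))%E /\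
  ((energy mu p X (fun x => complex.Im (u x)))%:E <= m%:R%:E * (e + normLp_lp mu p g))%E.
Proof.
move=> su [mg _] hg; have mgr := measurable_gradient su.
have p0 : 0 < p by exact: lt_trans hp.
have E i x : (gradient X u x - g x)%R 0 i = gradient X u x 0 i - g x 0 i.
  by rewrite [LHS]mxE [X in _ + X]mxE.
have mgu i : measurable_C (fun x => (gradient X u x - g x)%R 0 i).
  by under eq_fun do rewrite E; exact: measurable_CB.
have H (a : G -> R) : smooth a ->
    (forall i x, `|X i x a| <= normc (gradient X u x 0 i)) ->
    ((energy mu p X a)%:E <= m%:R%:E * (e + normLp_lp mu p g))%E.
  move=> sa ha; rewrite /energy -sumEFin.
  apply: (@le_trans _ _ (\sum_(i < m) (e + normLp_lp mu p g))%E); last first.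
    by rewrite sumr_const card_ord mule_natl.
  apply: lee_sum => i _.
  have cX : continuous (fun x => X i x a) by apply: smooth_continuous; case: (vX i) => _; apply.
  rewrite -(LpN_fin hcomp mu hp cX).
  have m1 : measurable_fun [set: B] (fun x : B => norm_lp p (gradient X u x - g x)).
    exact: measurable_norm_lp.
  have m2 : measurable_fun [set: B] (fun x : B => norm_lp p (g x)).
    exact: measurable_norm_lp.
  apply: le_trans (leeD hg (lexx _)).
  apply: le_trans (LpN_triangle mu hp m1 m2).
  have m3 : measurable_fun [set: B] (fun x : B => X i x a) by exact: continuous_measurable_R.
  have m4 := measurable_funD m1 m2.
  apply: (LpN_le mu hp m3 m4) => x.
  apply: le_trans (ha i x) _; apply: le_trans (ler_norm _).
  apply: le_trans (lerD (normc_le_norm_lp _ i p0) (normc_le_norm_lp _ i p0)).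
  by rewrite E (le_trans _ (normcD _ _))// subrK.
have [sR sI _] := su.
split; apply: H => // i x; rewrite mxE; last exact: (Im_le_normc (Complex _ _)).
exact: (Re_le_normc (Complex _ _)).
Qed.

Variable K : R.
Hypothesis K0 : 0 <= K.
Hypothesis hK : forall g, transport_cost mu p X g K.

Lemma smooth_poincare f : smooth f ->
  (LpN (fun x => f x - \int[mu]_y f y)%R <= (K * energy mu p X f)%:E)%E.
Proof.
by move=> sf; apply: (mean_deviation hcomp hmu hp (smooth_continuous sf)) => g; exact: hK.
Qed.

Lemma complex_poincare u : smooth_compact_support u ->
  (normLp mu p (fun x => u x - mean mu u)%R <=
   (K * (energy mu p X (fun x => complex.Re (u x)) + energy mu p X (fun x => complex.Im (u x))))%:E)%E.
Proof.
move=> [sR sI _].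
have mpart (a : G -> R) (b : R) : smooth a -> measurable_fun [set: B] (fun x : B => a x - b).
  move=> sa; apply: measurable_funB; last exact: measurable_cst.
  by apply: continuous_measurable_R; exact: smooth_continuous.
have mabs (a : G -> R) (b : R) : smooth a -> measurable_fun [set: B] (fun x : B => `|a x - b|).
  by move=> sa; apply: measurableT_comp (mpart a b sa).
rewrite mulrDr EFinD; apply: le_trans (leeD (smooth_poincare sR) (smooth_poincare sI)).
have abs (a : G -> R) : smooth a -> (LpN (fun x : B => `|a x - \int[mu]_y a y|)%R <= LpN (fun x : B => a x - \int[mu]_y a y)%R)%E.
  move=> sa; apply: (LpN_le mu hp (mabs a _ sa) (mpart a _ sa)) => x.
  by rewrite normr_id.
apply: le_trans (leeD (abs _ sR) (abs _ sI)).
apply: le_trans (LpN_triangle mu hp (mabs _ _ sR) (mabs _ _ sI)).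
apply: (LpN_le mu hp).
- by apply: measurable_normc; apply: measurable_CB; [split; apply: continuous_measurable_R; exact: smooth_continuous|exact: measurable_C_cst].
- by apply: measurable_funD; exact: mabs.
move=> x; rewrite ger0_norm ?normc_ge0// (le_trans _ (ler_norm _))//.
by apply: le_trans (normc_le _) _; rewrite ReB ImB.
Qed.

Lemma smooth_mem_Lp u : smooth_compact_support u -> mem_Lp mu p u.
Proof.
move=> [sR sI _]; have cR := smooth_continuous sR; have cI := smooth_continuous sI.
have mu' : measurable_C u by split; exact: continuous_measurable_R.
split=> //.
have cn : continuous (fun x => `|complex.Re (u x)| + `|complex.Im (u x)|).
  move=> x; apply: cvgD; first by apply: cvg_norm; exact: cR.
  by apply: cvg_norm; exact: cI.
apply: (@le_lt_trans _ _ (LpN (fun x => `|complex.Re (u x)| + `|complex.Im (u x)|)%R)).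
  apply: (LpN_le mu hp (measurable_normc mu') (continuous_measurable_R cn)) => x.
  by rewrite ger0_norm ?normc_ge0// (le_trans _ (ler_norm _))// normc_le.
by rewrite (LpN_fin hcomp mu hp cn) ltry.
Qed.

(** For a smooth [u] close to [f] in the graph norm, split f - mean f into f - u, u - mean u and
    mean u - mean f. The middle term obeys the smooth inequality, and the outer ones are small. *)
Lemma closure_poincare f g : nabla_p mu X p f g ->
  (normLp mu p (fun x => f x - mean mu f)%R <= (2 * m%:R * K)%:E * normLp_lp mu p g)%E.
Proof.
move=> [fp gp happ].
have [mf _] := fp; have [mg gfin] := gp.
set A := normLp_lp mu p g in gfin *.
have A0 : (0 <= A)%E by exact: Lnorm_ge0.
have [a aE] : exists a, A = a%:E.
  by exists (fine A); rewrite fineK// ge0_fin_numE.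
have L0 : 0 < 4 + 2 * m%:R * K by rewrite ltr_wpDr// !mulr_ge0.
apply/lee_addgt0Pr => e e0.
(* The three terms contribute errors d, 2mKd and 2d beyond 2mK times the norm of [g], in total at
   most [e]. *)
pose d := e / (4 + 2 * m%:R * K).
have d0 : 0 < d by rewrite divr_gt0.
have d20 : 0 <= 2 * d by rewrite mulr_ge0// ltW.
have [u [su ufd ugd]] := happ d d0.
have up := smooth_mem_Lp su; have [mu' _] := up.
have muf : measurable_C (fun x => u x - f x) by exact: measurable_CB.
have ufp : mem_Lp mu p (fun x => u x - f x)%R.
  by split => //; apply: lt_trans ufd _; rewrite ltry.
have [eR eI] := energy_le_gradient su gp (ltW ugd).
rewrite -/A aE -EFinD -EFinM !lee_fin in eR eI.
have P := complex_poincare su.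
have M : (normc (mean mu (fun x => u x - f x)%R) <= 2 * d).
  rewrite -lee_fin EFinM; apply: le_trans (normc_mean_le ufp) _.
  by apply: lee_wpmul2l; [rewrite lee_fin|exact: ltW].
have m1 : measurable_fun [set: B] (fun x : B => normc (u x - f x)) by exact: measurable_normc.
have m2 : measurable_fun [set: B] (fun x : B => normc (u x - mean mu u)).
  by apply: measurable_normc; apply: measurable_CB => //; exact: measurable_C_cst.
have m12 : measurable_fun [set: B] (fun x : B => normc (u x - f x) + normc (u x - mean mu u)).
  exact: measurable_funD.
have m3 : measurable_fun [set: B] (fun _ : B => 2 * d) by exact: measurable_cst.
have T := LpN_triangle mu hp m12 m3.
have T2 := LpN_triangle mu hp m1 m2.
have E : (LpN (fun x => normc (f x - mean mu f)%R) <=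
    LpN (fun x => normc (u x - f x) + normc (u x - mean mu u) + 2 * d)%R)%E.
  apply: (LpN_le mu hp).
  - by apply: measurable_normc; apply: measurable_CB => //; exact: measurable_C_cst.
  - exact: measurable_funD.
  move=> x; rewrite ger0_norm ?normc_ge0// (le_trans _ (ler_norm _))//.
  apply: le_trans (lerD (lexx _) M).
  rewrite -(mean_sub up fp).
  rewrite (_ : f x - mean mu f = - (u x - f x) + (u x - mean mu u) + (mean mu u - mean mu f))%R; last by rewrite opprB !subrKA.
  apply: le_trans (normcD _ _) _; rewrite lerD2r.
  by apply: le_trans (normcD _ _) _; rewrite lerD2r (@normcN R (u x - f x)).
apply: le_trans E _; apply: le_trans T _; rewrite (LpN_cst mu hp) (ger0_norm d20).
apply: (@le_trans _ _ (d%:E + (K * (energy mu p X (fun x => complex.Re (u x)) + energy mu p X (fun x => complex.Im (u x))))%:E + (2 * d)%:E)%E).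
  apply: leeD => //; apply: le_trans T2 _; apply: leeD => //; exact: ltW.
rewrite aE -EFinM -!EFinD lee_fin.
have : K * (energy mu p X (fun x => complex.Re (u x)) + energy mu p X (fun x => complex.Im (u x))) <= K * (2 * (m%:R * (d + a))).
  by rewrite ler_wpM2l// mulr_natl mulr2n lerD.
have : e = d * (4 + 2 * m%:R * K) by rewrite /d divfK// gt_eqF.
move: d0; move: (energy _ _ _ _ + _) => en d0 -> h.
nra.
Qed.

End poincare.

Theorem corollary7p16 (R : realType) (n : nat) (G : lieGroupType R n)
    (hconn : connected [set: G]) (hcomp : compact [set: G])
    (mu : probability (borel G) R) (hmu : normalized_haar mu)
    (m : nat) (X : 'I_m -> vfield R G) (hX : hormander X)
    (p : R) (hp : 1 < p) :
  exists C : R, forall (f : G -> R[i]) (g : G -> 'rV[R[i]]_m),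
    nabla_p mu X p f g ->
    (normLp mu p (fun x => f x - mean mu f)%R <= C%:E * normLp_lp mu p g)%E.
Proof.
have [K K0 hK] := transport_cost_bounded hcomp hmu hp hX hconn.
have vX i : vector_field (X i) by case: hX => h _ _; case: (h i).
by exists (2 * m%:R * K) => f g; exact: (closure_poincare hcomp hmu hp vX K0 hK).
Qed.
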